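(* Let $k$ be an algebraically closed field and let $\mathcal{C}$ be a connected, skeletal finite EI category such that for every object $x$ the order of the finite group $\mathrm{Aut}_{\mathcal{C}}(x)$ is invertible in $k$. Let $Q$ be the associated quiver of $\mathcal{C}$ (constructed by the four-step procedure given in the context). Then $Q$ is precisely (isomorphic to) the ordinary quiver of the category algebra $k\mathcal{C}$. Moreover, $k\mathcal{C}$ has the same ordinary quiver as $k\hat{\mathcal{C}}$, the category algebra of the free EI cover $\hat{\mathcal{C}}$ of $\mathcal{C}$.
   Context: Conventions. A finite EI category is a small category with finitely many morphisms in which every endomorphism is an isomorphism. It is skeletal if isomorphic objects are equal, and connected if any two objects are joined by a finite chain of objects in which consecutive ones have a morphism between them in some direction. Composition is from right to left. For a skeletal finite EI category, isomorphisms, endomorphisms and automorphisms coincide. The category algebra $k\mathcal{C}$ has the morphisms of $\mathcal{C}$ as a $k$-basis, with product $\alpha*\beta=\alpha\circ\beta$ if composable and $0$ otherwise. Modules are finitely generated left modules. $\uparrow$ and $\downarrow$ denote induction and restriction of modules between group algebras. Ordinary quiver of a finite dimensional algebra $A$: vertices are the isomorphism classes $[Ae]$ of indecomposable projective $A$-modules ($e$ a primitive idempotent), and the number of arrows $[Ae_1]\to[Ae_2]$ is $\dim_k e_2(\mathrm{rad}A/\mathrm{rad}^2A)e_1$. Unfactorizable morphisms. A morphism $\alpha$ is unfactorizable if it is not an isomorphism and whenever $\alpha=\gamma\beta$, either $\beta$ or $\gamma$ is an isomorphism. For $x\ne y$ the set of unfactorizable morphisms $x\to y$ is an $(\mathrm{Aut}_{\mathcal{C}}(y),\mathrm{Aut}_{\mathcal{C}}(x))$-biset.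 Choosing one element from each orbit, for all pairs $(x,y)$, gives the set of representative unfactorizable morphisms. Finite free EI categories. A finite EI quiver is a datum $\hat Q=(Q_0,Q_1,s,t,f,g)$ where $(Q_0,Q_1,s,t)$ is a finite acyclic quiver, $f$ assigns a finite group $f(v)$ to each vertex $v$, and $g$ assigns an $(f(t(\alpha)),f(s(\alpha)))$-biset to each arrow $\alpha$. It generates a category $\mathcal{C}_{\hat Q}$ with object set $Q_0$, $\mathrm{End}(v)=f(v)$, and, for $v\neq w$, $\mathrm{Hom}(v,w)=\bigsqcup_\gamma H_\gamma$ over all directed paths $\gamma$ from $v$ to $w$, where for $\gamma$ the path $v=v_0\xrightarrow{\alpha_1}v_1\to\cdots\xrightarrow{\alpha_n}v_n=w$, $H_\gamma=g(\alpha_n)\times_{f(v_{n-1})}\cdots\times_{f(v_1)}g(\alpha_1)$ (biset product: $X\times_K Y=(X\times Y)/((xk,y)\sim(x,ky))$). Composition is induced by the natural maps $H_{\gamma_2}\times H_{\gamma_1}\to H_{\gamma_2}\times_{f(v)}H_{\gamma_1}=H_{\gamma_2\gamma_1}$ and by the group multiplications and actions. A finite EI category is a finite free EI category if it is isomorphic to some $\mathcal{C}_{\hat Q}$. Free EI cover. The free EI cover $\hat{\mathcal{C}}$ of $\mathcal{C}$ is the finite free EI category, unique up to isomorphism, admitting a full functor $\hat F:\hat{\mathcal{C}}\to\mathcal{C}$ such that $\hat{\mathcal{C}}$ and $\mathcal{C}$ have the same objects, isomorphisms and unfactorizable morphisms and $\hat F$ is the identity on these. Explicitly, $\hat{\mathcal{C}}=\mathcal{C}_{\hat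 Q}$ where $\hat Q$ has as vertices the objects of $\mathcal{C}$, one arrow $x\to y$ for each representative unfactorizable morphism $\alpha:x\to y$, $f(x)=\mathrm{Aut}_{\mathcal{C}}(x)$, and $g$ of that arrow is the biset orbit $\mathrm{Aut}_{\mathcal{C}}(y)\,\alpha\,\mathrm{Aut}_{\mathcal{C}}(x)$. Associated quiver $Q$ of $\mathcal{C}$ (all group orders invertible in $k$). Step 1: The vertex set is $\bigsqcup_{x\in\mathrm{Ob}(\mathcal{C})}S_x$, where $S_x$ is a set of representatives of isomorphism classes of simple $k\mathrm{Aut}_{\mathcal{C}}(x)$-modules. Step 2: For a representative unfactorizable morphism $\alpha:x\to y$ put $G=\mathrm{Aut}_{\mathcal{C}}(x)$, $H=\mathrm{Aut}_{\mathcal{C}}(y)$, $G_0=\{g\in G:\alpha g=\alpha\}$, $H_0=\{h\in H:h\alpha=\alpha\}$, $G_1=\{g\in G:\exists h\in H,\ \alpha g=h\alpha\}$, $H_1=\{h\in H:\exists g\in G,\ h\alpha=\alpha g\}$. Then $G_0\lhd G_1$, $H_0\lhd H_1$, and $gG_0\mapsto hH_0$ whenever $\alpha g=h\alpha$ defines an isomorphism $G_1/G_0\cong H_1/H_0$, by which these groups are identified. Let $U_1,\dots,U_r$ be the pairwise non-isomorphic simple summands of $k\uparrow_{G_0}^{G_1}\cong k(G_1/G_0)$; each is regarded both as a $kG_1$-module and as a $kH_1$-module. Step 3: For each simple $kG$-module $V\in S_x$ and each simple $kH$-module $W\in S_y$ write $V\downarrow^G_{G_1}\cong U_1^{e_1}\oplus\cdots\oplus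 U_r^{e_r}\oplus X$ and $W\downarrow^H_{H_1}\cong U_1^{f_1}\oplus\cdots\oplus U_r^{f_r}\oplus Y$, where $X$ and $Y$ have no summand isomorphic to any $U_i$. Put $\sum_{i=1}^r e_if_i$ arrows from $V$ to $W$. Step 4: Do this for all representative unfactorizable morphisms, accumulating the arrows. *)

(* Defs.v *)
From HB Require Import structures.
From mathcomp Require Import all_boot all_order all_algebra all_fingroup.
From mathcomp Require Import all_solvable all_field all_character.
From mathcomp Require Import generic_quotient boolp.

Set Implicit Arguments.
Unset Strict Implicit.
Unset Printing Implicit Defensive.

Import GRing.Theory.
Local Open Scope ring_scope.
Local Open Scope quotient_scope.

Record eicat := EICat {
  Ob : finType;
  Hom : Ob -> Ob -> finType;
  idH : forall x, Hom x x;
  cmp : forall x y z, Hom y z -> Hom x y -> Hom x z;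
  cmpA : forall x y z w (h : Hom z w) (g : Hom y z) (f : Hom x y),
    cmp h (cmp g f) = cmp (cmp h g) f;
  cmp1m : forall x y (f : Hom x y), cmp (idH y) f = f;
  cmpm1 : forall x y (f : Hom x y), cmp f (idH x) = f;
  endo_iso : forall x (f : Hom x x),
    exists g : Hom x x, cmp g f = idH x /\ cmp f g = idH x
}.

Arguments Hom {e} x y.
Arguments idH {e} x.
Arguments cmp {e x y z} _ _.

Notation "g ∘ f" := (cmp g f) (at level 40, left associativity).

Section Categories.

Variable C : eicat.
Implicit Types x y z : Ob C.

Definition is_iso x y (f : Hom x y) :=
  [exists g : Hom y x, (g ∘ f == idH x) && (f ∘ g == idH y)].

Definition skeletal := forall x y (f : Hom x y), is_iso f -> x = y.

Definition linked x y := (0 < #|Hom x y|)%N || (0 < #|Hom y x|)%N.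

Definition connected_cat := forall x y, connect linked x y.

Definition unfactorizable x y (f : Hom x y) :=
  ~~ is_iso f &&
  [forall z, forall h : Hom x z, forall g : Hom z y,
     (f == g ∘ h) ==> (is_iso h || is_iso g)].

(* In an EI category every endomorphism is an automorphism. *)
Definition autC x : Type := Hom x x.

HB.instance Definition _ x := Finite.on (autC x).

Definition aut_inv x (f : autC x) : autC x :=
  odflt f [pick g : autC x | g ∘ f == idH x].

Fact aut_mulA x : associative (fun g f : autC x => g ∘ f : autC x).
Proof. by move=> h g f; apply: cmpA. Qed.

Fact aut_mul1 x : left_id (idH x) (fun g f : autC x => g ∘ f : autC x).
Proof. by move=> f; apply: cmp1m. Qed.

Fact aut_mulV x :
  left_inverse (idH x) (@aut_inv x) (fun g f : autC x => g ∘ f : autC x).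
Proof.
move=> f; rewrite /aut_inv; case: pickP => [g /eqP // | no_g].
by have [g [gf _]] := endo_iso f; move: (no_g g); rewrite /= gf eqxx.
Qed.

HB.instance Definition _ x :=
  Finite_isGroup.Build (autC x) (@aut_mulA x) (@aut_mul1 x) (@aut_mulV x).

Lemma autME x (g f : autC x) : (g * f)%g = g ∘ f.
Proof. by []. Qed.

Lemma aut1E x : (1%g : autC x) = idH x.
Proof. by []. Qed.

Definition biorbit x y (f : Hom x y) : {set Hom x y} :=
  [set f' | [exists h : autC y, exists g : autC x, f' == h ∘ f ∘ g]].

Fact biorbitP x y (r f : Hom x y) :
  reflect (exists h : autC y, exists g : autC x, f = h ∘ r ∘ g)
          (f \in biorbit r).
Proof.
rewrite inE; apply: (iffP existsP) => [[h /existsP[g /eqP ->]] | [h [g ->]]].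
  by exists h, g.
by exists h; apply/existsP; exists g.
Qed.

Record unfact_reps := UnfactReps {
  rep_set :> forall x y, {set Hom x y};
  rep_unfact : forall x y (f : Hom x y), f \in rep_set x y -> unfactorizable f;
  rep_uniq : forall x y (f : Hom x y), unfactorizable f ->
    exists! r : Hom x y, r \in rep_set x y /\ f \in biorbit r
}.

Fact biorbit_refl x y (f : Hom x y) : f \in biorbit f.
Proof.
by apply/biorbitP; exists 1%g, 1%g; rewrite !aut1E cmp1m cmpm1.
Qed.

Fact biorbit_sym x y (r f : Hom x y) : f \in biorbit r -> r \in biorbit f.
Proof.
case/biorbitP=> h [g ->]; apply/biorbitP; exists (h^-1)%g, (g^-1)%g.
rewrite -!cmpA -autME mulgV aut1E cmpm1 cmpA -autME mulVg.
by rewrite aut1E cmp1m.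
Qed.

Fact biorbit_trans x y (q r f : Hom x y) :
  r \in biorbit q -> f \in biorbit r -> f \in biorbit q.
Proof.
case/biorbitP=> h [g ->] /biorbitP[h' [g' ->]]; apply/biorbitP.
by exists (h' * h)%g, (g * g')%g; rewrite !autME !cmpA.
Qed.

Lemma unfact_reps_exist : inhabited unfact_reps.
Proof.
pose cand x y (f : Hom x y) :=
  [pred f' : Hom x y | (f' \in biorbit f) && unfactorizable f'].
pose rep x y (f : Hom x y) := odflt f (pick (cand x y f)).
have repP x y (f : Hom x y) : unfactorizable f -> cand x y f (rep x y f).
  move=> unf_f; rewrite /rep; case: pickP => // /(_ f).
  by rewrite /= biorbit_refl unf_f.
have rep_eq x y (f r : Hom x y) :
    unfactorizable f -> f \in biorbit r -> rep x y f = rep x y r.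
  move=> unf_f fr; rewrite /rep (@eq_pick _ (cand x y f) (cand x y r)).
    case: pickP => // /(_ f); by rewrite /= fr unf_f.
  move=> f' /=; congr (_ && _); apply/idP/idP; first exact: biorbit_trans.
  exact: biorbit_trans (biorbit_sym fr).
pose R x y := [set r : Hom x y | unfactorizable r && (rep x y r == r)].
constructor; apply: (@UnfactReps R) => x y f.
  by rewrite inE => /andP[].
move=> unf_f; have /andP[/= rf unf_r] := repP x y f unf_f.
exists (rep x y f); split=> [|r [+ fr]].
  by rewrite inE unf_r (rep_eq _ _ _ f) // eqxx; split; last exact: biorbit_sym.
by rewrite inE => /andP[_ /eqP <-]; apply: rep_eq.
Qed.

Definition mor : Type := {x : Ob C & {y : Ob C & Hom x y}}.
HB.instance Definition _ := Finite.on mor.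

Definition Mor x y (f : Hom x y) : mor :=
  Tagged (fun x => {y : Ob C & Hom x y}) (Tagged (fun y => Hom x y) f).
Definition mdom (m : mor) : Ob C := tag m.
Definition mcod (m : mor) : Ob C := tag (tagged m).
Definition marr (m : mor) : Hom (mdom m) (mcod m) := tagged (tagged m).

End Categories.

Record biset (A B : finGroupType) := Biset {
  bs_sort :> finType;
  lact : A -> bs_sort -> bs_sort;
  ract : bs_sort -> B -> bs_sort;
  lact1 : forall x, lact 1%g x = x;
  lactM : forall a b x, lact (a * b)%g x = lact a (lact b x);
  ract1 : forall x, ract x 1%g = x;
  ractM : forall x a b, ract x (a * b)%g = ract (ract x a) b;
  lractA : forall a x b, lact a (ract x b) = ract (lact a x) b
}.

Section RegularBiset.

Variable A : finGroupType.

Definition reg_biset : biset A A.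
Proof.
refine (@Biset A A A (fun a x => a * x)%g (fun x a => x * a)%g _ _ _ _ _).
- by move=> x; rewrite mul1g.
- by move=> a b x; rewrite mulgA.
- by move=> x; rewrite mulg1.
- by move=> x a b; rewrite mulgA.
- by move=> a x b; rewrite mulgA.
Defined.

End RegularBiset.

Section BisetProduct.

Variables (A K B : finGroupType) (X : biset A K) (Y : biset K B).

Definition bprod_rel (p q : X * Y) :=
  [exists k : K, (p.1 == ract q.1 k) && (q.2 == lact k p.2)].

Fact bprod_relP (p q : X * Y) :
  reflect (exists k : K, p.1 = ract q.1 k /\ q.2 = lact k p.2) (bprod_rel p q).
Proof.
apply: (iffP existsP) => [[k /andP[/eqP ? /eqP ?]] | [k [e1 e2]]].
  by exists k.
by exists k; rewrite -e1 -e2 !eqxx.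
Qed.

Fact bprod_rel_refl : reflexive bprod_rel.
Proof. by move=> p; apply/bprod_relP; exists 1%g; rewrite ract1 lact1. Qed.

Fact bprod_rel_symL p q : bprod_rel p q -> bprod_rel q p.
Proof.
case/bprod_relP=> k [e1 e2]; apply/bprod_relP; exists k^-1%g.
by rewrite e1 -ractM mulgV ract1 e2 -lactM mulVg lact1.
Qed.

Fact bprod_rel_sym : symmetric bprod_rel.
Proof. by move=> p q; apply/idP/idP; apply: bprod_rel_symL. Qed.

Fact bprod_rel_trans : transitive bprod_rel.
Proof.
move=> q p r /bprod_relP[k [e1 e2]] /bprod_relP[l [e3 e4]].
apply/bprod_relP; exists (l * k)%g.
by rewrite e1 e3 -ractM e4 e2 -lactM.
Qed.

Canonical bprod_equiv :=
  EquivRel bprod_rel bprod_rel_refl bprod_rel_sym bprod_rel_trans.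

Definition bprod_type : Type := {eq_quot bprod_rel}.
HB.instance Definition _ := EqQuotient.on bprod_type.

Definition bpair (x : X) (y : Y) : bprod_type := \pi_bprod_type (x, y).

Lemma bpairE x y x' y' :
  bpair x y = bpair x' y' <->
  exists k : K, x = ract x' k /\ y' = lact k y.
Proof.
split=> [/eqP|eq_xy].
  by rewrite /bpair eqmodE /= => /bprod_relP.
by apply/eqP; rewrite /bpair eqmodE /=; apply/bprod_relP.
Qed.

Lemma bpairP (z : bprod_type) : exists x y, z = bpair x y.
Proof.
by exists (repr z).1, (repr z).2; rewrite /bpair -surjective_pairing reprK.
Qed.

Lemma bpair_rep x y : exists k : K,
  x = ract (repr (bpair x y)).1 k /\ (repr (bpair x y)).2 = lact k y.
Proof.
by apply/bpairE; rewrite /bpair -surjective_pairing reprK.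
Qed.

Definition bprod_lact (a : A) (z : bprod_type) :=
  bpair (lact a (repr z).1) (repr z).2.

Definition bprod_ract (z : bprod_type) (b : B) :=
  bpair (repr z).1 (ract (repr z).2 b).

Lemma bprod_lactE a x y : bprod_lact a (bpair x y) = bpair (lact a x) y.
Proof.
apply/esym/bpairE; have [k [e1 e2]] := bpair_rep x y; exists k.
by rewrite -lractA -e1.
Qed.

Lemma bprod_ractE x y b : bprod_ract (bpair x y) b = bpair x (ract y b).
Proof.
apply/esym/bpairE; have [k [e1 e2]] := bpair_rep x y; exists k.
by rewrite lractA -e2.
Qed.

Definition bprod : biset A B.
Proof.
refine (@Biset A B (quot_type bprod_type) bprod_lact bprod_ract _ _ _ _ _).
- by move=> z; have [x [y ->]] := bpairP z; rewrite bprod_lactE lact1.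
- move=> a b z; have [x [y ->]] := bpairP z.
  by rewrite !bprod_lactE lactM.
- by move=> z; have [x [y ->]] := bpairP z; rewrite bprod_ractE ract1.
- move=> z a b; have [x [y ->]] := bpairP z.
  by rewrite !bprod_ractE ractM.
- move=> a z b; have [x [y ->]] := bpairP z.
  by rewrite !(bprod_ractE, bprod_lactE).
Defined.

End BisetProduct.

Definition arrow_rel (V E : finType) (s t : E -> V) : rel V :=
  [rel x y | [exists a, (s a == x) && (t a == y)]].

Record eiquiver := EIQuiver {
  Q0 : finType;
  Q1 : finType;
  src : Q1 -> Q0;
  tgt : Q1 -> Q0;
  acyclicQ : forall a, ~~ connect (arrow_rel src tgt) (tgt a) (src a);
  vgrp : Q0 -> finGroupType;
  abis : forall a, biset (vgrp (tgt a)) (vgrp (src a))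
}.

Arguments src {e} a.
Arguments tgt {e} a.
Arguments vgrp {e} v.
Arguments abis {e} a.

Section GeneratedCategory.

Variable Q : eiquiver.
Implicit Types u v w : Q0 Q.

Inductive qpath v : Q0 Q -> Type :=
  | pnil : qpath v v
  | pcons (a : Q1 Q) : qpath v (src a) -> qpath v (tgt a).

Fixpoint pcat v w (p : qpath v w) u : qpath u v -> qpath u w :=
  match p in qpath _ w return qpath u v -> qpath u w with
  | pnil => id
  | pcons a p' => fun q => pcons (pcat p' q)
  end.

(* The arrows of a path, last one first. *)
Fixpoint parrows v w (p : qpath v w) : seq (Q1 Q) :=
  if p is pcons a p' then a :: parrows p' else [::].

Fixpoint parse v (s : seq (Q1 Q)) : option {w & qpath v w} :=
  if s is a :: s' then
    if parse v s' is Some (existT w p) then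
      if w =P src a is ReflectT e then
        Some (existT _ (tgt a) (pcons (eq_rect w (qpath v) p (src a) e)))
      else None
    else None
  else Some (existT _ v (pnil v)).

Fact parrowsK v w (p : qpath v w) :
  parse v (parrows p) = Some (existT (qpath v) w p).
Proof.
elim: p => //= a p ->; case: eqP => // e.
by rewrite (eq_irrelevance e erefl).
Qed.

Fact parrows_connect v w (p : qpath v w) :
  (connect (arrow_rel src tgt) v w) *
  (forall a, a \in parrows p -> connect (arrow_rel src tgt) (tgt a) w).
Proof.
elim: p => /= [|a p [IHv IHa]]; first by split; [exact: connect0|].
have step: connect (arrow_rel src tgt) (src a) (tgt a).
  by apply/connect1/existsP; exists a; rewrite !eqxx.
split=> [|b]; first exact: connect_trans IHv step.
rewrite inE => /predU1P[-> | /IHa ba]; first exact: connect0.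
exact: connect_trans ba step.
Qed.

Fact parrows_uniq v w (p : qpath v w) : uniq (parrows p).
Proof.
elim: p => //= a p ->; rewrite andbT; apply/negP => a_p.
by have := acyclicQ a; rewrite (parrows_connect p).2.
Qed.

Fact parrows_size v w (p : qpath v w) : (size (parrows p) <= #|Q1 Q|)%N.
Proof. by rewrite -(card_uniqP (parrows_uniq p)) max_card. Qed.

Definition penc v w (p : qpath v w) : #|Q1 Q|.-bseq (Q1 Q) :=
  Bseq (parrows_size p).

Definition pdec v w (s : #|Q1 Q|.-bseq (Q1 Q)) : option (qpath v w) :=
  if parse v s is Some (existT w' p) then
    if w' =P w is ReflectT e then Some (eq_rect w' (qpath v) p w e) else None
  else None.

Fact pencK v w : pcancel (@penc v w) (@pdec v w).
Proof.
move=> p; rewrite /pdec /= parrowsK; case: eqP => // e.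
by rewrite (eq_irrelevance e erefl).
Qed.

HB.instance Definition _ v w := Finite.copy (qpath v w) (pcan_type (@pencK v w)).

(* [hset p] is the biset H_p; the trivial path contributes the group of its
   vertex, and a one-arrow path [a] contributes
   abis a x_(vgrp (src a)) vgrp (src a), canonically isomorphic to abis a. *)
Fixpoint hset v w (p : qpath v w) : biset (vgrp w) (vgrp v) :=
  match p in qpath _ w return biset (vgrp w) (vgrp v) with
  | pnil => reg_biset (vgrp v)
  | pcons a p' => bprod (abis a) (hset p')
  end.

(* The natural map H_p x H_q -> H_(p q), which multiplies the group element
   ending a word of H_p into a word of H_q. *)
Fixpoint hmul v w (p : qpath v w) u (q : qpath u v) :
    hset p -> hset q -> hset (pcat p q) :=
  match p return hset p -> hset q -> hset (pcat p q) with
  | pnil => fun h y => lact h y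
  | pcons a p' => fun (z : bprod_type (abis a) (hset p')) y =>
      bpair (repr z).1 (hmul (repr z).2 y)
  end.

Lemma hmul_pair a v (p : qpath v (src a)) u (q : qpath u v) (x : abis a)
    (m : hset p) (y : hset q) :
  (forall k (m : hset p), hmul (lact k m) y = lact k (hmul m y)) ->
  hmul (p := pcons p) (bpair x m : hset (pcons p)) y =
  bpair x (hmul m y) :> bprod_type (abis a) (hset (pcat p q)).
Proof.
move=> hm; have [k [e1 e2]] := bpair_rep x m.
apply/esym/bpairE; exists k; split=> //.
by rewrite -hm -e2.
Qed.

Lemma hmul_lact v w (p : qpath v w) u (q : qpath u v) k (m : hset p)
    (y : hset q) :
  hmul (lact k m) y = lact k (hmul m y).
Proof.
elim: p k m => [|a p IHp] k m; first exact: lactM.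
have hm k' (m' : hset p) := IHp k' m'.
have [x [m1 ->]] := bpairP m.
rewrite [lact k _](bprod_lactE k x m1) (hmul_pair _ _ hm) (hmul_pair _ _ hm).
by rewrite [RHS](bprod_lactE k x (hmul m1 y)).
Qed.

Lemma hmulE a v (p : qpath v (src a)) u (q : qpath u v) (x : abis a)
    (m : hset p) (y : hset q) :
  hmul (p := pcons p) (bpair x m : hset (pcons p)) y =
  bpair x (hmul m y) :> bprod_type (abis a) (hset (pcat p q)).
Proof. by apply: hmul_pair => k m'; apply: hmul_lact. Qed.

Definition gen_hom v w : finType := {p : qpath v w & hset p}.

Definition gen_arr v w (p : qpath v w) (m : hset p) : gen_hom v w :=
  Tagged (fun p => hset p) m.

Definition gen_id v : gen_hom v v := @gen_arr v v (pnil v) (1%g : vgrp v).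

Definition gen_cmp u v w (g : gen_hom v w) (f : gen_hom u v) : gen_hom u w :=
  gen_arr (hmul (tagged g) (tagged f)).

Definition gen_cons a v (x : abis a) (f : gen_hom v (src a)) :
    gen_hom v (tgt a) :=
  @gen_arr v (tgt a) (pcons (tag f)) (bpair x (tagged f)).

Lemma gen_cmp_cons a u v (x : abis a) (g : gen_hom v (src a))
    (f : gen_hom u v) :
  gen_cmp (gen_cons x g) f = gen_cons x (gen_cmp g f).
Proof.
by congr existT; apply: (hmulE x (tagged g) (tagged f)).
Qed.

Lemma gen_homP v (P : forall w, gen_hom v w -> Prop) w (f : gen_hom v w) :
  (forall h : vgrp v, P v (@gen_arr v v (pnil v) h)) ->
  (forall a (x : abis a) (g : gen_hom v (src a)),
     P (src a) g -> P (tgt a) (gen_cons x g)) ->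
  P w f.
Proof.
move=> Pnil Pcons; case: f => p; elim: p => [|a p IHp] m; first exact: Pnil.
have [x [m1 ->]] := bpairP m.
exact: (Pcons a x (gen_arr m1) (IHp m1)).
Qed.

Fact gen_cmp1m v w (f : gen_hom v w) : gen_cmp (gen_id w) f = f.
Proof. by case: f => p m; rewrite /gen_cmp /= lact1. Qed.

Fact gen_cmpm1 v w (f : gen_hom v w) : gen_cmp f (gen_id v) = f.
Proof.
elim/gen_homP: w / f => [h | a x g IHg].
  by rewrite /gen_cmp /= mulg1.
by rewrite gen_cmp_cons IHg.
Qed.

Fact gen_cmpA v w x y (h : gen_hom x y) (g : gen_hom w x) (f : gen_hom v w) :
  gen_cmp h (gen_cmp g f) = gen_cmp (gen_cmp h g) f.
Proof.
elim/gen_homP: y / h => [h | a z h IHh].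
  by case: g f => p m [q n]; rewrite /gen_cmp /= /gen_arr hmul_lact.
by rewrite !gen_cmp_cons IHh.
Qed.

Fact gen_endo_iso v (f : gen_hom v v) :
  exists g, gen_cmp g f = gen_id v /\ gen_cmp f g = gen_id v.
Proof.
suffices [h ->]: exists h : vgrp v, f = @gen_arr v v (pnil v) h.
  exists (@gen_arr v v (pnil v) h^-1%g).
  by rewrite /gen_cmp /gen_id /= mulVg mulgV.
suffices nil_loop w (p : qpath v w) (m : hset p) (e : w = v) :
    exists h : vgrp v,
      eq_rect w (gen_hom v) (gen_arr m) v e = @gen_arr v v (pnil v) h.
  by case: f => p m; exact: (nil_loop v p m erefl).
case: p m e => [|a p] m e; first by exists m; rewrite (eq_irrelevance e erefl).
have /negP[] := acyclicQ a; rewrite [X in connect _ X _]e.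
exact: (parrows_connect p).1.
Qed.

Definition gen_cat : eicat :=
  EICat gen_cmpA gen_cmp1m gen_cmpm1 gen_endo_iso.

End GeneratedCategory.

Section FreeCover.

Variables (C : eicat) (R : unfact_reps C).
Implicit Types x y : Ob C.

Section OrbitBiset.

Variables (x y : Ob C) (r : Hom x y).

Definition orbit_type := {f : Hom x y | f \in biorbit r}.

Fact orbit_lactP (h : autC y) (f : orbit_type) : h ∘ val f \in biorbit r.
Proof.
apply/biorbitP; have /biorbitP[h' [g ->]] := valP f.
by exists (h * h')%g, g; rewrite autME !cmpA.
Qed.

Fact orbit_ractP (f : orbit_type) (g : autC x) : val f ∘ g \in biorbit r.
Proof.
apply/biorbitP; have /biorbitP[h [g' ->]] := valP f.
by exists h, (g' * g)%g; rewrite autME !cmpA.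
Qed.

Definition orbit_biset : biset (autC y) (autC x).
Proof.
refine (@Biset (autC y) (autC x) orbit_type
  (fun (h : autC y) f => Sub (h ∘ val f) (orbit_lactP h f))
  (fun f (g : autC x) => Sub (val f ∘ g) (orbit_ractP f g))
  _ _ _ _ _).
- by move=> f; apply: val_inj; rewrite !SubK aut1E cmp1m.
- by move=> a b f; apply: val_inj; rewrite !SubK autME cmpA.
- by move=> f; apply: val_inj; rewrite !SubK aut1E cmpm1.
- by move=> f a b; apply: val_inj; rewrite !SubK autME cmpA.
- by move=> a f b; apply: val_inj; rewrite !SubK cmpA.
Defined.

End OrbitBiset.

Definition cover_arrow := {m : mor C | marr m \in R (mdom m) (mcod m)}.

Definition cover_src (a : cover_arrow) : Ob C := mdom (val a).
Definition cover_tgt (a : cover_arrow) : Ob C := mcod (val a).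

Fact cover_connect x y :
  connect (arrow_rel cover_src cover_tgt) x y -> exists f : Hom x y, True.
Proof.
case/connectP=> p; elim: p x => [|z p IHp] x /= => [_ ->|].
  by exists (idH x).
case/andP=> /existsP[a /andP[/eqP <- /eqP <-]] /IHp{}IHp /IHp[f _].
by exists (f ∘ marr (val a)).
Qed.

Lemma loop_isom x y (f : Hom x y) (g : Hom y x) : is_iso f.
Proof.
have [a [agf _]] := endo_iso (g ∘ f); have [b [_ fgb]] := endo_iso (f ∘ g).
apply/existsP; exists (a ∘ g); rewrite -cmpA agf eqxx /=.
suffices ->: a ∘ g = g ∘ b by rewrite cmpA fgb.
rewrite -[LHS]cmpm1 -fgb -!cmpA [g ∘ _]cmpA !cmpA -[a ∘ g ∘ f]cmpA agf.
by rewrite cmp1m.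
Qed.

Fact cover_acyclic (a : cover_arrow) :
  ~~ connect (arrow_rel cover_src cover_tgt) (cover_tgt a) (cover_src a).
Proof.
apply/negP=> /cover_connect[f _].
have /andP[/negP not_iso _] := rep_unfact (valP a).
by apply: not_iso; apply: loop_isom f.
Qed.

Definition cover_quiver : eiquiver :=
  @EIQuiver (Ob C) cover_arrow cover_src cover_tgt cover_acyclic
    (fun x => autC x) (fun a => orbit_biset (marr (val a))).

Definition free_cover : eicat := gen_cat cover_quiver.

End FreeCover.

(* MathComp's algebras are nonzero rings; the zero algebra is kept here, as it
   is the category algebra of the empty category. *)
Record fdalg (k : fieldType) := FDAlg {
  fda_sort :> vectType k;
  fda_mul : fda_sort -> fda_sort -> fda_sort;
  fda_one : fda_sort;
  fda_mulA : associative fda_mul;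
  fda_mul1 : left_id fda_one fda_mul;
  fda_mulr1 : right_id fda_one fda_mul;
  fda_linearl : forall a, linear (fda_mul^~ a);
  fda_linearr : forall a, linear (fda_mul a)
}.

Arguments fda_mul {k f} a b : rename.

Notation "a ⋆ b" := (fda_mul a b) (at level 40, left associativity).

Section Radical.

Variables (k : fieldType) (A : fdalg k).
Implicit Types (a b e f : A) (I J M N : {vspace A}).

(* A being unital, its left ideals are subspaces. *)
Definition left_ideal I := forall a b, b \in I -> a ⋆ b \in I.

Definition maximal_left_ideal M :=
  [/\ left_ideal M, M <> fullv &
   forall N, left_ideal N -> (M <= N)%VS -> N = M \/ N = fullv].

Lemma radical_exists : exists J,
  forall a, a \in J <-> (forall M, maximal_left_ideal M -> a \in M).
Proof.
pose meet J := exists2 s : seq {vspace A},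
  forall M, M \in s -> maximal_left_ideal M & J = (\bigcap_(M <- s) M)%VS.
pose has_dim n := `[< exists2 J, meet J & \dim J = n >].
have exd : exists n, has_dim n.
  exists (\dim {:A}); apply/asboolP; exists fullv => //.
  by exists [::] => //; rewrite big_nil.
case: (ex_minnP exd) => n /asboolP[J [s max_s defJ] dimJ] min_n.
exists J => a; split=> [aJ M maxM | aM].
  suffices sJM : (J <= J :&: M)%VS.
    by apply: subvP a aJ; apply: subv_trans sJM (capvSr _ _).
  rewrite -(geq_leqif (dimv_leqif_sup (capvSl J M))) dimJ.
  apply: min_n; apply/asboolP; exists (J :&: M)%VS => //.
  exists (M :: s) => [N|]; last by rewrite big_cons capvC defJ.
  by rewrite inE => /predU1P[-> | /max_s].
rewrite defJ; elim: s max_s {defJ} => [|M s IHs] max_s.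
  by rewrite big_nil memvf.
rewrite big_cons memv_cap; apply/andP; split.
  by apply/aM/max_s; rewrite mem_head.
by apply: IHs => N sN; apply: max_s; rewrite inE sN orbT.
Qed.

Definition radical : {vspace A} := projT1 (cid radical_exists).

Lemma radicalP a :
  a \in radical <-> (forall M, maximal_left_ideal M -> a \in M).
Proof. exact: projT2 (cid radical_exists) a. Qed.

(* The ideal product, spanned by the products a ⋆ b. *)
Definition vmul I J : {vspace A} :=
  <<[seq a ⋆ b | a <- vbasis I, b <- vbasis J]>>%VS.

Definition is_idempotent e := e ⋆ e = e.

Definition primitive_idempotent e :=
  [/\ e <> 0, is_idempotent e &
   forall f g, is_idempotent f -> is_idempotent g -> f ⋆ g = 0 -> g ⋆ f = 0 ->
     e = f + g -> f = 0 \/ g = 0].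

(* The left ideal A e, as an A-module. *)
Definition left_mod e : {vspace A} := limg (linfun (fda_mul^~ e)).

Lemma left_modP e b : reflect (exists a, b = a ⋆ e) (b \in left_mod e).
Proof.
have lin a : linfun (fda_mul^~ e) a = a ⋆ e.
  pose l := GRing.isLinear.Build _ _ _ _ (fda_mul^~ e) (fda_linearl e).
  pose L : {linear A -> A} := HB.pack (fda_mul^~ e) l.
  exact: (lfunE L a).
apply: (iffP memv_imgP) => [[a _ ->] | [a ->]]; exists a; rewrite ?memvf //.
Qed.

Definition module_hom e f (phi : 'Hom(subvs_of (left_mod e),
                                      subvs_of (left_mod f))) :=
  forall a (u v : subvs_of (left_mod e)),
    vsval v = a ⋆ vsval u -> vsval (phi v) = a ⋆ vsval (phi u).

Definition left_mod_iso e f :=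
  exists2 phi : 'Hom(subvs_of (left_mod e), subvs_of (left_mod f)),
    bijective phi & module_hom phi.

Lemma left_mod_iso_refl e : left_mod_iso e e.
Proof.
exists \1%VF => [|a u v]; last by rewrite !id_lfunE.
by exists \1%VF => u; rewrite !id_lfunE.
Qed.

Lemma left_mod_iso_sym e f : left_mod_iso e f -> left_mod_iso f e.
Proof.
case=> phi [psi phiK psiK] hom_phi.
have ker_phi : lker phi == 0%VS by apply/lker0P; apply: can_inj phiK.
have invK : cancel phi (phi^-1)%VF := lker0_lfunK ker_phi.
have invE u : (phi^-1)%VF u = psi u by rewrite -{1}(psiK u) invK.
exists (phi^-1)%VF => [|a u v vE]; first by exists phi => u; rewrite invE.
rewrite !invE; have /left_modP[b ub] := subvsP (psi u).
have Aw : a ⋆ vsval (psi u) \in left_mod e.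
  by apply/left_modP; exists (a ⋆ b); rewrite ub fda_mulA.
pose w : subvs_of (left_mod e) := Subvs Aw.
suffices ->: v = phi w by rewrite phiK.
by apply: val_inj; rewrite /= vE -{1}(psiK u); apply/esym/hom_phi.
Qed.

Lemma left_mod_iso_trans e f g :
  left_mod_iso e f -> left_mod_iso f g -> left_mod_iso e g.
Proof.
case=> phi bphi hphi [psi bpsi hpsi]; exists (psi \o phi)%VF.
  have eq_comp : psi \o phi =1 (psi \o phi)%VF by move=> u; rewrite comp_lfunE.
  exact: eq_bij (bij_comp bpsi bphi) _ eq_comp.
by move=> a u v /hphi/hpsi; rewrite !comp_lfunE.
Qed.

End Radical.

(* Only the number of arrows between two vertices is recorded. *)
Record quiver := Quiver {
  vertex : Type;
  narrows : vertex -> vertex -> nat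
}.

Definition quiver_iso (P Q : quiver) :=
  exists2 phi : vertex P -> vertex Q, bijective phi &
  forall v w, narrows (phi v) (phi w) = narrows v w.

Section OrdinaryQuiver.

Variables (k : fieldType) (A : fdalg k).

Definition prim_idem := {e : A | `[< primitive_idempotent e >]}.

Definition prim_iso (e f : prim_idem) := `[< left_mod_iso (val e) (val f) >].

Fact prim_iso_refl : reflexive prim_iso.
Proof. by move=> e; apply/asboolP; apply: left_mod_iso_refl. Qed.

Fact prim_iso_sym : symmetric prim_iso.
Proof.
by move=> e f; apply/asboolP/asboolP; apply: left_mod_iso_sym.
Qed.

Fact prim_iso_trans : transitive prim_iso.
Proof.
by move=> f e g /asboolP ef /asboolP fg; apply/asboolP/(left_mod_iso_trans ef).
Qed.

Canonical prim_iso_equiv :=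
  EquivRel prim_iso prim_iso_refl prim_iso_sym prim_iso_trans.

Definition proj_class := {eq_quot prim_iso}.

(* f (rad A / rad^2 A) e is the image of f (rad A) e in rad A / rad^2 A. *)
Definition corner_dim (f e : A) : nat :=
  let J := radical A in
  let J2 := vmul J J in
  (\dim (<<[seq f ⋆ a ⋆ e | a <- vbasis J]>> + J2) - \dim J2)%N.

Definition ordinary_quiver : quiver :=
  @Quiver proj_class (fun P1 P2 => corner_dim (val (repr P2)) (val (repr P1))).

End OrdinaryQuiver.

Section CategoryAlgebra.

Variables (k : fieldType) (C : eicat).

Definition cat_alg_type : vectType k := {ffun mor C -> k^o}.
Implicit Types u v w : cat_alg_type.

(* A family u of coefficients stands for the sum of the u m * m over the
   morphisms m; the coefficient of a product at f : x -> z collects the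
   factorizations f = b ∘ a. *)
Definition cat_mul u v : cat_alg_type :=
  [ffun m => \sum_(y : Ob C) \sum_(b : Hom y (mcod m))
     \sum_(a : Hom (mdom m) y | b ∘ a == marr m) u (Mor b) * v (Mor a)].

Definition cat_one : cat_alg_type := [ffun m => (m == Mor (idH (mdom m)))%:R].

Fact sum_fiber (I J : finType) (f : I -> J) (G : I -> J -> k^o) :
  \sum_j \sum_(i | f i == j) G i j = \sum_i G i (f i).
Proof.
rewrite (exchange_big_dep predT) //=; apply: eq_bigr => i _.
by rewrite (big_pred1 (f i)) // => j; rewrite /= eq_sym.
Qed.

Fact cat_mulA : associative cat_mul.
Proof.
move=> u v w; apply/ffunP=> m; rewrite !ffunE.
pose x := mdom m; pose t := mcod m.
pose T y z (d : Hom z t) (c : Hom y z) (a : Hom x y) :=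
  u (Mor d) * v (Mor c) * w (Mor a).
transitivity (\sum_z \sum_(d : Hom z t) \sum_y \sum_(c : Hom y z)
    \sum_(a : Hom x y | d ∘ (c ∘ a) == marr m) T y z d c a).
  apply: eq_bigr => z _; apply: eq_bigr => d _.
  rewrite (eq_bigr (fun e => \sum_y \sum_(c : Hom y z)
      \sum_(a : Hom x y | c ∘ a == e) T y z d c a)) => [|e _]; last first.
    rewrite ffunE mulr_sumr; apply: eq_bigr => y _.
    rewrite mulr_sumr; apply: eq_bigr => c _.
    by rewrite mulr_sumr; apply: eq_bigr => a _; rewrite /T mulrA.
  rewrite exchange_big; apply: eq_bigr => y _ /=.
  rewrite exchange_big; apply: eq_bigr => c _ /=.
  rewrite (exchange_big_dep (fun a => d ∘ (c ∘ a) == marr m)) /=; last first.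
    by move=> e a /eqP <- /eqP ->.
  apply: eq_bigr => a /eqP ma; rewrite (big_pred1 (c ∘ a)) // => e /=.
  by rewrite [RHS]eq_sym; apply: andb_idl => /eqP <-; rewrite ma.
transitivity (\sum_y \sum_z \sum_(d : Hom z t) \sum_(c : Hom y z)
    \sum_(a : Hom x y | d ∘ c ∘ a == marr m) T y z d c a).
  rewrite exchange_big /=; apply: eq_bigr => z _.
  rewrite exchange_big /=; apply: eq_bigr => y _.
  apply: eq_bigr => d _; apply: eq_bigr => c _.
  by apply: eq_bigl => a; rewrite cmpA.
apply: eq_bigr => y _.
rewrite [RHS](eq_bigr (fun b => \sum_z \sum_(d : Hom z t)
    \sum_(c : Hom y z | d ∘ c == b)
      \sum_(a : Hom x y | b ∘ a == marr m) T y z d c a)) => [|b _]; last first.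
  rewrite [LHS](eq_bigr (fun a => \sum_z \sum_(d : Hom z t)
    \sum_(c : Hom y z | d ∘ c == b) T y z d c a)) => [|a _]; last first.
    rewrite ffunE mulr_suml; apply: eq_bigr => z _.
    rewrite mulr_suml; apply: eq_bigr => d _.
    by rewrite mulr_suml.
  rewrite exchange_big; apply: eq_bigr => z _ /=.
  rewrite exchange_big; apply: eq_bigr => d _ /=.
  by rewrite exchange_big.
rewrite [RHS]exchange_big; apply: eq_bigr => z _ /=.
rewrite [RHS]exchange_big; apply: eq_bigr => d _ /=.
by rewrite sum_fiber.
Qed.

Fact Mor_inj x y : injective (@Mor C x y).
Proof. by move=> f g /eqP; rewrite !eq_Tagged /= => /eqP. Qed.

Fact cat_mul1 : left_id cat_one cat_mul.
Proof.
move=> u; apply/ffunP=> m; rewrite !ffunE.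
rewrite (bigD1 (mcod m)) //= [X in _ + X]big1 => [|y /eqP ny]; last first.
  apply: big1 => b _; apply: big1 => a _; rewrite ffunE.
  case: eqP => [|_]; last by rewrite mul0r.
  by move/(congr1 (@mcod C))=> /= /esym.
rewrite addr0 (bigD1 (idH (mcod m))) //= [X in _ + X]big1 => [|b nb].
  rewrite addr0 (big_pred1 (marr m)) => [|a]; last by rewrite cmp1m.
  by rewrite ffunE eqxx mul1r; case: m => x [].
apply: big1 => a _; rewrite ffunE; case: eqP => [e|_]; last by rewrite mul0r.
by case/eqP: nb; apply: Mor_inj e.
Qed.

Fact cat_mulr1 : right_id cat_one cat_mul.
Proof.
move=> u; apply/ffunP=> m; rewrite !ffunE.
rewrite (bigD1 (mdom m)) //= [X in _ + X]big1 => [|y /eqP ny]; last first.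
  apply: big1 => b _; apply: big1 => a _; rewrite ffunE.
  case: eqP => [|_]; last by rewrite mulr0.
  by move/(congr1 (@mcod C)).
rewrite addr0 (bigD1 (marr m)) //= [X in _ + X]big1 => [|b nb].
  rewrite addr0 (bigD1 (idH (mdom m))) ?cmpm1 //= big1 => [|a /andP[_ na]].
    by rewrite addr0 ffunE eqxx mulr1; case: m => x [].
  rewrite ffunE; case: eqP => [e|_]; last by rewrite mulr0.
  by case/eqP: na; apply: Mor_inj e.
apply: big1 => a ba; rewrite ffunE; case: eqP => [e|_]; last by rewrite mulr0.
by case/eqP: nb; rewrite -(eqP ba) (Mor_inj e) cmpm1.
Qed.

Fact cat_linearl v : linear (cat_mul^~ v).
Proof.
move=> c u1 u2; apply/ffunP=> m; rewrite !ffunE /GRing.scale /= mulr_sumr.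
rewrite -big_split; apply: eq_bigr => y _ /=; rewrite mulr_sumr -big_split.
apply: eq_bigr => b _ /=; rewrite mulr_sumr -big_split; apply: eq_bigr => a _.
by rewrite /= !ffunE mulrDl mulrA.
Qed.

Fact cat_linearr u : linear (cat_mul u).
Proof.
move=> c v1 v2; apply/ffunP=> m; rewrite !ffunE /GRing.scale /= mulr_sumr.
rewrite -big_split; apply: eq_bigr => y _ /=; rewrite mulr_sumr -big_split.
apply: eq_bigr => b _ /=; rewrite mulr_sumr -big_split; apply: eq_bigr => a _.
by rewrite /= !ffunE mulrDr mulrCA.
Qed.

Definition cat_alg : fdalg k :=
  FDAlg cat_mulA cat_mul1 cat_mulr1 cat_linearl cat_linearr.

Definition cat_basis (m : mor C) : cat_alg := [ffun m' => (m' == m)%:R].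

Lemma cat_basisM x y z (g : Hom y z) (f : Hom x y) :
  cat_basis (Mor g) ⋆ cat_basis (Mor f) = cat_basis (Mor (g ∘ f)).
Proof.
apply/ffunP=> m; rewrite !ffunE; case: eqP => [-> | m_neq].
  rewrite (bigD1 y) //= [X in _ + X]big1 => [|w nw]; last first.
    apply: big1 => b _; apply: big1 => a _; rewrite !ffunE.
    case: eqP => [/(congr1 (@mdom C))/= e|_]; last by rewrite mul0r.
    by rewrite e eqxx in nw.
  rewrite addr0 (bigD1 g) //= [X in _ + X]big1 => [|b nb]; last first.
    apply: big1 => a _; rewrite !ffunE; case: eqP => [/Mor_inj e|_].
      by rewrite e eqxx in nb.
    by rewrite mul0r.
  rewrite addr0 (bigD1 f) ?eqxx //= big1 => [|a /andP[_ na]].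
    by rewrite !ffunE !eqxx mulr1 addr0.
  rewrite !ffunE; case: (Mor a =P _) => [/Mor_inj e|_]; last by rewrite mulr0.
  by rewrite e eqxx in na.
apply: big1 => w _; apply: big1 => b _; apply: big1 => a ba; rewrite !ffunE.
case: eqP => [eb|_]; last by rewrite mul0r.
case: eqP => [ea|_]; last by rewrite mulr0.
case: m b a ba eb ea m_neq => x' [z' h] /= b a ba eb ea [].
have ez := congr1 (@mcod C) eb; have ex := congr1 (@mdom C) ea.
have ey := congr1 (@mdom C) eb.
rewrite /mdom /mcod /= in b ba eb ex ey ez; subst w x' z'.
by move: ba; rewrite (Mor_inj eb) (Mor_inj ea) => /eqP ->.
Qed.

Lemma cat_basisM0 (m n : mor C) :
  mdom m != mcod n -> cat_basis m ⋆ cat_basis n = 0.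
Proof.
move=> mn; apply/ffunP=> l; rewrite !ffunE.
apply: big1 => w _; apply: big1 => b _; apply: big1 => a _; rewrite !ffunE.
case: eqP => [eb|_]; last by rewrite mul0r.
case: eqP => [ea|_]; last by rewrite mulr0.
by rewrite -eb -ea eqxx in mn.
Qed.

End CategoryAlgebra.

Section Multiplicity.

Variables (k : fieldType) (gT : finGroupType) (G : {group gT}).
Implicit Types V W X Y : representation k G.

Definition repr_iso V W := mx_rsim V W.

Fact rsim_inverse V W (M : 'M_(rdegree V, rdegree W)) N :
    M *m N = 1%:M -> N *m M = 1%:M ->
    {in G, forall x, V x *m M = M *m W x} ->
  repr_iso V W.
Proof.
move=> MN NM hom_M; have freeM : row_free M by apply/row_freeP; exists N.
exists M => //; apply/eqP; rewrite eqn_leq -{1}(eqP freeM) rank_leq_col /=.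
have /eqP <- : row_free N by apply/row_freeP; exists M.
exact: rank_leq_col.
Qed.

Fact repr_iso_refl V : repr_iso V V.
Proof. exact: mx_rsim_refl. Qed.

Fact repr_iso_sym V W : repr_iso V W -> repr_iso W V.
Proof. exact: mx_rsim_sym. Qed.

Fact repr_iso_trans V W X : repr_iso V W -> repr_iso W X -> repr_iso V X.
Proof. exact: mx_rsim_trans. Qed.

Fact rsim_dadd V V' W W' :
  repr_iso V V' -> repr_iso W W' ->
  repr_iso (dadd_grepr V W) (dadd_grepr V' W').
Proof.
rewrite /repr_iso.
case: V V' W W' => [n V] [n' V'] [m W] [m' W'] /=.
move=> [M en freeM dV] [N em freeN dW].
rewrite -{n'}en in V' M freeM dV *; rewrite -{m'}em in W' N freeN dW *.
exists (block_mx M 0 0 N) => [||g Gg] //=.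
  rewrite row_free_unit unitmxE det_ublock unitrM -!unitmxE.
  by rewrite -!row_free_unit freeM.
by rewrite !mulmx_block !(mulmx0, mul0mx, addr0, add0r) dV ?dW.
Qed.

Fact rsim_daddC V W : repr_iso (dadd_grepr V W) (dadd_grepr W V).
Proof.
apply: (@rsim_inverse (dadd_grepr V W) (dadd_grepr W V)
  (block_mx 0 1%:M 1%:M 0) (block_mx 0 1%:M 1%:M 0)) => [||g Gg] /=.
- rewrite mulmx_block !(mulmx0, mul0mx, mulmx1, addr0, add0r).
  by rewrite -scalar_mx_block.
- rewrite mulmx_block !(mulmx0, mul0mx, mulmx1, addr0, add0r).
  by rewrite -scalar_mx_block.
by rewrite !mulmx_block !(mulmx0, mul0mx, mulmx1, mul1mx, addr0, add0r).
Qed.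

Fact rsim_daddA V W X :
  repr_iso (dadd_grepr V (dadd_grepr W X)) (dadd_grepr (dadd_grepr V W) X).
Proof.
pose M : 'M[k]_(rdegree V + (rdegree W + rdegree X),
           rdegree V + rdegree W + rdegree X) :=
  block_mx (row_mx 1%:M 0) 0 (col_mx (row_mx 0 1%:M) 0) (col_mx 0 1%:M).
pose N : 'M[k]_(rdegree V + rdegree W + rdegree X,
           rdegree V + (rdegree W + rdegree X)) :=
  block_mx (col_mx 1%:M 0) (col_mx 0 (row_mx 1%:M 0)) 0 (row_mx 0 1%:M).
apply: (@rsim_inverse (dadd_grepr V (dadd_grepr W X))
          (dadd_grepr (dadd_grepr V W) X) M N) => [||g Gg] /=.
- rewrite mulmx_block !(mulmx0, mul0mx, addr0, add0r).
  rewrite !(mul_col_mx, mul_row_col, mul_mx_row, mulmx1,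
              mul1mx, mulmx0, mul0mx).
  rewrite !(addr0, add0r, row_mx0, col_mx0, add_col_mx) -block_mxEv.
  by rewrite -!scalar_mx_block.
- rewrite mulmx_block !(mulmx0, mul0mx, addr0, add0r).
  rewrite !(mul_col_mx, mul_row_col, mul_mx_row, mulmx1,
              mul1mx, mulmx0, mul0mx).
  rewrite !(addr0, add0r, row_mx0, col_mx0, add_col_mx) -?block_mxEv.
  by rewrite -!scalar_mx_block.
rewrite !mulmx_block !(mulmx0, mul0mx, addr0, add0r).
rewrite !(mul_mx_row, mul_col_mx, mul_row_block, mul_block_col).
rewrite !(mulmx1, mul1mx, mulmx0, mul0mx, addr0, add0r, row_mx0, col_mx0).
rewrite !(mul_row_col, mulmx1, mulmx0, addr0, add0r) mul0mx mul_mx_row.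
by rewrite mulmx1 mulmx0.
Qed.

Fact rsim_dadd0 V W : rdegree W = 0%N -> repr_iso V (dadd_grepr W V).
Proof.
case: W => [[|n] W] //= _; set W0 := Representation W.
apply: (@rsim_inverse V (dadd_grepr W0 V) (row_mx 0 1%:M) (col_mx 0 1%:M)).
- by rewrite mul_row_col mulmx1 mulmx0 add0r.
- rewrite mul_col_row [RHS]scalar_mx_block.
  by congr block_mx; rewrite ?mulmx1 ?mulmx0 ?mul0mx // [RHS]flatmx0.
move=> g Gg; rewrite mul_row_block mul_mx_row.
by rewrite !(mulmx1, mul1mx, mulmx0, mul0mx, addr0, add0r).
Qed.

Variables (I : finType) (U : I -> representation k G).

Definition is_summand V X := exists Y, repr_iso X (dadd_grepr V Y).

(* V is the sum of the U_i^(e_i) and of a module X with no summand U_i. *)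
Definition is_multiplicity V (e : I -> nat) :=
  exists X, repr_iso V
      (dadd_grepr (\big[@dadd_grepr k gT G/grepr0]_i muln_grepr (U i) (e i)) X)
    /\ forall i, ~ is_summand (U i) X.

Fact rsim_dsum_incr (s : seq I) (i : I) (e : I -> nat) :
    uniq s -> i \in s ->
  repr_iso
    (dadd_grepr (U i) (\big[@dadd_grepr k gT G/grepr0]_(j <- s)
                         muln_grepr (U j) (e j)))
    (\big[@dadd_grepr k gT G/grepr0]_(j <- s)
        muln_grepr (U j) (e j + (j == i))).
Proof.
elim: s => //= j s IHs /andP[js uniq_s]; rewrite inE !big_cons.
case: eqP => [-> _ | /eqP ij /= i_s].
  rewrite eqxx addn1 /muln_grepr big_ord_recl.
  rewrite [X in repr_iso _ (dadd_grepr _ X)](_ : _ =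
    \big[@dadd_grepr k gT G/grepr0]_(j <- s) muln_grepr (U j) (e j)).
    exact: rsim_daddA.
  apply: eq_big_seq => l ls; rewrite /muln_grepr.
  by case: eqP ls => [-> | _ _]; [rewrite (negPf js) | rewrite addn0].
rewrite [j == i]eq_sym (negPf ij) addn0.
have IH := rsim_dadd (repr_iso_refl (muln_grepr (U j) (e j))) (IHs uniq_s i_s).
apply: repr_iso_trans _ IH.
apply: repr_iso_trans (rsim_daddA _ _ _) _.
apply: repr_iso_trans _ (repr_iso_sym (rsim_daddA _ _ _)).
exact: rsim_dadd (rsim_daddC _ _) (repr_iso_refl _).
Qed.

Lemma multiplicity_exists V :
  (forall i, 0 < rdegree (U i))%N -> exists e, is_multiplicity V e.
Proof.
move=> U_gt0; pose decomp X e := repr_iso V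
  (dadd_grepr (\big[@dadd_grepr k gT G/grepr0]_i muln_grepr (U i) (e i)) X).
pose has_deg n := `[< exists X e, decomp X e /\ rdegree X = n >].
have exn : exists n, has_deg n.
  exists (rdegree V); apply/asboolP; exists V, (fun=> 0%N); split=> //.
  apply: rsim_dadd0.
  by elim/big_rec: _ => //= i W _ ->; rewrite /muln_grepr big_ord0.
case: (ex_minnP exn) => n /asboolP[X [e [VX degX]]] min_n.
exists e, X; split=> // i [Y XY].
pose e' j := (e j + (j == i))%N.
have VY : decomp Y e'.
  apply: repr_iso_trans VX _.
  apply: repr_iso_trans (rsim_dadd (repr_iso_refl _) XY) _.
  apply: repr_iso_trans (rsim_daddA _ _ _) _.
  apply: rsim_dadd (repr_iso_refl _).
  apply: repr_iso_trans (rsim_daddC _ _) _.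
  by apply: rsim_dsum_incr; rewrite ?mem_index_enum ?index_enum_uniq.
have := min_n (rdegree Y); rewrite leqNgt -degX (mxrank_rsim XY) /=.
rewrite -[X in (X < _)%N]add0n ltn_add2r U_gt0 => /(_ _)/negP[] //.
by apply/asboolP; exists Y, e'.
Qed.

Hypothesis U_gt0 : forall i, (0 < rdegree (U i))%N.

Definition multiplicity V : I -> nat :=
  projT1 (cid (multiplicity_exists V U_gt0)).

Lemma multiplicityP V : is_multiplicity V (multiplicity V).
Proof. exact: projT2 (cid (multiplicity_exists V U_gt0)). Qed.

End Multiplicity.

Section AssociatedQuiver.

Variables (k : closedFieldType) (C : eicat).
Implicit Types x y : Ob C.

Section Unfactorizable.

Variables (x y : Ob C) (al : Hom x y).

(* With G = Aut x and H = Aut y, these are G_0, G_1 and H_1.  A representation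
   is a homomorphism to matrices; as a left module it consists of columns. *)
Definition fixr : {set autC x} := [set g : autC x | al ∘ g == al].
Definition swapr : {set autC x} :=
  [set g : autC x | [exists h : autC y, al ∘ g == h ∘ al]].
Definition swapl : {set autC y} :=
  [set h : autC y | [exists g : autC x, h ∘ al == al ∘ g]].

Fact fixr_group_set : group_set fixr.
Proof.
apply/group_setP; split=> [|g h]; rewrite !inE ?aut1E ?cmpm1 // => /eqP eg.
by move=> /eqP eh; rewrite autME cmpA eg eh.
Qed.
Canonical fixr_group := Group fixr_group_set.

Fact swapr_group_set : group_set swapr.
Proof.
apply/group_setP; split=> [|g g']; rewrite !inE.
  by apply/existsP; exists 1%g; rewrite !aut1E cmpm1 cmp1m.
move=> /existsP[h /eqP e] /existsP[h' /eqP e']; apply/existsP.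
by exists (h * h')%g; rewrite !autME cmpA e -cmpA e' cmpA.
Qed.
Canonical swapr_group := Group swapr_group_set.

Fact swapl_group_set : group_set swapl.
Proof.
apply/group_setP; split=> [|h h']; rewrite !inE.
  by apply/existsP; exists 1%g; rewrite !aut1E cmpm1 cmp1m.
move=> /existsP[g /eqP e] /existsP[g' /eqP e']; apply/existsP.
by exists (g * g')%g; rewrite !autME cmpA -e -!cmpA e'.
Qed.
Canonical swapl_group := Group swapl_group_set.

Fact cmp_autK (g : autC x) : al ∘ g ∘ (g^-1)%g = al.
Proof. by rewrite -cmpA -autME mulgV aut1E cmpm1. Qed.

Fact swapr_norm : swapr \subset 'N(fixr)%g.
Proof.
apply/subsetP=> g; rewrite !inE => /existsP[h /eqP gh].
apply/subsetP=> _ /imsetP[f + ->]; rewrite !inE => /eqP ff.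
have -> : al = (h^-1)%g ∘ al ∘ g.
  by rewrite -cmpA gh cmpA -autME mulVg aut1E cmp1m.
rewrite conjgE !autME !cmpA -[_ ∘ g ∘ (g^-1)%g]cmpA -[g ∘ (g^-1)%g]autME.
by rewrite mulgV aut1E cmpm1 -[_ ∘ al ∘ f]cmpA ff.
Qed.

Lemma swap_coset (g g' : autC x) :
    g \in swapr -> g' \in swapr -> al ∘ g = al ∘ g' ->
  coset fixr g = coset fixr g'.
Proof.
move=> /(subsetP swapr_norm) Ng /(subsetP swapr_norm) Ng' eq_g.
apply/rcoset_kercosetP=> //; apply/rcosetP; exists (g * g'^-1)%g.
  by rewrite inE autME cmpA eq_g cmp_autK.
by rewrite mulgKV.
Qed.

(* The identification H_1/H_0 = G_1/G_0, composed with H_1 -> H_1/H_0: an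
   element h is sent to g G_0 for any g such that al ∘ g = h ∘ al. *)
Definition swap_quo (h : autC y) : coset_of fixr :=
  coset fixr (odflt 1%g [pick g : autC x | al ∘ g == h ∘ al]).

Lemma swap_quoE (h : autC y) (g : autC x) :
  al ∘ g = h ∘ al -> swap_quo h = coset fixr g.
Proof.
move=> gh; rewrite /swap_quo.
case: pickP => [g' /eqP gh' | /(_ g)]; last by rewrite gh eqxx.
by apply: swap_coset; rewrite ?gh // inE; apply/existsP; exists h;
   rewrite ?gh ?gh'.
Qed.

(* The simple summands U_i of k(G_1/G_0), up to isomorphism. *)
Definition swap_irr : irrType k (swapr / fixr)%G :=
  DecSocleType (regular_repr k (swapr / fixr)%G).

Variable i : swap_irr.

Fact inflr_repr_subproof :
  mx_repr swapr (fun g : autC x => irr_repr i (coset fixr g)).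
Proof.
split=> [|g h Gg Gh]; first by rewrite morph1 repr_mx1.
have Ng := subsetP swapr_norm g Gg; have Nh := subsetP swapr_norm h Gh.
by rewrite morphM // repr_mxM ?mem_quotient.
Qed.

Fact swaplP (h : autC y) :
  h \in swapl -> exists2 g, g \in swapr & al ∘ g = h ∘ al.
Proof.
rewrite inE => /existsP[g /eqP e]; exists g => //.
by rewrite inE; apply/existsP; exists h; rewrite e.
Qed.

Fact infll_repr_subproof :
  mx_repr swapl (fun h : autC y => irr_repr i (swap_quo h)).
Proof.
split=> [|h h' Hh Hh'].
  by rewrite (@swap_quoE _ 1%g) ?morph1 ?repr_mx1 // !aut1E cmpm1 cmp1m.
have [g Gg gh] := swaplP Hh; have [g' Gg' gh'] := swaplP Hh'.
have Ng := subsetP swapr_norm g Gg; have Ng' := subsetP swapr_norm g' Gg'.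
rewrite (@swap_quoE _ (g * g')%g); last first.
  by rewrite !autME cmpA gh -cmpA gh' cmpA.
by rewrite (swap_quoE gh) (swap_quoE gh') morphM // repr_mxM ?mem_quotient.
Qed.

(* U_i, as a module over G_1 and over H_1. *)
Definition inflr : representation k swapr_group :=
  Representation (MxRepresentation inflr_repr_subproof).
Definition infll : representation k swapl_group :=
  Representation (MxRepresentation infll_repr_subproof).

End Unfactorizable.

Fact inflr_gt0 x y (al : Hom x y) i : (0 < rdegree (@inflr x y al i))%N.
Proof. exact: irr_degree_gt0. Qed.

Fact infll_gt0 x y (al : Hom x y) i : (0 < rdegree (@infll x y al i))%N.
Proof. exact: irr_degree_gt0. Qed.

Variables (R : unfact_reps C) (S : forall x, irrType k [set: autC x]).

Definition resr x y (al : Hom x y) (V : S x) :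
    representation k (swapr_group al) :=
  Representation (subg_repr (irr_repr V) (subsetT (swapr_group al))).

Definition resl x y (al : Hom x y) (W : S y) :
    representation k (swapl_group al) :=
  Representation (subg_repr (irr_repr W) (subsetT (swapl_group al))).

Definition arrow_mult x y (al : Hom x y) (V : S x) (W : S y) : nat :=
  (\sum_(i : swap_irr al)
     multiplicity (@inflr_gt0 _ _ al) (resr al V) i *
     multiplicity (@infll_gt0 _ _ al) (resl al W) i)%N.

Definition assoc_quiver : quiver :=
  @Quiver {x : Ob C & S x}
    (fun v w => \sum_(al in R (tag v) (tag w))
                   arrow_mult al (tagged v) (tagged w))%N.

End AssociatedQuiver.

(* Main.v *)
(* The irreducible representations V of the groups Aut x, extended by zero to
   kC, are jointly surjective onto a product of matrix algebras, and their common
   kernel is spanned by the non-isomorphisms, hence nilpotent: it is the radical.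
   So the vertices of the ordinary quiver are the pairs (x, V), and a primitive
   idempotent e_V for V is a diagonal matrix unit of the group algebra k Aut x.
   The square of the radical is spanned by the factorizable non-isomorphisms, so
   for V over x and W over y the space e_W (rad / rad^2) e_V is dual to the space
   of functions Phi from the unfactorizable morphisms x -> y to Hom(V, W) with
   Phi(h f g) = W(h) Phi(f) V(g).  (Traces would only give its dimension modulo
   the characteristic.)  Such a Phi is determined by its values at the
   representatives al; these are the matrices that intertwine V and W along the
   pairs (g, h) with al g = h al, and by Maschke and Schur they form a space of
   dimension sum_i e_i f_i.  Finally the evaluation functor from the free cover
   to C is bijective on automorphisms and on unfactorizable morphisms, which are
   all that the functions Phi depend on. *)
From HB Require Import structures.
From mathcomp Require Import all_boot all_order all_algebra all_fingroup.
From mathcomp Require Import all_solvable all_field all_character.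
From mathcomp Require Import generic_quotient boolp zify.
Require Import Defs.

Set Implicit Arguments.
Unset Strict Implicit.
Unset Printing Implicit Defensive.

Import GRing.Theory.
Local Open Scope ring_scope.
Local Open Scope quotient_scope.

(** * Dimensions of subspaces *)

(** The simple modules [S] belong to the groups Aut(x) of C, while an endomorphism of the free cover
    is an element of a generated hom-set. To let one computation serve both categories with the same
    vertices, it is carried out for a skeletal category whose automorphism groups are presented by
    model groups [gr x] with multiplicative bijections [iota]. Both instances take [gr x] to be
    [autC x], so all quiver isomorphisms that compare the two are the identity on vertices.
    Skeletality turns being an isomorphism into equality of endpoints. Hence unfactorizability can
    be tested through a functor that is the identity on objects, although morphisms of the cover are
    classes of words. Dual spaces are never formed. Equalities of dimension come from a pair of
    linear injections, or from one bilinear pairing that is nondegenerate on each side; such counts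
    are natural numbers, independent of the characteristic. *)

Section LinearAlgebra.

Variable k : fieldType.

(** A subspace of maximal dimension inside P absorbs the line of every u in P. This turns
    annihilators, intertwiners and equivariant functions, which are given by conditions in [Prop],
    into subspaces with a dimension. *)
Lemma vspace_of_pred (vT : vectType k) (P : vT -> Prop) :
    P 0 -> (forall a u v, P u -> P v -> P (a *: u + v)) ->
  exists U : {vspace vT}, forall u, u \in U <-> P u.
Proof.
move=> P0 Plin; pose sub (U : {vspace vT}) := forall u, u \in U -> P u.
pose has_dim n := `[< exists2 U, sub U & \dim U = n >].
have exd : exists n, has_dim n.
  exists 0%N; apply/asboolP; exists 0%VS; last exact: dimv0.
  by move=> u; rewrite memv0 => /eqP ->.
have bound n : has_dim n -> (n <= \dim {:vT})%N.
  by move=> /asboolP[U _ <-]; rewrite dimvS ?subvf.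
case: (ex_maxnP exd bound) => n /asboolP[U subU dimU] maxn.
exists U => u; split=> [|Pu]; first exact: subU.
have subUu : sub (U + <[u]>)%VS.
  move=> _ /memv_addP[w wU [_ /vlineP[a ->] ->]].
  by rewrite addrC; apply: Plin; last exact: subU.
have /maxn : has_dim (\dim (U + <[u]>)) by apply/asboolP; exists (U + <[u]>)%VS.
rewrite -dimU (geq_leqif (dimv_leqif_sup (addvSl U <[u]>))) subv_add.
by case/andP=> _; rewrite -memvE.
Qed.

Lemma dimv_le_inj (uT vT : vectType k) (f : uT -> vT) (U : {vspace uT})
    (W : {vspace vT}) :
    linear f -> {in U, forall u, f u \in W} ->
    {in U, forall u, f u = 0 -> u = 0} ->
  (\dim U <= \dim W)%N.
Proof.
move=> lin_f fUW f_inj.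
pose l := GRing.isLinear.Build _ _ _ _ f lin_f.
pose L : {linear uT -> vT} := HB.pack f l.
have LE u : linfun L u = f u by rewrite lfunE.
rewrite -(@limg_dim_eq _ _ _ (linfun L)) => [|].
  by apply/dimvS/subvP=> _ /memv_imgP[u uU ->]; rewrite LE fUW.
apply/eqP; rewrite -subv0; apply/subvP=> u; rewrite memv_cap memv_ker LE memv0.
by case/andP=> uU /eqP/f_inj ->.
Qed.

(** Pairing with a basis of B embeds F into the row vectors of length dim B. Only nondegeneracy on
    the side of F enters, so an equality takes two applications. *)
Lemma dimv_le_pairing (uT vT : vectType k) (beta : uT -> vT -> k)
    (F : {vspace uT}) (B : {vspace vT}) :
    (forall b, linear (beta^~ b : uT -> k^o)) ->
    (forall f, linear (beta f : vT -> k^o)) ->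
    {in F, forall f, {in B, forall b, beta f b = 0} -> f = 0} ->
  (\dim F <= \dim B)%N.
Proof.
move=> lin1 lin2 nondeg.
pose h f : 'rV[k]_(\dim B) := \row_i beta f (vbasis B)`_i.
suffices: (\dim F <= \dim {:'rV[k]_(\dim B)})%N by rewrite dimvf /dim /= mul1n.
apply: (@dimv_le_inj _ _ h) => [a u v|u _|u uF hu0]; last 1 first.
- apply: nondeg => // b bB; rewrite (coord_vbasis bB).
  pose l := GRing.isLinear.Build _ _ _ _ (beta u : vT -> k^o) (lin2 u).
  pose L : {linear vT -> k^o} := HB.pack (beta u : vT -> k^o) l.
  rewrite -[beta u _]/(L _) linear_sum big1 // => i _; rewrite linearZ /=.
  by move/rowP/(_ i): hu0; rewrite !mxE => ->; rewrite scaler0.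
- by apply/rowP=> i; rewrite !mxE lin1.
exact: memvf.
Qed.

Lemma dimv_ffun (I : finType) (vT : vectType k) (U : I -> {vspace vT})
    (W : {vspace {ffun I -> vT}}) :
    (forall f, f \in W <-> forall i, f i \in U i) ->
  \dim W = (\sum_i \dim (U i))%N.
Proof.
move=> WP; pose J := {i : I & 'I_(\dim (U i))}.
have cardJ : \dim {:{ffun J -> k^o}} = (\sum_i \dim (U i))%N.
  rewrite dimvf /dim /= muln1 card_tagged sumnE big_map big_enum /=.
  by apply: eq_bigr => i _; rewrite card_ord.
apply/eqP; rewrite eqn_leq -cardJ; apply/andP; split.
  pose h (f : {ffun I -> vT}) : {ffun J -> k^o} :=
    [ffun j => coord (vbasis (U (tag j))) (tagged j) (f (tag j))].
  apply: (@dimv_le_inj _ _ h) => [a u v|u _|u uF hu0].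
  - by apply/ffunP=> j; rewrite !ffunE linearP.
  - exact: memvf.
  apply/ffunP=> i; rewrite ffunE (coord_vbasis ((WP u).1 uF i)) big1 // => j _.
  move/ffunP/(_ (Tagged (fun i => 'I_(\dim (U i))) j)): hu0.
  by rewrite !ffunE /= => ->; rewrite scale0r.
pose h (c : {ffun J -> k^o}) : {ffun I -> vT} :=
  [ffun i => \sum_(j < \dim (U i))
     c (Tagged (fun i => 'I_(\dim (U i))) j) *: (vbasis (U i))`_j].
apply: (@dimv_le_inj _ _ h) => [a u v|u _|u _ hu0].
- apply/ffunP=> i; rewrite !ffunE scaler_sumr -big_split /=.
  apply: eq_bigr => j _.
  by rewrite !ffunE scalerDl scalerA.
- apply/WP=> i; rewrite ffunE; apply: memv_suml => j _.
  by rewrite memvZ // vbasis_mem ?mem_nth ?size_tuple.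
apply/ffunP=> -[i j]; rewrite ffunE.
have := basis_free (vbasisP (U i)); move/freeP=> free_i.
apply: (free_i (fun j => u (Tagged (fun i => 'I_(\dim (U i))) j))).
by move/ffunP/(_ i): hu0; rewrite !ffunE.
Qed.

Lemma mul_mx_delta m n p (M : 'M[k]_(m, n)) i (j : 'I_p) :
  M *m delta_mx i j = \sum_l M l i *: delta_mx l j.
Proof.
rewrite {1}[M]matrix_sum_delta mulmx_suml; apply: eq_bigr => l _.
rewrite mulmx_suml (bigD1 i) //= -scalemxAl mul_delta_mx big1 ?addr0 // => r ri.
by rewrite -scalemxAl mul_delta_mx_0 // scaler0.
Qed.

Lemma mul_delta_mx_l m n p (M : 'M[k]_(m, n)) (i : 'I_p) j :
  delta_mx i j *m M = \sum_l M j l *: delta_mx i l.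
Proof.
rewrite {1}[M]matrix_sum_delta mulmx_sumr (bigD1 j) //= mulmx_sumr.
rewrite [X in _ + X]big1 => [|r rj]; last first.
  rewrite mulmx_sumr big1 // => l _.
  by rewrite -scalemxAr mul_delta_mx_0 ?scaler0 // eq_sym.
by rewrite addr0; apply: eq_bigr => l _; rewrite -scalemxAr mul_delta_mx.
Qed.

End LinearAlgebra.

(** * Idempotents, the radical and the ordinary quiver *)

Section FdalgTheory.

Variables (k : fieldType) (A : fdalg k).
Implicit Types a b c e f x y : A.

Lemma fda_mulDl a b c : (a + b) ⋆ c = a ⋆ c + b ⋆ c.
Proof. by have := fda_linearl c 1 a b; rewrite /= !scale1r. Qed.

Lemma fda_mulDr a b c : a ⋆ (b + c) = a ⋆ b + a ⋆ c.
Proof. by have := fda_linearr a 1 b c; rewrite /= !scale1r. Qed.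

Lemma fda_mul0r a : 0 ⋆ a = 0.
Proof. by apply: (addrI (0 ⋆ a)); rewrite -fda_mulDl !addr0. Qed.

Lemma fda_mulr0 a : a ⋆ 0 = 0.
Proof. by apply: (addrI (a ⋆ 0)); rewrite -fda_mulDr !addr0. Qed.

Lemma fda_scalel (t : k) a b : (t *: a) ⋆ b = t *: (a ⋆ b).
Proof. by have := fda_linearl b t a 0; rewrite /= fda_mul0r !addr0. Qed.

Lemma fda_scaler (t : k) a b : a ⋆ (t *: b) = t *: (a ⋆ b).
Proof. by have := fda_linearr a t b 0; rewrite /= fda_mulr0 !addr0. Qed.

Lemma fda_mulNl a b : (- a) ⋆ b = - (a ⋆ b).
Proof. by rewrite -scaleN1r fda_scalel scaleN1r. Qed.

Lemma fda_mulNr a b : a ⋆ (- b) = - (a ⋆ b).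
Proof. by rewrite -scaleN1r fda_scaler scaleN1r. Qed.

Lemma fda_mulBl a b c : (a - b) ⋆ c = a ⋆ c - b ⋆ c.
Proof. by rewrite fda_mulDl fda_mulNl. Qed.

Lemma fda_mulBr a b c : a ⋆ (b - c) = a ⋆ b - a ⋆ c.
Proof. by rewrite fda_mulDr fda_mulNr. Qed.

Lemma fda_mul_suml I r (P : pred I) (F : I -> A) b :
  (\sum_(i <- r | P i) F i) ⋆ b = \sum_(i <- r | P i) F i ⋆ b.
Proof.
by elim/big_rec2: _ => [|i u v _ <-]; rewrite ?fda_mul0r ?fda_mulDl.
Qed.

Lemma fda_mul_sumr I r (P : pred I) (F : I -> A) b :
  b ⋆ (\sum_(i <- r | P i) F i) = \sum_(i <- r | P i) b ⋆ F i.
Proof.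
by elim/big_rec2: _ => [|i u v _ <-]; rewrite ?fda_mulr0 ?fda_mulDr.
Qed.

Lemma vmul_mem (I J : {vspace A}) a b :
  a \in I -> b \in J -> a ⋆ b \in vmul I J.
Proof.
move=> aI bJ; rewrite (coord_vbasis aI) (coord_vbasis bJ) fda_mul_suml.
apply: memv_suml => i _; rewrite fda_mul_sumr; apply: memv_suml => j _.
rewrite fda_scalel fda_scaler !memvZ //; apply: memv_span.
by apply: allpairs_f; rewrite mem_nth ?size_tuple.
Qed.

Lemma vmul_sub (I J U : {vspace A}) :
  (forall a b, a \in I -> b \in J -> a ⋆ b \in U) -> (vmul I J <= U)%VS.
Proof.
move=> IJU; apply/span_subvP=> _ /allpairsP[[a b] /= [aI bJ ->]].
by apply: IJU; apply: vbasis_mem.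
Qed.

(** Murray-von Neumann equivalence: x lies in e A f and y in f A e. It is the element-level form of
    an isomorphism A e = A f, given by right multiplication by x. *)
Definition idem_equiv e f :=
  exists x y, [/\ x ⋆ y = e, y ⋆ x = f, e ⋆ x ⋆ f = x & f ⋆ y ⋆ e = y].

Lemma idem_equiv_sym e f : idem_equiv e f -> idem_equiv f e.
Proof. by case=> x [y [? ? ? ?]]; exists y, x. Qed.

Lemma left_mod_memP e a : is_idempotent e -> a \in left_mod e <-> a ⋆ e = a.
Proof.
move=> ee; split=> [/left_modP[b ->]|ae]; first by rewrite -fda_mulA ee.
by apply/left_modP; exists a.
Qed.

Lemma idem_equiv_left_mod_iso e f :
  is_idempotent e -> is_idempotent f -> idem_equiv e f -> left_mod_iso e f.
Proof.
move=> ee ff [x [y [xy yx exf fye]]].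
have mulx_subproof (u : subvs_of (left_mod e)) : vsval u ⋆ x \in left_mod f.
  by apply/left_modP; exists (vsval u ⋆ e ⋆ x); rewrite -{1}exf !fda_mulA.
have muly_subproof (u : subvs_of (left_mod f)) : vsval u ⋆ y \in left_mod e.
  by apply/left_modP; exists (vsval u ⋆ f ⋆ y); rewrite -{1}fye !fda_mulA.
pose p u : subvs_of (left_mod f) := Subvs (mulx_subproof u).
pose q u : subvs_of (left_mod e) := Subvs (muly_subproof u).
have lin_p : linear p.
  by move=> t u v; apply: val_inj; rewrite /= fda_mulDl fda_scalel.
pose l := GRing.isLinear.Build _ _ _ _ p lin_p.
pose L : {linear subvs_of (left_mod e) -> subvs_of (left_mod f)} := HB.pack p l.
exists (linfun L) => [|a u v uv]; last by rewrite !lfunE /= uv fda_mulA.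
exists q => u; apply: val_inj; rewrite lfunE /= -fda_mulA ?xy ?yx.
  by apply/left_mod_memP => //; apply: subvsP.
by apply/left_mod_memP => //; apply: subvsP.
Qed.

(** A module map out of A e is right multiplication by the image of e. The witnesses x and y are the
    images of e and f under the isomorphism and its inverse. *)
Lemma left_mod_iso_idem_equiv e f :
  is_idempotent e -> is_idempotent f -> left_mod_iso e f -> idem_equiv e f.
Proof.
move=> ee ff [phi [psi phiK psiK] hom_phi].
have eP : e \in left_mod e by apply/left_mod_memP.
have fP : f \in left_mod f by apply/left_mod_memP.
pose x := vsval (phi (Subvs eP)); pose y := vsval (psi (Subvs fP)).
have phiE u : vsval (phi u) = vsval u ⋆ x.
  by apply: hom_phi; rewrite /=; apply/esym/left_mod_memP=> //; apply: subvsP.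
have xf : x ⋆ f = x by apply/left_mod_memP=> //; apply: subvsP.
have ye : y ⋆ e = y by apply/left_mod_memP=> //; apply: subvsP.
have ex : e ⋆ x = x by rewrite -(phiE (Subvs eP)).
have yx : y ⋆ x = f by rewrite -phiE psiK.
have inj_x a b : a ⋆ e = a -> b ⋆ e = b -> a ⋆ x = b ⋆ x -> a = b.
  move=> ae be abx.
  have aP : a \in left_mod e by apply/left_mod_memP.
  have bP : b \in left_mod e by apply/left_mod_memP.
  suffices: Subvs aP = Subvs bP by move/(congr1 val).
  by apply: (can_inj phiK); apply: val_inj; rewrite /= !phiE.
exists x, y; split=> //.
- by apply: inj_x; [rewrite -fda_mulA ye | exact: ee | rewrite -fda_mulA yx ex].
- by rewrite ex.
by apply: inj_x; [rewrite -fda_mulA ee | | rewrite -!fda_mulA ex yx].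
Qed.

Lemma vmul_ind (I J : {vspace A}) (P : A -> Prop) :
    P 0 -> (forall (t : k) a b, P a -> P b -> P (t *: a + b)) ->
    (forall a b, a \in I -> b \in J -> P (a ⋆ b)) ->
  forall c, c \in vmul I J -> P c.
Proof.
move=> P0 Plin IJP c; have [U UP] := vspace_of_pred P0 Plin.
suffices: (vmul I J <= U)%VS by move/subvP=> /(_ c) + cIJ => /(_ cIJ)/UP.
by apply: vmul_sub => a b aI bJ; apply/UP/IJP.
Qed.

Lemma corner_spanP (J : {vspace A}) e f u :
  u \in <<[seq f ⋆ a ⋆ e | a <- vbasis J]>>%VS <->
  exists2 a, a \in J & u = f ⋆ a ⋆ e.
Proof.
pose h a := f ⋆ a ⋆ e.
have lin_h : linear h.
  by move=> t a b; rewrite /h fda_mulDr fda_scaler fda_mulDl fda_scalel.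
pose l := GRing.isLinear.Build _ _ _ _ h lin_h.
pose L : {linear A -> A} := HB.pack h l.
rewrite (@eq_map _ _ _ (linfun L)) => [|a]; last by rewrite lfunE.
rewrite -limg_span (span_basis (vbasisP J)).
split=> [/memv_imgP[a aJ ->]|[a aJ ->]].
  by exists a; rewrite ?lfunE.
by apply/memv_imgP; exists a; rewrite ?lfunE.
Qed.

(** By the dimension formula for a sum and an intersection. In this form an injection of corners
    that preserves rad^2 controls both terms. *)
Lemma corner_dimE e1 f1
    (U := <<[seq f1 ⋆ a ⋆ e1 | a <- vbasis (radical A)]>>%VS) :
  @corner_dim k A f1 e1 =
  (\dim U - \dim (U :&: vmul (radical A) (radical A)))%N.
Proof.
rewrite /corner_dim -/U; set J2 := vmul _ _.
have := dimv_sum_cap U J2; lia.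
Qed.

End FdalgTheory.

(** * Recognizing the radical and the ordinary quiver from matrix representations *)

Section Recognition.

Variables (k : fieldType) (A : fdalg k) (V : Type) (n : V -> nat).
Variables (i0 : forall v, 'I_(n v)) (rho : forall v, A -> 'M[k]_(n v)).
Variable e : V -> A.
Implicit Types a b : A.

Hypothesis rho_lin : forall v, linear (rho v).
Hypothesis rhoM : forall v a b, rho v (a ⋆ b) = rho v a *m rho v b.
Hypothesis rho_surj : forall v (M : 'M[k]_(n v)),
  exists2 a, rho v a = M & forall w, w <> v -> rho w a = 0.

Definition rho_ker a := forall v, rho v a = 0.

Hypothesis rho_ker_linv : forall a,
  rho_ker a -> exists b, b ⋆ (fda_one A - a) = fda_one A.
Hypothesis e_idem : forall v, is_idempotent (e v).
Hypothesis rho_e : forall v, rho v (e v) = delta_mx (i0 v) (i0 v).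
Hypothesis rho_e0 : forall v w, w <> v -> rho w (e v) = 0.

Local Notation one := (fda_one A).

(** Unitality follows from surjectivity: if a maps to the identity matrix, then so does [one] times
    a. *)
Lemma rho1 v : rho v one = 1%:M.
Proof.
have [a aE _] := rho_surj (1%:M : 'M_(n v)).
by have := rhoM v one a; rewrite fda_mul1 aE mulmx1.
Qed.

Lemma rhoZ v (t : k) a : rho v (t *: a) = t *: rho v a.
Proof.
pose l := GRing.isLinear.Build _ _ _ _ (rho v) (@rho_lin v).
pose L : {linear A -> 'M[k]_(n v)} := HB.pack (rho v) l.
by rewrite -[rho v]/(L : _ -> _) linearZ.
Qed.

Lemma rhoD v a b : rho v (a + b) = rho v a + rho v b.
Proof. by rewrite -{1}[a]scale1r rho_lin scale1r. Qed.

Lemma rhoB v a b : rho v (a - b) = rho v a - rho v b.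
Proof. by rewrite rhoD -scaleN1r rhoZ scaleN1r. Qed.

Lemma rho0 v : rho v 0 = 0.
Proof. by rewrite -[0 in LHS](subrr one) rhoB subrr. Qed.

(** A left inverse b of 1 - a equals 1 + b a, again of the form 1 minus a kernel element; so b has a
    left inverse, which must be 1 - a. *)
Lemma rho_ker_inv a : rho_ker a ->
  exists b, b ⋆ (one - a) = one /\ (one - a) ⋆ b = one.
Proof.
move=> Na; have [b bE] := rho_ker_linv Na; exists b; split=> //.
have Nba : rho_ker (- (b ⋆ a)).
  by move=> v; rewrite -scaleN1r rhoZ rhoM Na mulmx0 scaler0.
have [c] := rho_ker_linv Nba.
have -> : fda_one A - - (b ⋆ a) = b.
  by rewrite opprK -bE fda_mulBr fda_mulr1 subrK.
move=> cb; rewrite -[one - a]fda_mul1 -{1}cb.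
by rewrite -[c ⋆ b ⋆ _]fda_mulA bE fda_mulr1.
Qed.

Lemma cV_transitive m (u w : 'cV[k]_m) : u != 0 -> exists X, X *m u = w.
Proof.
case/matrix0Pn=> i [j ui]; rewrite ord1 in ui.
exists ((u i 0)^-1 *: (w *m delta_mx 0 i)).
rewrite -scalemxAl -mulmxA -rowE.
have -> : row i u = (u i 0)%:M.
  by apply/matrixP=> r s; rewrite !ord1 !mxE eqxx mulr1n.
by rewrite mul_mx_scalar scalerA mulVf // scale1r.
Qed.

(** Surjectivity of [rho v] makes A transitive on nonzero columns, so the quotient of A by the
    annihilator of c is a simple module. *)
Lemma annihilator_maximal v (c : 'cV[k]_(n v)) (M : {vspace A}) :
    c != 0 -> (forall a, a \in M <-> rho v a *m c = 0) -> maximal_left_ideal M.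
Proof.
move=> c0 MP; split=> [a b /MP bM | fullM | N leftN sMN].
- by apply/MP; rewrite rhoM -mulmxA bM mulmx0.
- have /MP : one \in M by rewrite fullM memvf.
  by rewrite rho1 mul1mx => /eqP; apply/negP.
have [/subvP sNM | /subvPn[b bN bM]] := boolP (N <= M)%VS.
  by left; apply/eqP; rewrite eqEsubv sMN andbT; apply/subvP.
right; apply/eqP; rewrite eqEsubv subvf /=.
apply/subvP=> a _.
have bc : rho v b *m c != 0 by apply/negP=> /eqP/MP; apply/negP.
have [X XE] := cV_transitive (rho v a *m c) bc.
have [x xE _] := rho_surj X.
rewrite -[a](subrK (x ⋆ b)) memvD ?leftN //; apply: (subvP sMN).
by apply/MP; rewrite rhoB rhoM xE mulmxBl -mulmxA XE subrr.
Qed.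

(** Annihilators of the standard columns are maximal left ideals that together cut out the kernel.
    Conversely, if a kernel element a were outside a maximal M, then 1 = m + x a with m in M; but 1
    - x a is invertible, so M would be everything. *)
Lemma radicalE a : a \in radical A <-> rho_ker a.
Proof.
split=> [/radicalP aJ v | Na].
  apply/matrixP=> i j; rewrite mxE.
  pose c : 'cV[k]_(n v) := delta_mx j 0.
  have c0 : c != 0 by apply/matrix0Pn; exists j, 0; rewrite mxE !eqxx oner_neq0.
  have [||M MP] := @vspace_of_pred _ A (fun a => rho v a *m c = 0).
  - by rewrite rho0 mul0mx.
  - by move=> t b d b0 d0; rewrite rho_lin mulmxDl -scalemxAl b0 d0 scaler0 addr0.
  have /MP/matrixP/(_ i 0) := aJ M (annihilator_maximal c0 MP).
  by rewrite -colE !mxE => ->.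
apply/(radicalP a) => M [leftM M_full maxM].
have leftMa : left_ideal (M + left_mod a)%VS.
  move=> b _ /memv_addP[m mM [_ /left_modP[c ->] ->]].
  rewrite fda_mulDr memv_add ?leftM //; apply/left_modP.
  by exists (b ⋆ c); rewrite fda_mulA.
have aMa : a \in (M + left_mod a)%VS.
  rewrite -[X in X \in _]add0r memv_add ?mem0v //; apply/left_modP; exists one.
  by rewrite fda_mul1.
case: (maxM _ leftMa (addvSl _ _)) => [<- // | full_Ma].
have : one \in (M + left_mod a)%VS by rewrite full_Ma memvf.
case/memv_addP=> m mM [_ /left_modP[x ->] oneE].
have Nxa : rho_ker (x ⋆ a) by move=> v; rewrite rhoM Na mulmx0.
have [b [bE _]] := rho_ker_inv Nxa.
case: M_full; apply/eqP; rewrite eqEsubv subvf /=; apply/subvP=> c _.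
rewrite -[c]fda_mulr1 -bE oneE addrK; by rewrite !leftM.
Qed.

Lemma rho_ker_idem f : rho_ker f -> is_idempotent f -> f = 0.
Proof.
move=> Nf ff; have [b [bE _]] := rho_ker_inv Nf.
by rewrite -[f]fda_mul1 -bE -fda_mulA fda_mulBl fda_mul1 ff subrr fda_mulr0.
Qed.

(** The element 1 - (f - u) is invertible in A and acts on the corner f A f as u; compressing its
    inverse to the corner inverts u there. *)
Lemma corner_unit f u :
    is_idempotent f -> f ⋆ u ⋆ f = u -> rho_ker (f - u) ->
  exists w, [/\ f ⋆ w ⋆ f = w, w ⋆ u = f & u ⋆ w = f].
Proof.
move=> ff fuf Nfu; have [b [bE Eb]] := rho_ker_inv Nfu.
have fu : f ⋆ u = u by rewrite -fuf !fda_mulA ff.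
have uf : u ⋆ f = u by rewrite -fuf -!fda_mulA ff.
have uE : (one - (f - u)) ⋆ f = u.
  by rewrite !fda_mulBl fda_mul1 ff uf opprB addrC subrK.
have Eu : f ⋆ (one - (f - u)) = u.
  by rewrite !fda_mulBr fda_mulr1 ff fu opprB addrC subrK.
have bu : b ⋆ u = f by rewrite -uE fda_mulA bE fda_mul1.
have ub : u ⋆ b = f by rewrite -Eu -fda_mulA Eb fda_mulr1.
exists (f ⋆ b ⋆ f); split.
- by rewrite !fda_mulA ff -!fda_mulA ff.
- by rewrite -!fda_mulA fu bu ff.
by rewrite !fda_mulA uf ub ff.
Qed.

Lemma e_neq0 v : e v <> 0.
Proof.
move=> e0; have := rho_e v; rewrite e0 rho0.
move/matrixP/(_ (i0 v) (i0 v)); rewrite !mxE !eqxx => /esym/eqP.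
by rewrite oner_eq0.
Qed.

Lemma delta_mul_delta m p q r (M : 'M[k]_(p, q)) (i : 'I_m) j l (s : 'I_r) :
  delta_mx i j *m M *m delta_mx l s = M j l *: delta_mx i s.
Proof.
rewrite -(mul_delta_mx (0 : 'I_1) i j) -(mul_delta_mx (0 : 'I_1) l s).
rewrite !mulmxA -[_ *m M]mulmxA -rowE -[_ *m row j M *m _]mulmxA -colE.
have -> : col l (row j M) = (M j l)%:M.
  by apply/matrixP=> x y; rewrite !ord1 !mxE eqxx mulr1n.
by rewrite mul_mx_scalar -scalemxAl mul_delta_mx.
Qed.

(** F is absorbed on both sides by the diagonal matrix unit, so it is a multiple of it. If the
    factor is nonzero, G F = 0 forces G = 0. *)
Lemma delta_idem_split m (i : 'I_m) (F G : 'M[k]_m) :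
    F *m F = F -> G *m G = G -> F *m G = 0 -> G *m F = 0 ->
    delta_mx i i = F + G -> F = 0 \/ G = 0.
Proof.
move=> FF GG FG GF sumE.
have F1 : F *m delta_mx i i = F by rewrite sumE mulmxDr FF FG addr0.
have F2 : delta_mx i i *m F = F by rewrite sumE mulmxDl FF GF addr0.
have FE : F = F i i *: delta_mx i i by rewrite -delta_mul_delta F2 F1.
have G1 : G *m delta_mx i i = G by rewrite sumE mulmxDr GG GF add0r.
have [Fi0 | Fi0] := eqVneq (F i i) 0.
  by left; rewrite FE Fi0 scale0r.
right; apply: (scalerI Fi0).
by rewrite scaler0 -[in LHS]G1 scalemxAr -FE.
Qed.

(** A splitting of [e v] induces a splitting of a diagonal matrix unit over v and of 0 elsewhere.
    One part is therefore killed by every [rho w], and an idempotent in the common kernel is 0. *)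
Lemma e_primitive v : primitive_idempotent (e v).
Proof.
split=> [||f g ff gg fg gf eE]; [exact: e_neq0 | exact: e_idem |].
have rho_ff w : rho w f *m rho w f = rho w f by rewrite -rhoM ff.
have rho_gg w : rho w g *m rho w g = rho w g by rewrite -rhoM gg.
have off w : w <> v -> rho w f = 0 /\ rho w g = 0.
  move=> /rho_e0; rewrite eE rhoD => fg0; split.
    have := congr1 (mulmx (rho w f)) fg0.
    by rewrite mulmxDr -!rhoM ff fg rho0 addr0 mulmx0.
  have := congr1 (mulmx (rho w g)) fg0.
  by rewrite mulmxDr -!rhoM gg gf rho0 add0r mulmx0.
have [||||||] := @delta_idem_split _ (i0 v) (rho v f) (rho v g).
- exact: rho_ff.
- exact: rho_gg.
- by rewrite -rhoM fg rho0.
- by rewrite -rhoM gf rho0.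
- by rewrite -rho_e eE rhoD.
- move=> f0; left; apply: rho_ker_idem => // w.
  by have [-> // | /off[]] := pselect (w = v).
move=> g0; right; apply: rho_ker_idem => // w.
by have [-> // | /off[]] := pselect (w = v).
Qed.

Lemma e_equiv_inj v w : idem_equiv (e v) (e w) -> v = w.
Proof.
case=> x [y [xy _ exe _]]; apply: contrapT => vw.
have := rho_e v; rewrite -xy rhoM -exe !rhoM (rho_e0 vw) mulmx0 mul0mx.
move/matrixP/(_ (i0 v) (i0 v)); rewrite !mxE !eqxx => /esym/eqP.
by rewrite oner_eq0.
Qed.

(* A product y ⋆ x with x in f A e_v and y in e_v A f is chosen over e_v and
   corrected by a unit of e_v A e_v; then x ⋆ y is a nonzero idempotent below f.
   This makes the lifting of idempotents modulo the radical unnecessary. *)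
Lemma primitive_equiv_e f :
  primitive_idempotent f -> exists v, idem_equiv (e v) f.
Proof.
case=> f0 ff prim_f.
have [v rf0] : exists v, rho v f != 0.
  apply: contrapT => no_v; apply/f0/rho_ker_idem => // v.
  by apply/eqP; apply: contrapT => /negP rf0; apply: no_v; exists v.
have [i [j fij]] := matrix0Pn _ rf0.
(* The scalar is chosen so that y ⋆ x maps to the diagonal matrix unit over v, that is, to the image
   of [e v]. *)
have [y1 y1E _] := rho_surj ((rho v f i j)^-1 *: delta_mx (i0 v) i).
have [x1 x1E _] := rho_surj (delta_mx j (i0 v)).
have ee := e_idem v.
pose y := e v ⋆ y1 ⋆ f; pose x := f ⋆ x1 ⋆ e v.
have ey : e v ⋆ y = y by rewrite /y !fda_mulA ee.
have yf : y ⋆ f = y by rewrite /y -!fda_mulA ff.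
have fx : f ⋆ x = x by rewrite /x !fda_mulA ff.
have xe : x ⋆ e v = x by rewrite /x -!fda_mulA ee.
have [|w|w [ewe wu uw]] := @corner_unit (e v) (y ⋆ x) ee.
- by rewrite fda_mulA ey -fda_mulA xe.
- rewrite rhoB; have [-> | /rho_e0 e0] := pselect (w = v); last first.
    by rewrite !rhoM e0 !mul0mx subrr.
  rewrite !rhoM rho_e y1E x1E -!scalemxAr -!scalemxAl.
  rewrite mul_delta_mx !mulmxA -[_ *m rho v f *m rho v f]mulmxA -rhoM ff.
  by rewrite delta_mul_delta -scalemxAl mul_delta_mx scalerA mulVf //
    scale1r subrr.
pose X := x ⋆ w.
have yX : y ⋆ X = e v by rewrite /X fda_mulA.
have Xe : X ⋆ e v = X by rewrite /X -ewe -!fda_mulA ee.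
have fX : f ⋆ X = X by rewrite /X fda_mulA fx.
have gg : is_idempotent (X ⋆ y).
  by rewrite /is_idempotent -fda_mulA [y ⋆ _]fda_mulA yX ey.
have fg : f ⋆ (X ⋆ y) = X ⋆ y by rewrite fda_mulA fX.
have gf : X ⋆ y ⋆ f = X ⋆ y by rewrite -fda_mulA yf.
have f_g : is_idempotent (f - X ⋆ y).
  by rewrite /is_idempotent fda_mulBl !fda_mulBr ff fg gf gg subrr subr0.
exists v, y, X; split; rewrite ?ey ?fX //.
have [|||g0|/eqP] := prim_f _ _ gg f_g.
- by rewrite fda_mulBr gf gg subrr.
- by rewrite fda_mulBl fg gg subrr.
- by rewrite addrC subrK.
- have : y ⋆ (X ⋆ y ⋆ X) = e v by rewrite -fda_mulA yX Xe yX.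
  by rewrite g0 fda_mul0r fda_mulr0 => /esym/e_neq0.
by rewrite subr_eq0 => /eqP.
Qed.

(** The map u to y1 u x sends one corner to the other and respects rad^2, a two-sided ideal; u to x1
    u y undoes it, since x y = e1 and x1 y1 = f1. *)
Lemma corner_dim_le e1 e2 f1 f2 :
    is_idempotent e1 -> is_idempotent f1 ->
    idem_equiv e1 e2 -> idem_equiv f1 f2 ->
  let U e f := <<[seq f ⋆ a ⋆ e | a <- vbasis (radical A)]>>%VS in
  let J2 := vmul (radical A) (radical A) in
  (\dim (U e1 f1) <= \dim (U e2 f2))%N /\
  (\dim (U e1 f1 :&: J2) <= \dim (U e2 f2 :&: J2))%N.
Proof.
move=> ee ff [x [y [xy yx exe eye]]] [x1 [y1 [xy1 yx1 exe1 eye1]]] U J2.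
have Jl a b : b \in radical A -> a ⋆ b \in radical A.
  by move=> /radicalE Nb; apply/radicalE=> v; rewrite rhoM Nb mulmx0.
have Jr a b : a \in radical A -> a ⋆ b \in radical A.
  by move=> /radicalE Na; apply/radicalE=> v; rewrite rhoM Na mul0mx.
pose h u := y1 ⋆ u ⋆ x.
have lin_h : linear h.
  by move=> t a b; rewrite /h fda_mulDr fda_scaler fda_mulDl fda_scalel.
have hU u : u \in U e1 f1 -> h u \in U e2 f2.
  case/corner_spanP=> a aJ ->; apply/corner_spanP.
  exists (h (f1 ⋆ a ⋆ e1)); first by apply/Jr/Jl/Jr/Jl.
  rewrite /h -{1}eye1 -{1}exe -!fda_mulA [e1 ⋆ (e1 ⋆ _)]fda_mulA ee.
  by rewrite [f1 ⋆ (f1 ⋆ _)]fda_mulA ff.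
have h_inj u : u \in U e1 f1 -> h u = 0 -> u = 0.
  case/corner_spanP=> a aJ -> hu0.
  have : x1 ⋆ h (f1 ⋆ a ⋆ e1) ⋆ y = 0 by rewrite hu0 fda_mulr0 fda_mul0r.
  by rewrite /h -!fda_mulA xy ee !fda_mulA xy1 ff.
have hJ2 u : u \in J2 -> h u \in J2.
  apply: (@vmul_ind _ A _ _ (fun u => h u \in J2)) => [|t a b aJ bJ|a b aJ bJ].
  - by rewrite /h fda_mulr0 fda_mul0r mem0v.
  - by rewrite lin_h memvD ?memvZ.
  by rewrite /h fda_mulA -fda_mulA; apply: vmul_mem; [apply: Jl | apply: Jr].
split; apply: (dimv_le_inj lin_h) => // u; rewrite memv_cap => /andP[uU uJ].
  by rewrite memv_cap hU ?hJ2.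
by apply: h_inj.
Qed.

Lemma corner_dim_equiv e1 e2 f1 f2 :
    is_idempotent e1 -> is_idempotent f1 ->
    is_idempotent e2 -> is_idempotent f2 ->
    idem_equiv e1 e2 -> idem_equiv f1 f2 ->
  @corner_dim k A f1 e1 = @corner_dim k A f2 e2.
Proof.
move=> e1P f1P e2P f2P ee ff; have [d1 d2] := corner_dim_le e1P f1P ee ff.
have [d3 d4] := corner_dim_le e2P f2P (idem_equiv_sym ee) (idem_equiv_sym ff).
by rewrite !corner_dimE; congr (_ - _)%N; apply/eqP; rewrite eqn_leq ?d1 ?d2.
Qed.

Theorem ordinary_quiver_recognition :
  quiver_iso (@Quiver V (fun v w => @corner_dim k A (e w) (e v)))
    (ordinary_quiver A).
Proof.
have primP v : `[< primitive_idempotent (e v) >] by apply/asboolT/e_primitive.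
pose phi v : proj_class A := \pi_(proj_class A) (exist _ (e v) (primP v)).
have idemP (f : prim_idem A) : is_idempotent (val f) by case/asboolP: (valP f).
(* The arrows are counted at the representative that [repr] selects, which is only equivalent to
   [e v]; this is where invariance of [corner_dim] is used. *)
have phi_repr v : idem_equiv (val (repr (phi v))) (e v).
  apply: left_mod_iso_idem_equiv; [exact: idemP | exact: e_idem |].
  apply/asboolP.
  rewrite -[`[< _ >]]/(prim_iso (repr (phi v)) (exist _ (e v) (primP v))).
  by rewrite -eqmodE reprK.
have phi_inj : injective phi.
  move=> v w vw; apply: e_equiv_inj.
  apply: left_mod_iso_idem_equiv; [exact: e_idem | exact: e_idem |].
  by move/eqP: vw; rewrite eqmodE => /asboolP.
have phi_surj P : exists v, phi v = P.
  have [v vP] := primitive_equiv_e (asboolW (valP (repr P))).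
  exists v; rewrite -[P]reprK; apply/eqP; rewrite eqmodE; apply/asboolP.
  exact: idem_equiv_left_mod_iso.
exists phi => [|v w] /=; last first.
  apply: corner_dim_equiv.
  - exact: idemP.
  - exact: idemP.
  - exact: e_idem.
  - exact: e_idem.
  - exact: phi_repr.
  exact: phi_repr.
exists (fun P => projT1 (cid (phi_surj P))) => [v|P].
  exact/phi_inj/(projT2 (cid (phi_surj (phi v)))).
exact: projT2 (cid (phi_surj P)).
Qed.

End Recognition.

(** * Semisimple group algebras *)

Section GroupAlgebra.

Variables (k : closedFieldType) (gT : finGroupType).
Local Notation G := [set: gT]%G.
Variable S : irrType k G.
Hypothesis charG : ([pchar k]^'.-group G)%g.

Definition irr_eval (c : gT -> k) (s : S) := \sum_g c g *: irr_repr s g.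

(** Elements of the group algebra are kept as coefficient functions; [ring_elt] is their image in
    the enveloping algebra of the regular representation, where Wedderburn theory is available. *)
Let ring_elt (c : gT -> k) := \sum_g c g *: regular_repr k G g.

Let ring_elt_mem c : (ring_elt c \in group_ring k G)%MS.
Proof. by apply/envelop_mxP; exists c; apply: eq_bigl => g; rewrite inE. Qed.

Let gring_op_elt c s : gring_op (irr_repr s) (ring_elt c) = irr_eval c s.
Proof.
rewrite linear_sum; apply: eq_bigr => g _.
by rewrite linearZ /= gring_opG ?inE.
Qed.

(** On the simple module i only the i-th Wedderburn component acts, and it acts faithfully; so all
    components vanish, and with them the group algebra element. *)
Lemma irr_eval_inj c : (forall s, irr_eval c s = 0) -> forall g, c g = 0.
Proof.
move=> c0 g.
have [e Re eE] : exists2 A : S -> 'M_(gcard G),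
    forall i, (A i \in Wedderburn_subring i)%MS & ring_elt c = \sum_i A i.
  have := ring_elt_mem c; rewrite -(Wedderburn_sum_pchar S charG).
  case/memmx_sumsP=> A AE AR; exists A => //.
have e0 i : e i = 0.
  have irri := socle_irr i.
  have irr_i : irr_comp S (irr_repr i) = i by apply: irr_reprK_pchar.
  apply: (regular_op_inj_pchar (sG := S) charG irri);
    rewrite ?inE -/(irr_repr i) ?irr_i.
  - exact: Re.
  - by rewrite linear0 sub0mx.
  rewrite linear0 -(c0 i) -gring_op_elt eE linear_sum (bigD1 i) //=.
  rewrite big1 ?addr0 // => j ji.
  exact: (irr_repr'_op0_pchar charG ji (Re j)).
have : ring_elt c = 0 by rewrite eE big1.
move/(congr1 (gring_proj g)); rewrite linear0 linear_sum (bigD1 g) //=.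
rewrite big1 => [|h hg]; last first.
  by rewrite linearZ /= gring_projE ?inE // eq_sym (negPf hg) scaler0.
rewrite addr0 linearZ /= gring_projE ?inE // eqxx.
by move/matrixP/(_ 0 0); rewrite !mxE mulr1.
Qed.

(** Over a closed field s is absolutely irreducible, so its group matrices span all matrices.
    Multiplying by the central idempotent of s removes the effect on the other simple modules. *)
Lemma irr_eval_surj (s : S) (M : 'M[k]_(irr_degree s)) :
  exists c, irr_eval c s = M /\ forall s', s' <> s -> irr_eval c s' = 0.
Proof.
have abs : mx_absolutely_irreducible (irr_repr s).
  exact: (@group_closure_closed_field k gT G _ _ (socle_irr s)).
have [_ [a aE]] := mx_abs_irrP abs.
pose A := ring_elt (a^~ M).
have AR := ring_elt_mem (a^~ M).
have eR := Wedderburn_id_mem s.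
have eG : (Wedderburn_id s \in group_ring k G)%MS.
  by rewrite -(Wedderburn_sum_pchar S charG) (sumsmx_sup s).
have /envelop_mxP[c cE] : (A *m Wedderburn_id s \in group_ring k G)%MS.
  exact: envelop_mxM.
have cE' : ring_elt c = A *m Wedderburn_id s.
  by rewrite cE; apply: eq_bigl => g; rewrite inE.
exists c; split=> [|s' ss'].
  rewrite -gring_op_elt cE' gring_opM // op_Wedderburn_id_pchar // mulmx1.
  by rewrite gring_op_elt [RHS]aE; apply: eq_bigl => g; rewrite inE.
rewrite -gring_op_elt cE' gring_opM //.
by rewrite (irr_repr'_op0_pchar charG _ eR) ?mulmx0 // eq_sym; apply/eqP.
Qed.

Definition convolution (c d : gT -> k) g := \sum_h c h * d (h^-1 * g)%g.

Lemma irr_evalM c d s :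
  irr_eval (convolution c d) s = irr_eval c s *m irr_eval d s.
Proof.
rewrite /irr_eval mulmx_suml.
under eq_bigr do rewrite scaler_suml.
rewrite exchange_big /=; apply: eq_bigr => h _.
rewrite mulmx_sumr (reindex_inj (mulgI h)) /=; apply: eq_bigr => g _.
by rewrite mulKg repr_mxM ?inE // -scalemxAl -scalemxAr scalerA.
Qed.

Lemma irr_eval_delta h s : irr_eval (fun g => (g == h)%:R) s = irr_repr s h.
Proof.
rewrite /irr_eval (bigD1 h) //= eqxx scale1r big1 ?addr0 // => g /negPf ->.
by rewrite scale0r.
Qed.

Lemma irr_eval_lin t c d s :
  irr_eval (fun g => t * c g + d g) s = t *: irr_eval c s + irr_eval d s.
Proof.
rewrite /irr_eval scaler_sumr -big_split; apply: eq_bigr => g _ /=.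
by rewrite scalerDl scalerA.
Qed.

Lemma irr_eval_eq c d :
  (forall s, irr_eval c s = irr_eval d s) -> c =1 d.
Proof.
move=> cd g.
have /irr_eval_inj/(_ g) : forall s, irr_eval (fun g => -1 * d g + c g) s = 0.
  by move=> s; rewrite irr_eval_lin cd scaleN1r addNr.
by rewrite mulN1r addrC => /eqP; rewrite subr_eq0 => /eqP.
Qed.

End GroupAlgebra.

(** * Equivariant matrix-valued functions *)

Section EquivariantFunctions.

Variables (k : fieldType) (m n : nat) (H G : finGroupType).
Variables (L : H -> 'M[k]_m) (N : G -> 'M[k]_n).
Hypotheses (L1 : L 1%g = 1%:M) (LM : forall h h', L (h * h')%g = L h *m L h').
Hypotheses (N1 : N 1%g = 1%:M) (NM : forall g g', N (g * g')%g = N g *m N g').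

(** Functions on the subset P are encoded as functions on T vanishing off P, so that no subtype of a
    hom-set has to carry the action. *)
Definition equivariant_on (T : finType) (P : pred T) (act : H -> G -> T -> T)
    (Phi : {ffun T -> 'M[k]_(m, n)}) :=
  (forall t, ~~ P t -> Phi t = 0) /\
  (forall t h g, Phi (act h g t) = L h *m Phi t *m N g).

Section Transport.

Variables (T T' : finType) (P : pred T) (P' : pred T').
Variables (act : H -> G -> T -> T) (act' : H -> G -> T' -> T') (e : T' -> T).
Variables (U : {vspace {ffun T -> 'M[k]_(m, n)}})
  (U' : {vspace {ffun T' -> 'M[k]_(m, n)}}).
Hypothesis memU : forall Phi, Phi \in U <-> equivariant_on P act Phi.
Hypothesis memU' : forall Phi, Phi \in U' <-> equivariant_on P' act' Phi.
Hypothesis P_act : forall h g t, P (act h g t) = P t.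
Hypothesis P_act' : forall h g t, P' (act' h g t) = P' t.
Hypothesis e_act : forall h g t, e (act' h g t) = act h g (e t).
Hypothesis eP : forall t, P' t -> P (e t).
Hypothesis e_inj : forall t t', P' t -> P' t' -> e t = e t' -> t = t'.
Hypothesis e_surj : forall t, P t -> exists2 t', P' t' & e t' = t.

Lemma dim_equivariant_transport : \dim U' = \dim U.
Proof.
apply/eqP; rewrite eqn_leq; apply/andP; split.
  (* The preimage under e is unique only within P', hence the restriction in [pick]; where there is
     none, the value is 0. *)
  pose push (Phi : {ffun T' -> 'M[k]_(m, n)}) : {ffun T -> 'M[k]_(m, n)} :=
    [ffun t => if [pick t' | P' t' && (e t' == t)] is Some t'
               then Phi t' else 0].
  have pushE Phi t : P' t -> push Phi (e t) = Phi t.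
    move=> Pt; rewrite ffunE; case: pickP => [t' /andP[Pt' /eqP tt']|/(_ t)].
      by rewrite (e_inj Pt' Pt tt').
    by rewrite Pt eqxx.
  apply: (@dimv_le_inj _ _ _ push).
  - move=> a Phi Psi; apply/ffunP=> t; rewrite !ffunE.
    by case: pickP => [t' _|_]; rewrite ?ffunE // scaler0 addr0.
  - move=> Phi /memU'[Phi0 equiPhi]; apply/memU.
    have push0 t : ~~ P t -> push Phi t = 0.
      move=> nt; rewrite ffunE; case: pickP => // t' /andP[Pt' /eqP tt'].
      by case/negP: nt; rewrite -tt' eP.
    split=> // t h g; have [Pt | nt] := boolP (P t); last first.
      by rewrite (push0 t) // mulmx0 mul0mx push0 // P_act.
    have [t' Pt' <-] := e_surj Pt.
    by rewrite -e_act !pushE ?P_act'.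
  move=> Phi /memU'[Phi0 _] push0; apply/ffunP=> t; rewrite ffunE.
  have [Pt | /Phi0 //] := boolP (P' t).
  by rewrite -pushE // push0 ffunE.
pose pull (Phi : {ffun T -> 'M[k]_(m, n)}) : {ffun T' -> 'M[k]_(m, n)} :=
  [ffun t => if P' t then Phi (e t) else 0].
apply: (@dimv_le_inj _ _ _ pull).
- move=> a Phi Psi; apply/ffunP=> t; rewrite !ffunE.
  by case: ifP => // _; rewrite scaler0 addr0.
- move=> Phi /memU[Phi0 equiPhi]; apply/memU'.
  split=> [t /negPf nt | t h g]; rewrite !ffunE ?nt // P_act' e_act.
  by case: ifP => _; rewrite ?equiPhi // mulmx0 mul0mx.
move=> Phi /memU[Phi0 _] pull0; apply/ffunP=> t; rewrite ffunE.
have [Pt | /Phi0 //] := boolP (P t).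
have [t' Pt' <-] := e_surj Pt.
by move/ffunP/(_ t'): pull0; rewrite !ffunE Pt'.
Qed.

End Transport.

Section Orbits.

Variables (T : finType) (P : pred T) (act : H -> G -> T -> T) (reps : {set T}).
Hypothesis actM : forall h h' g g' t,
  act h g (act h' g' t) = act (h * h')%g (g' * g)%g t.
Hypothesis P_act : forall h g t, P (act h g t) = P t.
Hypothesis repsP : forall r, r \in reps -> P r.
Hypothesis reps_cover : forall t, P t ->
  exists r h g, r \in reps /\ t = act h g r.
Hypothesis reps_uniq : forall r r' h h' g g',
  r \in reps -> r' \in reps -> act h g r = act h' g' r' -> r = r'.
Variables (U : {vspace {ffun T -> 'M[k]_(m, n)}})
  (K : T -> {vspace 'M[k]_(m, n)}).
Hypothesis memU : forall Phi, Phi \in U <-> equivariant_on P act Phi.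
Hypothesis memK : forall r, r \in reps -> forall M, M \in K r <->
  (forall h g, act 1%g g r = act h 1%g r -> L h *m M = M *m N g).

(** Families of values at the representatives become functions on all of T, zero off [reps], as
    [dimv_ffun] expects. *)
Let piece t := if t \in reps then K t else 0%VS.

Let extend (M : {ffun T -> 'M[k]_(m, n)}) : {ffun T -> 'M[k]_(m, n)} :=
  [ffun t => if [pick p : H * T * G |
                   (p.1.2 \in reps) && (t == act p.1.1 p.2 p.1.2)] is Some p
             then L p.1.1 *m M p.1.2 *m N p.2 else 0].

(** [extend] picks some presentation of a point by a representative. Two presentations share r and
    differ by h'^-1 h on the left and g' g^-1 on the right; these agree on r, and the intertwining
    condition in [K r] makes the values equal. *)
Let extendE (M : {ffun T -> 'M[k]_(m, n)}) h g r :
    (forall t, M t \in piece t) -> r \in reps ->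
  extend M (act h g r) = L h *m M r *m N g.
Proof.
move=> MK Rr; rewrite ffunE; case: pickP => [[[h' r'] g'] /=|/(_ (h, r, g))].
  case/andP=> Rr' /eqP e; have rr' := reps_uniq Rr Rr' e; subst r'.
  have := MK r; rewrite /piece Rr => /(memK Rr) HM.
  have {}HM : L (h'^-1 * h)%g *m M r = M r *m N (g' * g^-1)%g.
    apply: HM; transitivity (act h'^-1%g g^-1%g (act h g r)).
      by rewrite e actM mulVg.
    by rewrite actM mulgV.
  rewrite -[g'](mulgKV g) NM -[LHS]mulmxA [M r *m (_ *m _)]mulmxA -HM.
  by rewrite !mulmxA -LM mulKVg.
by rewrite /= Rr eqxx.
Qed.

(** Restriction to the representatives and [extend] give the two injections: the orbits are
    independent, and on the orbit of r the stabilizer condition [K r] is the only constraint. *)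
Lemma dim_equivariant_orbits : \dim U = (\sum_(r in reps) \dim (K r))%N.
Proof.
have [||Z ZP] := @vspace_of_pred _ {ffun T -> 'M[k]_(m, n)}
  (fun M => forall t, M t \in piece t).
- by move=> t; rewrite ffunE mem0v.
- by move=> a M M' HM HM' t; rewrite !ffunE memvD ?memvZ.
have -> : (\sum_(r in reps) \dim (K r))%N = \dim Z.
  rewrite (dimv_ffun ZP) [RHS](bigID (mem reps)) /= [X in (_ + X)%N]big1.
    by rewrite addn0; apply: eq_bigr => r Rr; rewrite /piece Rr.
  by move=> r /negPf nR; rewrite /piece nR dimv0.
apply/eqP; rewrite eqn_leq; apply/andP; split.
  pose res (Phi : {ffun T -> 'M[k]_(m, n)}) : {ffun T -> 'M[k]_(m, n)} :=
    [ffun t => if t \in reps then Phi t else 0].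
  apply: (@dimv_le_inj _ _ _ res).
  - move=> a Phi Psi; apply/ffunP=> t; rewrite !ffunE.
    by case: ifP => // _; rewrite scaler0 addr0.
  - move=> Phi /memU[_ equiPhi]; apply/ZP=> t; rewrite /piece ffunE.
    case: ifP => // Rt; last by rewrite mem0v.
    apply/(memK Rt) => h g hg; have := equiPhi t h 1%g.
    by rewrite -hg equiPhi L1 N1 mulmx1 mul1mx => ->.
  move=> Phi /memU[Phi0 equiPhi] res0; apply/ffunP=> t; rewrite ffunE.
  have [Pt | /Phi0 //] := boolP (P t).
  have [r [h [g [Rr ->]]]] := reps_cover Pt.
  move/ffunP/(_ r): res0; rewrite !ffunE Rr => Phir.
  by rewrite equiPhi Phir mulmx0 mul0mx.
apply: (@dimv_le_inj _ _ _ extend).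
- move=> a M M'; apply/ffunP=> t; rewrite !ffunE; case: pickP => [p _|_].
    by rewrite !ffunE mulmxDr mulmxDl -scalemxAr -scalemxAl.
  by rewrite scaler0 addr0.
- move=> M /ZP MZ; apply/memU.
  have ext0 t : ~~ P t -> extend M t = 0.
    move=> nt; rewrite ffunE; case: pickP => // -[[h r] g] /= /andP[Rr /eqP e].
    by case/negP: nt; rewrite e P_act repsP.
  split=> // t h g; have [Pt | nt] := boolP (P t); last first.
    by rewrite (ext0 t) // mulmx0 mul0mx ext0 // P_act.
  have [r [h' [g' [Rr ->]]]] := reps_cover Pt.
  by rewrite actM !extendE // LM NM !mulmxA.
move=> M /ZP MZ ext0; apply/ffunP=> t; rewrite ffunE.
have := MZ t; rewrite /piece.
case: ifP => [Rt _ | _]; last by rewrite memv0 => /eqP.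
have := extendE 1%g 1%g MZ Rt.
by rewrite ext0 ffunE L1 N1 mul1mx mulmx1.
Qed.

End Orbits.

End EquivariantFunctions.

Arguments fda_mul : simpl never.

(** * Category algebras *)

Section EICategories.

Variable D : eicat.
Hypothesis skelD : skeletal D.
Implicit Types x y z : Ob D.

(** Endomorphisms are invertible in an EI category, and skeletality gives the converse.
    Factorization questions thereby become questions about objects. *)
Lemma skeletal_is_iso x y (f : Hom x y) : is_iso f = (x == y).
Proof.
apply/idP/eqP=> [/skelD // | xy]; case: y / xy f => f.
exact: (loop_isom f (idH x)).
Qed.

Lemma skeletal_antisym x y (f : Hom x y) (g : Hom y x) : x = y.
Proof. exact: skelD (loop_isom f g). Qed.

Lemma unfactorizable_neq x y (f : Hom x y) : unfactorizable f -> x != y.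
Proof. by case/andP; rewrite skeletal_is_iso. Qed.

Lemma factorizableP x y (f : Hom x y) : x != y -> ~~ unfactorizable f ->
  exists z, exists h : Hom x z, exists g : Hom z y,
    [/\ f = g ∘ h, x != z & z != y].
Proof.
rewrite /unfactorizable skeletal_is_iso => -> /=.
case/forallPn=> z /forallPn[h] /forallPn[g].
rewrite negb_imply !skeletal_is_iso negb_or => /andP[/eqP fE /andP[xz zy]].
by exists z, h, g.
Qed.

Lemma unfactorizable_cmp x y z (g : Hom y z) (f : Hom x y) :
  unfactorizable (g ∘ f) -> (x == y) || (y == z).
Proof.
case/andP=> _ /forallP/(_ y)/forallP/(_ f)/forallP/(_ g).
by rewrite eqxx /= !skeletal_is_iso.
Qed.

(** A rank for the partial order of objects: it strictly increases along non-isomorphisms and bounds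
    the length of their chains. *)
Definition height x := #|[set z | (0 < #|Hom z x|)%N]|.

Lemma height_lt x y (f : Hom x y) : x != y -> (height x < height y)%N.
Proof.
move=> xy; apply: proper_card; apply/properP; split.
  apply/subsetP=> z; rewrite !inE => /card_gt0P[g _].
  by apply/card_gt0P; exists (f ∘ g).
exists y; rewrite !inE; first by apply/card_gt0P; exists (idH y).
apply/negP=> /card_gt0P[g _]; case/negP: xy; apply/eqP.
exact: skeletal_antisym f g.
Qed.

Lemma height_le x : (height x <= #|Ob D|)%N.
Proof. exact: max_card. Qed.

Section Units.

Variables (x y : Ob D) (h h' : Hom y y) (g g' : Hom x x).
Hypotheses (hh' : h' ∘ h = idH y) (gg' : g ∘ g' = idH x).

Lemma unfactorizable_unitl (f : Hom x y) :
  unfactorizable f -> unfactorizable (h ∘ f ∘ g).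
Proof.
move=> unf; have xy := unfactorizable_neq unf; case/andP: unf => _ unf.
rewrite /unfactorizable skeletal_is_iso xy /=.
apply/forallP=> z; apply/forallP=> p; apply/forallP=> q; apply/implyP=> /eqP e.
have fE : f = (h' ∘ q) ∘ (p ∘ g').
  rewrite -!cmpA [q ∘ (p ∘ g')]cmpA -e -!cmpA gg' cmpm1 !cmpA hh' cmp1m //.
move/forallP/(_ z)/forallP/(_ (p ∘ g'))/forallP/(_ (h' ∘ q)): unf.
by rewrite -fE eqxx /= !skeletal_is_iso.
Qed.

End Units.

End EICategories.

(** * The category algebra of a skeletal EI category *)

Section CategoryAlgebraTheory.

Variables (k : closedFieldType) (D : eicat).
Hypothesis skelD : skeletal D.
Implicit Types x y z : Ob D.

Variables (gr : Ob D -> finGroupType) (iota : forall x, gr x -> Hom x x).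
Hypothesis iotaM : forall x (g h : gr x), iota (g * h)%g = iota g ∘ iota h.
Hypothesis iota_bij : forall x, bijective (@iota x).
Variable S : forall x, irrType k [set: gr x].
Hypothesis char_gr : forall x, ([pchar k]^'.-group [set: gr x])%g.

Local Notation A := (cat_alg k D).
Implicit Types a b u : A.

Definition coef a (m : mor D) : k := (a : {ffun mor D -> k^o}) m.
Definition basis x y (f : Hom x y) : A := cat_basis k (Mor f).

Lemma coefD a b m : coef (a + b) m = coef a m + coef b m.
Proof. by rewrite /coef ffunE. Qed.

Lemma coefZ (t : k) a m : coef (t *: a) m = t * coef a m.
Proof. by rewrite /coef ffunE. Qed.

Lemma coef0 m : coef 0 m = 0.
Proof. by rewrite /coef ffunE. Qed.

Lemma coef_sum I (r : seq I) (P : pred I) (F : I -> A) m :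
  coef (\sum_(i <- r | P i) F i) m = \sum_(i <- r | P i) coef (F i) m.
Proof. by elim/big_rec2: _ => [|i u v _ <-]; rewrite ?coef0 ?coefD. Qed.

Lemma coef_inj a b : (forall m, coef a m = coef b m) -> a = b.
Proof. by move=> ab; apply/ffunP. Qed.

Lemma coef_basis x y (f : Hom x y) m : coef (basis f) m = (m == Mor f)%:R.
Proof. by rewrite /coef ffunE. Qed.

Lemma coefM a b m : coef (a ⋆ b) m = \sum_y \sum_(g : Hom y (mcod m))
  \sum_(f : Hom (mdom m) y | g ∘ f == marr m) coef a (Mor g) * coef b (Mor f).
Proof. by rewrite /coef ffunE. Qed.

Lemma Mor_marr (m : mor D) : Mor (marr m) = m.
Proof. by case: m => x []. Qed.

Lemma basis_sum a : a = \sum_m coef a m *: basis (marr m).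
Proof.
apply: coef_inj => m; rewrite coef_sum (bigD1 m) //= coefZ coef_basis Mor_marr.
rewrite eqxx mulr1 big1 ?addr0 // => l lm.
by rewrite coefZ coef_basis Mor_marr eq_sym (negPf lm) mulr0.
Qed.

Lemma basisM x y z (g : Hom y z) (f : Hom x y) :
  basis g ⋆ basis f = basis (g ∘ f).
Proof. exact: cat_basisM. Qed.

Lemma iota1 x : iota (1 : gr x)%g = idH x.
Proof.
have [j _ ij] := iota_bij x.
by rewrite -[LHS]cmpm1 -[in LHS](ij (idH x)) -iotaM mul1g ij.
Qed.

Lemma iotaVK x (g : gr x) : iota g^-1%g ∘ iota g = idH x.
Proof. by rewrite -iotaM mulVg iota1. Qed.

Lemma iotaKV x (g : gr x) : iota g ∘ iota g^-1%g = idH x.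
Proof. by rewrite -iotaM mulgV iota1. Qed.

Lemma unfactorizable_iota x y (h : gr y) (g : gr x) (f : Hom x y) :
  unfactorizable (iota h ∘ f ∘ iota g) = unfactorizable f.
Proof.
apply/idP/idP=> unf.
  have := unfactorizable_unitl skelD (iotaKV h) (iotaVK g) unf.
  by rewrite !cmpA iotaVK cmp1m -!cmpA iotaKV cmpm1.
exact: (unfactorizable_unitl skelD (iotaVK h) (iotaKV g)).
Qed.

Definition aut_coef a x (g : gr x) := coef a (Mor (iota g)).

(** An endomorphism of x factors only through x itself, since maps in both directions identify
    objects. So restricting coefficients to Aut(x) is multiplicative. *)
Lemma aut_coefM a b x (g : gr x) :
  aut_coef (a ⋆ b) g = convolution (@aut_coef a x) (@aut_coef b x) g.
Proof.
rewrite /aut_coef coefM (bigD1 x) //= [X in _ + X]big1 => [|y yx]; last first.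
  apply: big1 => p _; apply: big1 => q _.
  by case/negP: yx; apply/eqP/(skeletal_antisym skelD p q).
have ibij := iota_bij x.
rewrite addr0 (reindex (@iota x)) /=; last exact: onW_bij.
apply: eq_bigr => h _; rewrite (big_pred1 (iota (h^-1 * g)%g)) // => f /=.
rewrite iotaM; apply/eqP/eqP=> [e | ->].
  have <- : iota h ∘ f = iota g := e.
  by rewrite cmpA iotaVK cmp1m.
by rewrite cmpA iotaKV cmp1m.
Qed.

Local Notation vtx := {x : Ob D & S x}.
Local Notation vdeg v := (irr_degree (tagged v)).
Implicit Types v w : vtx.
Definition rho (v : vtx) a : 'M[k]_(vdeg v) :=
  irr_eval (@aut_coef a (tag v)) (tagged v).

Lemma rho_linear v : linear (rho v).
Proof.
move=> t a b; rewrite /rho -irr_eval_lin; apply: eq_bigr => g _.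
by rewrite /aut_coef coefD coefZ.
Qed.

Lemma rho_mul v a b : rho v (a ⋆ b) = rho v a *m rho v b.
Proof.
rewrite /rho -irr_evalM; apply: eq_bigr => g _; congr (_ *: _).
exact: aut_coefM.
Qed.

Lemma rho_kerP a :
  rho_ker rho a <-> forall m, mdom m = mcod m -> coef a m = 0.
Proof.
split=> [Na [x [y f]] | a0 v].
  rewrite /mdom /mcod /= => xy; case: y / xy f => f.
  have [j _ ij] := iota_bij x; rewrite -(ij f).
  have /(irr_eval_inj (char_gr x))/(_ (j f)) // :
    forall s : S x, irr_eval (@aut_coef a x) s = 0.
  by move=> s; apply: (Na (Tagged S s)).
rewrite /rho /irr_eval big1 // => g _.
by rewrite /aut_coef a0 // scale0r.
Qed.

(* Non-isomorphisms raise the height, so long products of them vanish. *)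
Lemma rho_ker_linv a :
  rho_ker rho a -> exists b, b ⋆ (fda_one A - a) = fda_one A.
Proof.
move=> /rho_kerP Na; pose pw n := iter n (fun p => p ⋆ a) (fda_one A).
have pw_high n m :
    (height (mcod m) < height (mdom m) + n)%N -> coef (pw n) m = 0.
  elim: n m => [|n IHn] m lt_m.
    rewrite /coef /= ffunE; case: eqP => // mE; move: lt_m.
    by rewrite {1}mE addn0 ltnn.
  rewrite coefM big1 // => y _; apply: big1 => g _; apply: big1 => f _.
  have [xy | xy] := eqVneq (mdom m) y; first by rewrite [coef a _]Na ?mulr0.
  rewrite IHn ?mul0r //; apply: leq_trans lt_m _.
  by rewrite addnS -addSn leq_add2r (height_lt skelD f xy).
(* A nonzero coefficient of the n-th power needs a height gain of at least n, while heights are at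
   most the number of objects. *)
have pw0 : pw #|Ob D|.+1 = 0.
  apply: coef_inj => m; rewrite pw_high ?coef0 //.
  by rewrite addnS ltnS (leq_trans (height_le _)) ?leq_addl.
exists (\sum_(i < #|Ob D|.+1) pw i); rewrite fda_mulBr fda_mulr1.
rewrite fda_mul_suml -sumrB.
have : forall n, \sum_(i < n) (pw i - pw i ⋆ a) = fda_one A - pw n.
  elim=> [|n IHn]; first by rewrite big_ord0 subrr.
  by rewrite big_ord_recr IHn /= addrA subrK.
by move=> ->; rewrite pw0 subr0.
Qed.

Definition embed x (c : gr x -> k) : A := \sum_g c g *: basis (iota g).

Lemma embed_coef x (c : gr x -> k) (g : gr x) : aut_coef (embed c) g = c g.
Proof.
rewrite /aut_coef coef_sum (bigD1 g) //= coefZ coef_basis eqxx mulr1.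
rewrite big1 ?addr0 // => h hg; rewrite coefZ coef_basis.
case: eqP => [/Mor_inj/(bij_inj (iota_bij x))/eqP|]; last by rewrite mulr0.
by rewrite eq_sym (negPf hg).
Qed.

Lemma embed_coef0 x y (c : gr x -> k) (g : gr y) :
  x != y -> aut_coef (embed c) g = 0.
Proof.
move=> xy; rewrite /aut_coef coef_sum big1 // => h _; rewrite coefZ coef_basis.
case: eqP => [/(congr1 (@mdom D))/= yx|]; last by rewrite mulr0.
by rewrite yx eqxx in xy.
Qed.

(** Since the simple modules are jointly faithful, every identity between matrix units and group
    elements can be checked on matrices. *)
Lemma embed_eq x (c d : gr x -> k) :
  (forall s : S x, irr_eval c s = irr_eval d s) -> embed c = embed d.
Proof.
by move=> /(irr_eval_eq (char_gr x)) cd; apply: eq_bigr => g _; rewrite cd.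
Qed.

Lemma embedM x (c d : gr x -> k) : embed c ⋆ embed d = embed (convolution c d).
Proof.
transitivity (\sum_h \sum_g (c h * d (h^-1 * g)%g) *: basis (iota g)).
  rewrite /embed fda_mul_suml; apply: eq_bigr => h _.
  rewrite fda_mul_sumr (reindex_inj (mulgI h^-1%g)); apply: eq_bigr => g _.
  by rewrite fda_scalel fda_scaler basisM -iotaM mulKVg scalerA.
by rewrite exchange_big; apply: eq_bigr => g _; rewrite -scaler_suml.
Qed.

Lemma embed_delta x (h : gr x) : embed (fun g => (g == h)%:R) = basis (iota h).
Proof.
rewrite /embed (bigD1 h) //= eqxx scale1r big1 ?addr0 // => g /negPf ->.
by rewrite scale0r.
Qed.

Lemma unit_coef_exists x (s : S x) i j : exists c : gr x -> k,
  irr_eval c s = delta_mx i j /\ forall s', s' <> s -> irr_eval c s' = 0.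
Proof. by have := irr_eval_surj (char_gr x) (delta_mx i j); apply. Qed.

Definition unit_coef x (s : S x) (i j : 'I_(irr_degree s)) :=
  projT1 (cid (unit_coef_exists i j)).
Arguments unit_coef {x} s i j.

Lemma unit_coefE x (s : S x) i j : irr_eval (unit_coef s i j) s = delta_mx i j.
Proof. by case: (projT2 (cid (unit_coef_exists i j))). Qed.

Lemma unit_coef0 x (s s' : S x) i j :
  s' <> s -> irr_eval (unit_coef s i j) s' = 0.
Proof. by case: (projT2 (cid (unit_coef_exists i j))) => _; apply. Qed.

(* Matrix units of the block of s in the group algebra of gr x. *)
Definition munit x (s : S x) (i j : 'I_(irr_degree s)) : A :=
  embed (unit_coef s i j).
Arguments munit {x} s i j.

Lemma munitM x (s : S x) i j l : munit s i j ⋆ munit s j l = munit s i l.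
Proof.
rewrite /munit embedM; apply: embed_eq => s'; rewrite irr_evalM.
have [-> | ss'] := eqVneq s' s; first by rewrite !unit_coefE mul_delta_mx.
by rewrite !unit_coef0 ?mul0mx //; apply/eqP.
Qed.

(** For fixed j the units [munit s i j] span a copy of the module s. This and its right-hand
    analogue give the equivariance of the test function in [unf_part_neq0]. *)
Lemma basis_munit x (s : S x) (g : gr x) i j :
  basis (iota g) ⋆ munit s i j = \sum_l irr_repr s g l i *: munit s l j.
Proof.
pose c h := \sum_l irr_repr s g l i * unit_coef s l j h.
transitivity (embed c).
  rewrite -embed_delta embedM; apply: embed_eq => s'; rewrite irr_evalM.
  rewrite irr_eval_delta.
  have cE : irr_eval c s' =
      \sum_l irr_repr s g l i *: irr_eval (unit_coef s l j) s'.
    under eq_bigr do rewrite /irr_eval scaler_sumr.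
    rewrite exchange_big; apply: eq_bigr => h _ /=.
    by rewrite scaler_suml; apply: eq_bigr => l _; rewrite scalerA.
  rewrite cE; have [-> | /eqP ss'] := eqVneq s' s.
    rewrite unit_coefE mul_mx_delta.
    by apply: eq_bigr => l _; rewrite unit_coefE.
  rewrite unit_coef0 // mulmx0 big1 // => l _.
  by rewrite unit_coef0 // scaler0.
rewrite /embed /c; under eq_bigr do rewrite scaler_suml.
rewrite exchange_big; apply: eq_bigr => l _ /=.
by rewrite scaler_sumr; apply: eq_bigr => h _; rewrite scalerA.
Qed.

Lemma munit_basis x (s : S x) (g : gr x) i j :
  munit s i j ⋆ basis (iota g) = \sum_l irr_repr s g j l *: munit s i l.
Proof.
pose c h := \sum_l irr_repr s g j l * unit_coef s i l h.
transitivity (embed c).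
  rewrite -embed_delta embedM; apply: embed_eq => s'; rewrite irr_evalM.
  rewrite irr_eval_delta.
  have cE : irr_eval c s' =
      \sum_l irr_repr s g j l *: irr_eval (unit_coef s i l) s'.
    under eq_bigr do rewrite /irr_eval scaler_sumr.
    rewrite exchange_big; apply: eq_bigr => h _ /=.
    by rewrite scaler_suml; apply: eq_bigr => l _; rewrite scalerA.
  rewrite cE; have [-> | /eqP ss'] := eqVneq s' s.
    rewrite unit_coefE mul_delta_mx_l.
    by apply: eq_bigr => l _; rewrite unit_coefE.
  rewrite unit_coef0 // mul0mx big1 // => l _.
  by rewrite unit_coef0 // scaler0.
rewrite /embed /c; under eq_bigr do rewrite scaler_suml.
rewrite exchange_big; apply: eq_bigr => l _ /=.
by rewrite scaler_sumr; apply: eq_bigr => h _; rewrite scalerA.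
Qed.

Definition idx0 (v : vtx) : 'I_(vdeg v) := Ordinal (irr_degree_gt0 (tagged v)).
Definition videm (v : vtx) : A := munit (tagged v) (idx0 v) (idx0 v).

Lemma videm_idem v : is_idempotent (videm v).
Proof. exact: munitM. Qed.

Lemma rho_embed v (c : gr (tag v) -> k) :
  rho v (embed c) = irr_eval c (tagged v).
Proof. by apply: eq_bigr => g _; rewrite embed_coef. Qed.

Lemma rho_embed0 v x (c : gr x -> k) : x != tag v -> rho v (embed c) = 0.
Proof.
by move=> xv; apply: big1 => g _; rewrite embed_coef0 // scale0r.
Qed.

Lemma rho_munit v i j : rho v (munit (tagged v) i j) = delta_mx i j.
Proof. by rewrite rho_embed unit_coefE. Qed.

Lemma rho_munit0 v w i j : w <> v -> rho w (munit (tagged v) i j) = 0.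
Proof.
case: v w i j => [x s] [y t] i j /= wv.
have [xy | xy] := eqVneq x y; last exact: (@rho_embed0 (Tagged S t)).
case: y / xy t wv => t wv; rewrite rho_embed unit_coef0 //= => ts.
by apply: wv; rewrite ts.
Qed.

Lemma rho_surj v (M : 'M[k]_(vdeg v)) :
  exists2 a, rho v a = M & forall w, w <> v -> rho w a = 0.
Proof.
exists (\sum_i \sum_j M i j *: munit (tagged v) i j).
  pose l := GRing.isLinear.Build _ _ _ _ (rho v) (@rho_linear v).
  pose L : {linear A -> 'M[k]_(vdeg v)} := HB.pack (rho v) l.
  rewrite -[rho v]/(L : _ -> _) [RHS]matrix_sum_delta linear_sum.
  apply: eq_bigr => i _; rewrite linear_sum; apply: eq_bigr => j _.
  by rewrite linearZ /= rho_munit.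
move=> w wv; pose l := GRing.isLinear.Build _ _ _ _ (rho w) (@rho_linear w).
pose L : {linear A -> 'M[k]_(vdeg w)} := HB.pack (rho w) l.
rewrite -[rho w]/(L : _ -> _) linear_sum big1 // => i _.
by rewrite linear_sum big1 // => j _; rewrite linearZ /= rho_munit0 // scaler0.
Qed.

Local Notation J := (radical A).

Lemma cat_radicalP a : a \in J <-> forall m, mdom m = mcod m -> coef a m = 0.
Proof.
rewrite -rho_kerP; apply: radicalE.
- exact: rho_linear.
- exact: rho_mul.
- exact: rho_surj.
exact: rho_ker_linv.
Qed.

Lemma radical_basis x y (f : Hom x y) : x != y -> basis f \in J.
Proof.
move=> xy; apply/cat_radicalP=> m mm; rewrite coef_basis.
case: eqP => // mE; move: mm xy; rewrite mE /mdom /mcod /= => ->.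
by rewrite eqxx.
Qed.

Lemma radicalMl a b : b \in J -> a ⋆ b \in J.
Proof.
move/cat_radicalP/rho_kerP=> Nb; apply/cat_radicalP/rho_kerP=> v.
by rewrite rho_mul Nb mulmx0.
Qed.

Lemma radicalMr a b : a \in J -> a ⋆ b \in J.
Proof.
move/cat_radicalP/rho_kerP=> Na; apply/cat_radicalP/rho_kerP=> v.
by rewrite rho_mul Na mul0mx.
Qed.

Local Notation J2 := (vmul J J).

Lemma radical2_ideal a b u : u \in J2 -> a ⋆ u ⋆ b \in J2.
Proof.
apply: (vmul_ind (P := fun u => a ⋆ u ⋆ b \in J2)) => [|t c d cJ dJ|c d cJ dJ].
- by rewrite fda_mulr0 fda_mul0r mem0v.
- by rewrite fda_mulDr fda_mulDl fda_scaler fda_scalel memvD ?memvZ.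
rewrite fda_mulA -fda_mulA.
exact: (vmul_mem (radicalMl a cJ) (radicalMr b dJ)).
Qed.

(** In any factorization of an unfactorizable morphism one factor is an endomorphism, where radical
    elements have coefficient 0. Conversely, a factorizable non-isomorphism is a product of two
    basis elements of the radical. *)
Lemma radical2P a : a \in J2 <->
  a \in J /\ forall x y (f : Hom x y), unfactorizable f -> coef a (Mor f) = 0.
Proof.
split=> [aJ2 | [aJ a_unf]].
  split.
    apply: (vmul_ind (P := fun a => a \in J)) aJ2 => [|t b c bJ cJ|b c bJ cJ].
    - exact: mem0v.
    - by rewrite memvD ?memvZ.
    exact: radicalMr.
  move=> x y f unf_f.
  apply: (vmul_ind (P := fun a => coef a (Mor f) = 0)) aJ2
    => [|t b c b0 c0|b c bJ cJ].
  - exact: coef0.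
  - by rewrite coefD coefZ b0 c0 mulr0 addr0.
  rewrite coefM big1 // => z _; apply: big1 => g _; apply: big1 => h /eqP gh.
  have gh' : g ∘ h = f := gh.
  have := unf_f; rewrite -gh' => /(unfactorizable_cmp skelD)/orP[] /eqP e.
    by rewrite [coef c _](cat_radicalP c).1 ?mulr0.
  by rewrite [coef b _](cat_radicalP b).1 ?mul0r.
rewrite (basis_sum a); apply: memv_suml => -[x [y f]] _; rewrite -/(Mor f).
rewrite /marr /=; have [xy | xy] := eqVneq x y.
  by rewrite (cat_radicalP a).1 // scale0r mem0v.
have [unf | fact] := boolP (unfactorizable f).
  by rewrite a_unf // scale0r mem0v.
have [z [h [g [fE xz zy]]]] := factorizableP skelD xy fact.
have := vmul_mem (radical_basis g zy) (radical_basis h xz).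
by rewrite basisM -fE => fJ2; apply: memvZ.
Qed.

Definition equivariant v w :=
  equivariant_on (irr_repr (tagged w)) (irr_repr (tagged v))
    (@unfactorizable D (tag v) (tag w)) (fun h g f => iota h ∘ f ∘ iota g).

Lemma equi_space_exists v w :
  exists U : {vspace {ffun Hom (tag v) (tag w) -> 'M[k]_(vdeg w, vdeg v)}},
    forall Phi, Phi \in U <-> @equivariant v w Phi.
Proof.
apply: vspace_of_pred => [|t Phi Psi [Phi0 PhiE] [Psi0 PsiE]].
  by split=> [f _ | f h g]; rewrite !ffunE ?mulmx0 ?mul0mx.
split=> [f unf | f h g]; rewrite !ffunE.
  by rewrite Phi0 ?Psi0 ?scaler0 ?addr0.
by rewrite PhiE PsiE mulmxDr mulmxDl -scalemxAr -scalemxAl.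
Qed.

Definition equi_space v w := projT1 (cid (equi_space_exists v w)).

Lemma equi_spaceP v w Phi : Phi \in equi_space v w <-> @equivariant v w Phi.
Proof. exact: projT2 (cid (equi_space_exists v w)) Phi. Qed.

Lemma coef_basis_mul0 x y (f : Hom x y) a m :
  mcod m != y -> coef (basis f ⋆ a) m = 0.
Proof.
move=> my; rewrite coefM big1 // => z _; apply: big1 => g _; apply: big1 => h _.
rewrite coef_basis; case: eqP => [/(congr1 (@mcod D))/= e|]; last by rewrite mul0r.
by case/eqP: my.
Qed.

Lemma coef_mul_basis0 x y (f : Hom x y) a m :
  mdom m != x -> coef (a ⋆ basis f) m = 0.
Proof.
move=> mx; rewrite coefM big1 // => z _; apply: big1 => g _; apply: big1 => h _.
rewrite coef_basis; case: eqP => [/(congr1 (@mdom D))/= e|]; last by rewrite mulr0.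
by case/eqP: mx.
Qed.

Lemma coef_corner0 x y (c : gr y -> k) (d : gr x -> k) a m :
  (mdom m != x) || (mcod m != y) -> coef (embed c ⋆ a ⋆ embed d) m = 0.
Proof.
case/orP=> [mx|my].
  rewrite /embed fda_mul_sumr coef_sum big1 // => g _.
  by rewrite fda_scaler coefZ coef_mul_basis0 ?mulr0.
rewrite -fda_mulA /embed fda_mul_suml coef_sum big1 // => g _.
by rewrite fda_scalel coefZ coef_basis_mul0 ?mulr0.
Qed.

Lemma sum_mor_hom x y (F : mor D -> k) :
    (forall m, (mdom m != x) || (mcod m != y) -> F m = 0) ->
  \sum_m F m = \sum_(f : Hom x y) F (Mor f).
Proof.
move=> F0; transitivity (\sum_(f : Hom x y) \sum_(m | m == Mor f) F m); last first.
  by apply: eq_bigr => f _; rewrite big_pred1_eq.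
rewrite (exchange_big_dep predT) //=; apply: eq_bigr => -[x' [y' f']] _.
rewrite -/(Mor f'); have [xx | nx] := eqVneq x' x; last first.
  by rewrite [F _]F0 /mdom /= ?nx // big1.
subst x'; have [yy | ny] := eqVneq y' y; last first.
  by rewrite [F _]F0 /mcod /= ?ny ?orbT // big1.
subst y'; rewrite (big_pred1 f') // => f.
by apply/eqP/eqP=> [/Mor_inj|->].
Qed.

Lemma embed_basis_embed x y (c : gr y -> k) (d : gr x -> k) (f : Hom x y) :
  embed c ⋆ basis f ⋆ embed d =
  \sum_h \sum_g (c h * d g) *: basis (iota h ∘ f ∘ iota g).
Proof.
rewrite /embed !fda_mul_suml; apply: eq_bigr => h _.
rewrite fda_mul_sumr; apply: eq_bigr => g _.
by rewrite !fda_scalel fda_scaler !basisM scalerA.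
Qed.

(** * Duality between a corner of rad / rad^2 and equivariant functions *)

Section Corner.

Variables v w : vtx.
Local Notation HomVW := (Hom (tag v) (tag w)).
Implicit Types (Phi : {ffun HomVW -> 'M[k]_(vdeg w, vdeg v)}).

Definition hom_eval Phi u := \sum_f coef u (Mor f) *: Phi f.

Lemma hom_eval_sum Phi I (r : seq I) (P : pred I) (F : I -> A) :
  hom_eval Phi (\sum_(i <- r | P i) F i) =
  \sum_(i <- r | P i) hom_eval Phi (F i).
Proof.
rewrite /hom_eval exchange_big; apply: eq_bigr => f _.
by rewrite coef_sum scaler_suml.
Qed.

Lemma hom_evalZ Phi t u : hom_eval Phi (t *: u) = t *: hom_eval Phi u.
Proof.
by rewrite scaler_sumr; apply: eq_bigr => f _; rewrite coefZ scalerA.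
Qed.

Lemma hom_eval_basis Phi (f : HomVW) : hom_eval Phi (basis f) = Phi f.
Proof.
rewrite /hom_eval (bigD1 f) //= coef_basis eqxx scale1r big1 ?addr0 // => g gf.
rewrite coef_basis; case: eqP => [/Mor_inj/eqP|]; last by rewrite scale0r.
by rewrite (negPf gf).
Qed.

(** Equivariance extends from group elements to the group algebras: outer factors become the
    matrices by which they act on w and v. *)
Lemma hom_eval_embed Phi (c : gr (tag w) -> k) (d : gr (tag v) -> k)
    (f : HomVW) :
    equivariant Phi ->
  hom_eval Phi (embed c ⋆ basis f ⋆ embed d) =
  irr_eval c (tagged w) *m Phi f *m irr_eval d (tagged v).
Proof.
case=> _ PhiE; rewrite embed_basis_embed hom_eval_sum !mulmx_suml.
apply: eq_bigr => h _; rewrite hom_eval_sum mulmx_sumr; apply: eq_bigr => g _.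
by rewrite hom_evalZ hom_eval_basis PhiE -!scalemxAl -scalemxAr scalerA.
Qed.

Definition unf_part u : {ffun HomVW -> k^o} :=
  [ffun f => if unfactorizable f then coef u (Mor f) else 0].

Lemma unf_part_linear : linear unf_part.
Proof.
move=> t u1 u2; apply/ffunP=> f; rewrite !ffunE.
by case: ifP => _; rewrite ?coefD ?coefZ // scaler0 addr0.
Qed.

(** The corner is cut out by diagonal matrix units, so on it only the entry at their two indices
    carries information; this entry takes the place of a trace. *)
Definition pairing Phi (b : {ffun HomVW -> k^o}) : k :=
  \sum_f b f * Phi f (idx0 w) (idx0 v).

Lemma pairing_linear1 (b : {ffun HomVW -> k^o}) :
  linear (pairing^~ b : _ -> k^o).
Proof.
move=> t Phi Psi; rewrite /pairing scaler_sumr -big_split; apply: eq_bigr => f _.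
by rewrite !ffunE !mxE mulrDr mulrCA.
Qed.

Lemma pairing_linear2 Phi : linear (pairing Phi : _ -> k^o).
Proof.
move=> t b c; rewrite /pairing scaler_sumr -big_split; apply: eq_bigr => f _.
by rewrite !ffunE mulrDl -scalerAl.
Qed.

Lemma pairing_hom_eval Phi u : equivariant Phi ->
  pairing Phi (unf_part u) = hom_eval Phi u (idx0 w) (idx0 v).
Proof.
case=> Phi0 _; rewrite summxE; apply: eq_bigr => f _; rewrite !ffunE !mxE.
by case: ifP => // /negbT/Phi0 ->; rewrite mxE mul0r mulr0.
Qed.

Local Notation U :=
  <<[seq videm w ⋆ a ⋆ videm v | a <- vbasis J]>>%VS.

Lemma corner_in_radical u : u \in U -> u \in J.
Proof. by case/corner_spanP=> a aJ ->; apply/radicalMr/radicalMl. Qed.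

Lemma corner_idem u : u \in U -> videm w ⋆ u ⋆ videm v = u.
Proof.
case/corner_spanP=> a _ ->; rewrite -!fda_mulA (videm_idem v).
by rewrite !fda_mulA (videm_idem w).
Qed.

Lemma corner_supp u m :
  u \in U -> (mdom m != tag v) || (mcod m != tag w) -> coef u m = 0.
Proof. by move=> /corner_idem <-; apply: coef_corner0. Qed.

Lemma corner_radical2 u : u \in U -> (u \in J2 <-> unf_part u = 0).
Proof.
move=> uU; split=> [/radical2P[_ u0] | u0].
  by apply/ffunP=> f; rewrite !ffunE; case: ifP => // /u0.
apply/radical2P; split=> [|x y f unf]; first exact: corner_in_radical.
have [/(corner_supp uU) // |] :=
  boolP ((mdom (Mor f) != tag v) || (mcod (Mor f) != tag w)).
rewrite /mdom /mcod /= negb_or !negbK => /andP[/eqP xv /eqP yw].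
by subst x y; move/ffunP/(_ f): u0; rewrite !ffunE unf.
Qed.

(** The entry (p, q) of [Phi f] is moved to the distinguished position by multiplying f with matrix
    units on both sides; the resulting corner element detects it. *)
Lemma equivariant_neq0 Phi :
    equivariant Phi ->
    (forall u, u \in U -> pairing Phi (unf_part u) = 0) ->
  Phi = 0.
Proof.
move=> equi Phi0; apply/ffunP=> f; rewrite !ffunE; apply/matrixP=> p q.
have [unf | /equi.1 -> //] := boolP (unfactorizable f).
pose a := munit (tagged w) (idx0 w) p ⋆ basis f ⋆ munit (tagged v) q (idx0 v).
have aU : a \in U.
  apply/corner_spanP; exists a.
    by apply/radicalMr/radicalMl/radical_basis/(unfactorizable_neq skelD unf).
  by rewrite /a -!fda_mulA munitM !fda_mulA munitM.
have := Phi0 a aU; rewrite pairing_hom_eval // hom_eval_embed // !unit_coefE.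
by rewrite delta_mul_delta !mxE !eqxx mulr1.
Qed.

(** Expand u between its two idempotents. Factorizable basis elements then contribute elements of
    rad^2, which have no coefficient at f0. *)
Lemma coef_unitsE (f0 : HomVW) u : unfactorizable f0 -> u \in U ->
  coef u (Mor f0) = \sum_(f : HomVW) unf_part u f *
    coef (videm w ⋆ basis f ⋆ videm v) (Mor f0).
Proof.
move=> unf0 uU.
pose F m := coef (videm w ⋆ (coef u m *: basis (marr m)) ⋆ videm v) (Mor f0).
have uE e e' : e ⋆ u ⋆ e' = \sum_m e ⋆ (coef u m *: basis (marr m)) ⋆ e'.
  by rewrite {1}(basis_sum u) fda_mul_sumr fda_mul_suml.
rewrite -{1}(corner_idem uU) uE coef_sum.
rewrite (@sum_mor_hom (tag v) (tag w) F) => [|m /(corner_supp uU) m0].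
  apply: eq_bigr => f _; rewrite /F fda_scaler fda_scalel coefZ ffunE.
  case: ifP => // /negbT fact; rewrite mul0r.
  suffices /radical2P[_ ->] : videm w ⋆ basis f ⋆ videm v \in J2.
  - by rewrite mulr0.
  - exact: unf0.
  have fJ := radical_basis f (unfactorizable_neq skelD unf0).
  apply/radical2_ideal/radical2P; split=> // x y g unf_g; rewrite coef_basis.
  case: eqP => // e; case/negP: fact; have xv := congr1 (@mdom D) e.
  have yw := congr1 (@mcod D) e; rewrite /mdom /mcod /= in xv yw.
  by subst x y; rewrite -(Mor_inj e).
by rewrite /F m0 scale0r fda_mulr0 fda_mul0r coef0.
Qed.

Lemma unf_part_neq0 u :
    u \in U ->
    (forall Phi, equivariant Phi -> pairing Phi (unf_part u) = 0) ->
  unf_part u = 0.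
Proof.
move=> uU u0; apply/ffunP=> f0; rewrite !ffunE; case: ifP => // unf0.
pose a p q (f : HomVW) :=
  munit (tagged w) (idx0 w) p ⋆ basis f ⋆ munit (tagged v) q (idx0 v).
(* A test function built to extract the coefficient at f0: matrix units on both sides of f supply
   the indices p and q, and their transformation rules give equivariance. *)
pose Phi : {ffun HomVW -> 'M[k]_(vdeg w, vdeg v)} :=
  [ffun f => if unfactorizable f
             then \matrix_(p, q) coef (a p q f) (Mor f0) else 0].
have equi : equivariant Phi.
  split=> [f /negPf nf | f h g]; rewrite !ffunE ?nf //.
  rewrite unfactorizable_iota; case: ifP => unf; last by rewrite mulmx0 mul0mx.
  apply/matrixP=> p q; rewrite !mxE /a -!basisM -!fda_mulA basis_munit.
  rewrite !fda_mulA munit_basis !fda_mul_suml coef_sum.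
  under eq_bigr do rewrite fda_mul_sumr coef_sum.
  rewrite exchange_big; apply: eq_bigr => l _.
  rewrite [(irr_repr _ h *m _) p l]mxE mulr_suml.
  apply: eq_bigr => r _; rewrite !fda_scalel fda_scaler !coefZ.
  rewrite [(\matrix_(_, _) _) r l]mxE.
  by rewrite mulrCA mulrC.
rewrite (coef_unitsE unf0 uU) -[RHS](u0 _ equi).
apply: eq_bigr => f _; rewrite !ffunE; case: ifP => unf; last by rewrite !mul0r.
by rewrite mxE.
Qed.

Lemma corner_dim_equi :
  @corner_dim k A (videm w) (videm v) = \dim (equi_space v w).
Proof.
pose l := GRing.isLinear.Build _ _ _ _ unf_part unf_part_linear.
pose L : {linear A -> {ffun HomVW -> k^o}} := HB.pack unf_part l.
have LE u : linfun L u = unf_part u by rewrite lfunE.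
(* On the corner the kernel of [unf_part] is exactly rad^2, so B is a concrete model of the corner
   of rad / rad^2. *)
pose B := (linfun L @: U)%VS.
have dimB : @corner_dim k A (videm w) (videm v) = \dim B.
  rewrite corner_dimE -(limg_ker_dim (linfun L) U).
  suffices -> : (U :&: lker (linfun L))%VS = (U :&: J2)%VS by rewrite addKn.
  apply/vspaceP=> u; rewrite !memv_cap; apply: andb_id2l => uU.
  rewrite memv_ker LE; apply/eqP/idP => [u0 | /(corner_radical2 uU) //].
  exact/(corner_radical2 uU).
rewrite dimB; apply/eqP; rewrite eqn_leq; apply/andP; split.
  apply: (@dimv_le_pairing _ _ _ (fun c Phi => pairing Phi c)).
  - exact: pairing_linear2.
  - exact: pairing_linear1.
  move=> _ /memv_imgP[u uU ->] u0; rewrite LE; apply: unf_part_neq0 => // Phi equi.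
  by rewrite -LE u0 //; apply/equi_spaceP.
apply: (@dimv_le_pairing _ _ _ pairing).
- exact: pairing_linear1.
- exact: pairing_linear2.
move=> Phi /equi_spaceP equi Phi0; apply: equivariant_neq0 => // u uU.
by rewrite -LE Phi0 //; apply: memv_img.
Qed.

End Corner.

Theorem ordinary_quiver_cat_alg :
  quiver_iso (@Quiver vtx (fun v w => \dim (equi_space v w)))
    (ordinary_quiver A).
Proof.
have [phi bij_phi narrows_phi] := ordinary_quiver_recognition rho_linear rho_mul
  rho_surj rho_ker_linv videm_idem (fun v => rho_munit (idx0 v) (idx0 v))
  (fun v w => @rho_munit0 v w (idx0 v) (idx0 v)).
exists phi => // v w; rewrite narrows_phi /=; exact: corner_dim_equi.
Qed.

End CategoryAlgebraTheory.

(** * Intertwiners along an unfactorizable morphism *)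

Section SummandFromQuotient.

Variables (k : fieldType) (gT qT : finGroupType).
Variables (H : {group gT}) (Q : {group qT}).
Variable q : gT -> qT.
Hypothesis qM : {in H &, {morph q : x y / (x * y)%g}}.
Hypothesis qH : {in H, forall h, q h \in Q}.
Hypothesis q_surj : {in Q, forall z, exists2 h, h \in H & q h = z}.
Hypothesis charH : ([pchar k]^'.-group H)%g.
Hypothesis charQ : ([pchar k]^'.-group Q)%g.
Variable sQ : irrType k Q.
Hypothesis infl_repr : forall i : sQ, mx_repr H (fun h => irr_repr i (q h)).

(** A simple submodule of N is fixed by the kernel of q, hence comes from an irreducible module of
    Q; Maschke splits it off V. The map q is a bare function so that both [coset] and [swap_quo]
    fit. *)
Lemma summand_of_trivial_kernel (V : representation k H)
    (N : 'M[k]_(rdegree V)) :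
    mxmodule V N -> N != 0 ->
    {in H, forall h, q h = 1%g -> N *m V h = N} ->
  exists i, is_summand (Representation (MxRepresentation (infl_repr i))) V.
Proof.
move=> modN nzN trivN.
have [N1 simN1 sN1N] : exists2 U, mxsimple V U & (U <= N)%MS.
  have := mxsimple_exists modN nzN.
  (* [mxsimple_exists] yields its witness only for a boolean goal, so the existence statement is
     reflected into a boolean. *)
  move=> /(_ `[< exists2 U, mxsimple V U & (U <= N)%MS >]) cl.
  by apply/asboolP/cl => -[U simU sUN]; apply/asboolP; exists U.
have modN1 := mxsimple_module simN1.
pose r1 := submod_repr modN1.
have q1 : q 1%g = 1%g.
  by apply: (mulgI (q 1%g)); rewrite -qM ?group1 // !mulg1.
have qV h : h \in H -> q h^-1%g = (q h)^-1%g.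
  move=> Hh; apply: (mulgI (q h)).
  by rewrite -qM ?groupV // !mulgV q1.
have triv1 h : h \in H -> q h = 1%g -> r1 h = 1%:M.
  move=> Hh qh; apply: (can_inj (val_submodK (U := N1))).
  rewrite -[r1 h]mul1mx (val_submodJ modN1) //.
  have [X ->] : exists X, val_submod (1%:M : 'M_(\rank N1)) = X *m N.
    by apply/submxP; apply: submx_trans (val_submodP _) sN1N.
  by rewrite -mulmxA trivN.
have r1_q g h : g \in H -> h \in H -> q g = q h -> r1 g = r1 h.
  move=> Hg Hh gh; rewrite -[g](mulgKV h) repr_mxM ?groupM ?groupV //.
  by rewrite triv1 ?mul1mx ?groupM ?groupV // qM ?groupV // qV // gh mulgV.
(* A set-theoretic section of q. It need not be multiplicative: [r1] is constant on the fibres of q,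
   so r1 composed with it is a representation of Q. *)
pose sec z := odflt 1%g [pick h in H | q h == z].
have secP z : z \in Q -> sec z \in H /\ q (sec z) = z.
  move=> Qz; rewrite /sec; case: pickP => [h /andP[Hh /eqP] // | no_h].
  by have [h Hh hz] := q_surj Qz; have := no_h h; rewrite Hh hz eqxx.
have rQ_repr : mx_repr Q (fun z => r1 (sec z)).
  split=> [|y z Qy Qz].
    have [s1 s2] := secP 1%g (group1 _).
    by rewrite triv1.
  have [sy qy] := secP y Qy; have [sz qz] := secP z Qz.
  have [syz qyz] := secP (y * z)%g (groupM Qy Qz).
  rewrite -repr_mxM //; apply: r1_q; rewrite ?groupM //.
  by rewrite qM // qy qz qyz.
pose rQ := MxRepresentation rQ_repr.
have rQE h : h \in H -> rQ (q h) = r1 h.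
  by move=> Hh; have [s1 s2] := secP _ (qH Hh); apply: r1_q.
have irr1 : mx_irreducible r1 by apply/submod_mx_irr.
have irrQ : mx_irreducible rQ.
  case/mx_irrP: irr1 => n_gt0 min1; apply/mx_irrP; split=> // U modU nzU.
  apply: min1 => //; apply/mxmoduleP=> h Hh.
  by rewrite -rQE //; apply: (mxmoduleP modU); apply: qH.
have [B en freeB homB] := rsim_irr_comp_pchar sQ charQ irrQ.
have sim1 : mx_rsim r1 (MxRepresentation (infl_repr (irr_comp sQ rQ))).
  exists B => // h Hh; rewrite -rQE //.
  exact/homB/qH.
have [N2 modN2 sumN dxN] := mx_Maschke_pchar V charH modN1 (submx1 _).
exists (irr_comp sQ rQ), (Representation (submod_repr modN2)).
apply: repr_iso_trans
  (_ : repr_iso V (Representation (submod_repr (mxmodule1 V)))) _.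
  by apply/mx_rsim_sym/rsim_submod1.
apply: (mx_rsim_dadd (modU := modN1) (modV := modN2)) => //.
exact: mx_rsim_refl.
Qed.

End SummandFromQuotient.

Section DimensionPair.

Variables (k : fieldType) (E E1 E2 : vectType k) (p1 : E -> E1) (p2 : E -> E2).
Hypotheses (lin1 : linear p1) (lin2 : linear p2).

(** Here p1 and p2 are the two halves of a block matrix, and U decomposes as a product along
    them. *)
Lemma dimv_pair (U : {vspace E}) (U1 : {vspace E1}) (U2 : {vspace E2}) :
    {in U, forall u, p1 u \in U1} -> {in U, forall u, p2 u \in U2} ->
    (forall u, p1 u = 0 -> p2 u = 0 -> u = 0) ->
    (forall u1 u2, u1 \in U1 -> u2 \in U2 ->
      exists2 u, u \in U & p1 u = u1 /\ p2 u = u2) ->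
  \dim U = (\dim U1 + \dim U2)%N.
Proof.
move=> UU1 UU2 inj surj.
pose l1 := GRing.isLinear.Build _ _ _ _ p1 lin1.
pose L1 : {linear E -> E1} := HB.pack p1 l1.
pose l2 := GRing.isLinear.Build _ _ _ _ p2 lin2.
pose L2 : {linear E -> E2} := HB.pack p2 l2.
have LE1 u : linfun L1 u = p1 u by rewrite lfunE.
have LE2 u : linfun L2 u = p2 u by rewrite lfunE.
rewrite -(limg_ker_dim (linfun L1) U) addnC.
have -> : (linfun L1 @: U)%VS = U1.
  apply/vspaceP=> u1; apply/memv_imgP/idP => [[u uU ->]|u1U].
    by rewrite LE1 UU1.
  by have [u uU [pu _]] := surj u1 0 u1U (mem0v _); exists u; rewrite ?LE1.
have <- : (linfun L2 @: (U :&: lker (linfun L1)))%VS = U2.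
  apply/vspaceP=> u2; apply/memv_imgP/idP => [[u + ->]|u2U].
    by rewrite memv_cap => /andP[uU _]; rewrite LE2 UU2.
  have [u uU [pu qu]] := surj 0 u2 (mem0v _) u2U; exists u; rewrite ?LE2 //.
  by rewrite memv_cap uU memv_ker LE1 pu eqxx.
rewrite limg_dim_eq //; apply/eqP; rewrite -subv0; apply/subvP=> u.
rewrite !memv_cap !memv_ker LE1 LE2 memv0 => /andP[/andP[_ /eqP u1] /eqP u2].
by rewrite (inj u).
Qed.

End DimensionPair.

(** * Intertwiners along a morphism and their dimension *)

Section SwapHom.

Variables (k : closedFieldType) (C : eicat) (x y : Ob C) (al : Hom x y).
Hypothesis char_x : ([pchar k]^'.-group [set: autC x])%g.
Hypothesis char_y : ([pchar k]^'.-group [set: autC y])%g.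
Local Notation G1 := (swapr_group al).
Local Notation H1 := (swapl_group al).
Implicit Types (V X : representation k G1) (W Y : representation k H1).

(** The stabilizer condition on the value of an equivariant function at al. The relation al g = h al
    already forces g into G_1 and h into H_1. *)
Definition swap_commutes V W (M : 'M[k]_(rdegree W, rdegree V)) :=
  forall (g : autC x) (h : autC y), al ∘ g = h ∘ al -> W h *m M = M *m V g.

Lemma swap_hom_exists V W : exists U : {vspace 'M[k]_(rdegree W, rdegree V)},
  forall M, M \in U <-> swap_commutes M.
Proof.
apply: vspace_of_pred => [g h _|t M N HM HN g h gh].
  by rewrite mulmx0 mul0mx.
by rewrite mulmxDr mulmxDl -scalemxAr -scalemxAl (HM g h gh) (HN g h gh).
Qed.

Definition swap_hom V W := projT1 (cid (swap_hom_exists V W)).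

Lemma swap_homP V W M : M \in swap_hom V W <-> swap_commutes M.
Proof. exact: projT2 (cid (swap_hom_exists V W)) M. Qed.

Lemma swap_memr (g : autC x) (h : autC y) : al ∘ g = h ∘ al -> g \in swapr al.
Proof. by move=> gh; rewrite inE; apply/existsP; exists h; apply/eqP. Qed.

Lemma swap_meml (g : autC x) (h : autC y) : al ∘ g = h ∘ al -> h \in swapl al.
Proof. by move=> gh; rewrite inE; apply/existsP; exists g; apply/eqP. Qed.

Lemma dim_swap_hom_le_l V V' W :
  repr_iso V V' -> (\dim (swap_hom V W) <= \dim (swap_hom V' W))%N.
Proof.
case=> B _ freeB homB.
apply: (@dimv_le_inj _ _ _ (fun M => M *m B)) => [t M N|M /swap_homP HM|M _ /eqP].
- by rewrite mulmxDl -scalemxAl.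
- apply/swap_homP=> g h gh.
  by rewrite mulmxA (HM _ _ gh) -!mulmxA homB // (swap_memr gh).
by rewrite mulmx_free_eq0 // => /eqP.
Qed.

Lemma dim_swap_hom_le_r V W W' :
  repr_iso W W' -> (\dim (swap_hom V W) <= \dim (swap_hom V W'))%N.
Proof.
move/repr_iso_sym; case=> B eqn freeB homB.
apply: (@dimv_le_inj _ _ _ (fun M => B *m M)) => [t M N|M /swap_homP HM|M _ /eqP].
- by rewrite mulmxDr -scalemxAr.
- apply/swap_homP=> g h gh.
  by rewrite mulmxA homB ?(swap_meml gh) // -!mulmxA (HM _ _ gh).
have fullB : row_full B by rewrite /row_full -[X in _ == X]eqn.
have [B' B'B] := row_fullP fullB.
by move/eqP=> BM0; rewrite -[M]mul1mx -B'B -mulmxA BM0 mulmx0.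
Qed.

Lemma dim_swap_hom_iso V V' W W' : repr_iso V V' -> repr_iso W W' ->
  \dim (swap_hom V W) = \dim (swap_hom V' W').
Proof.
move=> VV' WW'; apply/eqP; rewrite eqn_leq.
rewrite (leq_trans (dim_swap_hom_le_l W VV') (dim_swap_hom_le_r V' WW')).
by rewrite (leq_trans (dim_swap_hom_le_l W' (repr_iso_sym VV'))
  (dim_swap_hom_le_r V (repr_iso_sym WW'))).
Qed.

Lemma dim_swap_hom_addl V V' W :
  \dim (swap_hom (dadd_grepr V V') W) =
  (\dim (swap_hom V W) + \dim (swap_hom V' W))%N.
Proof.
apply: (@dimv_pair _ _ _ _ lsubmx rsubmx).
- exact: linearP.
- exact: linearP.
- move=> M /(@swap_homP (dadd_grepr V V') W M) HM.
  apply/swap_homP=> g h gh; have := HM g h gh => /=.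
  rewrite -{1 2}[M]hsubmxK mul_mx_row mul_row_block !mulmx0 addr0 add0r.
  by move/eq_row_mx=> [].
- move=> M /(@swap_homP (dadd_grepr V V') W M) HM.
  apply/swap_homP=> g h gh; have := HM g h gh => /=.
  rewrite -{1 2}[M]hsubmxK mul_mx_row mul_row_block !mulmx0 addr0 add0r.
  by move/eq_row_mx=> [].
- by move=> M l0 r0; rewrite -[M]hsubmxK l0 r0 row_mx0.
move=> M N /swap_homP HM /swap_homP HN; exists (row_mx M N).
  apply/(@swap_homP (dadd_grepr V V') W) => g h gh /=.
  rewrite mul_mx_row mul_row_block.
  by rewrite !mulmx0 addr0 add0r (HM g h gh) (HN g h gh).
by rewrite row_mxKl row_mxKr.
Qed.

Lemma dim_swap_hom_addr V W W' :
  \dim (swap_hom V (dadd_grepr W W')) =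
  (\dim (swap_hom V W) + \dim (swap_hom V W'))%N.
Proof.
apply: (@dimv_pair _ _ _ _ usubmx dsubmx).
- exact: linearP.
- exact: linearP.
- move=> M /(@swap_homP V (dadd_grepr W W') M) HM.
  apply/swap_homP=> g h gh; have := HM g h gh => /=.
  rewrite -{1 2}[M]vsubmxK mul_block_col mul_col_mx !mul0mx addr0 add0r.
  by move/eq_col_mx=> [].
- move=> M /(@swap_homP V (dadd_grepr W W') M) HM.
  apply/swap_homP=> g h gh; have := HM g h gh => /=.
  rewrite -{1 2}[M]vsubmxK mul_block_col mul_col_mx !mul0mx addr0 add0r.
  by move/eq_col_mx=> [].
- by move=> M l0 r0; rewrite -[M]vsubmxK l0 r0 col_mx0.
move=> M N /swap_homP HM /swap_homP HN; exists (col_mx M N).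
  apply/(@swap_homP V (dadd_grepr W W')) => g h gh /=.
  rewrite mul_block_col mul_col_mx.
  by rewrite !mul0mx addr0 add0r (HM g h gh) (HN g h gh).
by rewrite col_mxKu col_mxKd.
Qed.

Lemma dim_swap_hom_suml I r (P : pred I) (F : I -> representation k G1) W :
  \dim (swap_hom (\big[@dadd_grepr k _ G1/grepr0]_(i <- r | P i) F i) W) =
  (\sum_(i <- r | P i) \dim (swap_hom (F i) W))%N.
Proof.
elim/big_rec2: _ => [|i n V _ <-]; last exact: dim_swap_hom_addl.
apply/eqP; rewrite dimv_eq0 -subv0; apply/subvP=> M _.
by rewrite memv0; apply/eqP; apply: thinmx0.
Qed.

Lemma dim_swap_hom_sumr I r (P : pred I) (F : I -> representation k H1) V :
  \dim (swap_hom V (\big[@dadd_grepr k _ H1/grepr0]_(i <- r | P i) F i)) =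
  (\sum_(i <- r | P i) \dim (swap_hom V (F i)))%N.
Proof.
elim/big_rec2: _ => [|i n W _ <-]; last exact: dim_swap_hom_addr.
apply/eqP; rewrite dimv_eq0 -subv0; apply/subvP=> M _.
by rewrite memv0; apply/eqP; apply: flatmx0.
Qed.

Lemma dim_swap_hom_mulnl V W n :
  \dim (swap_hom (muln_grepr V n) W) = (n * \dim (swap_hom V W))%N.
Proof. by rewrite dim_swap_hom_suml sum_nat_const card_ord. Qed.

Lemma dim_swap_hom_mulnr V W n :
  \dim (swap_hom V (muln_grepr W n)) = (n * \dim (swap_hom V W))%N.
Proof. by rewrite dim_swap_hom_sumr sum_nat_const card_ord. Qed.

Local Notation U := (swap_irr k al).
Local Notation infr i := (@inflr k C x y al i).
Local Notation infl i := (@infll k C x y al i).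

Lemma char_G1 : ([pchar k]^'.-group G1)%g.
Proof. exact: pgroupS (subsetT _) char_x. Qed.

Lemma char_H1 : ([pchar k]^'.-group H1)%g.
Proof. exact: pgroupS (subsetT _) char_y. Qed.

Lemma char_swap_quo : ([pchar k]^'.-group (swapr al / fixr al)%g)%g.
Proof. exact: quotient_pgroup char_G1. Qed.

Lemma swap_quoM : {in swapl al &, {morph swap_quo al : h h' / (h * h')%g}}.
Proof.
move=> h h' Hh Hh'.
have [g Gg gh] := swaplP Hh; have [g' Gg' gh'] := swaplP Hh'.
rewrite (swap_quoE (g := (g * g')%g)).
  by rewrite (swap_quoE gh) (swap_quoE gh') morphM // (subsetP (swapr_norm al)).
by rewrite !autME cmpA gh -cmpA gh' cmpA.
Qed.

Lemma swap_quo_mem :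
  {in swapl al, forall h, swap_quo al h \in (swapr al / fixr al)%g}.
Proof.
by move=> h /swaplP[g Gg gh]; rewrite (swap_quoE gh) mem_quotient.
Qed.

Lemma swap_quo_surj :
  {in (swapr al / fixr al)%g,
    forall z, exists2 h, h \in swapl al & swap_quo al h = z}.
Proof.
move=> _ /morphimP[g Ng Gg ->]; move: (Gg); rewrite inE => /existsP[h /eqP gh].
by exists h; [exact: swap_meml gh | exact: swap_quoE].
Qed.

(* The row space of M is a submodule of V on which G_0 acts trivially. *)
Lemma swap_hom_eq0l V W : (forall i, ~ is_summand (infr i) V) ->
  \dim (swap_hom V W) = 0%N.
Proof.
move=> noV; apply/eqP; rewrite dimv_eq0 -subv0; apply/subvP=> M /swap_homP HM.
rewrite memv0; apply/negPn/negP=> M0.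
have cosetM : {in G1 &, {morph coset (fixr al) : g h / (g * h)%g}}.
  by move=> g h Gg Gh; rewrite morphM // (subsetP (swapr_norm al)).
have coset_mem :
    {in G1, forall g, coset (fixr al) g \in (swapr al / fixr al)%G}.
  by move=> g Gg; apply: mem_quotient.
have coset_surj : {in (swapr al / fixr al)%G,
    forall z, exists2 g, g \in G1 & coset (fixr al) g = z}.
  by move=> _ /morphimP[g Ng Gg ->]; exists g.
have modM : mxmodule V <<M>>%MS.
  apply/mxmoduleP=> g; rewrite inE => /existsP[h /eqP gh].
  by rewrite genmxE (eqmxMr _ (genmxE M)) -(HM g h gh) submxMl.
have nzM : <<M>>%MS != 0 by rewrite -mxrank_eq0 genmxE mxrank_eq0.
have trivM :
    {in G1, forall g, coset (fixr al) g = 1%g -> <<M>>%MS *m V g = <<M>>%MS}.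
  move=> g Gg /coset_idr; rewrite (subsetP (swapr_norm al)) // => /(_ isT).
  rewrite inE => /eqP gal.
  have MV : M *m V g = M.
    by rewrite -(HM g 1%g) ?repr_mx1 ?mul1mx // gal aut1E cmp1m.
  have /submxP[X ->] : (<<M>> <= M)%MS by rewrite genmxE.
  by rewrite -mulmxA MV.
have [i Vi] := summand_of_trivial_kernel cosetM coset_mem coset_surj char_G1
  char_swap_quo (@inflr_repr_subproof k C x y al) modM nzM trivM.
exact: noV Vi.
Qed.

(* The kernel of M has a complement in W, on which H_0 acts trivially. *)
Lemma swap_hom_eq0r V W : (forall i, ~ is_summand (infl i) W) ->
  \dim (swap_hom V W) = 0%N.
Proof.
move=> noW; apply/eqP; rewrite dimv_eq0 -subv0; apply/subvP=> M /swap_homP HM.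
rewrite memv0; apply/negPn/negP=> M0.
have modK : mxmodule W (kermx M).
  apply/mxmoduleP=> h /swaplP[g Gg gh]; apply/sub_kermxP.
  by rewrite -mulmxA (HM g h gh) mulmxA mulmx_ker mul0mx.
have [N modN sumN dxN] := mx_Maschke_pchar W char_H1 modK (submx1 _).
have nzN : N != 0.
  apply: contraNneq M0 => N0; rewrite -[M]mul1mx; apply/eqP/sub_kermxP.
  by rewrite -sumN N0 addsmx0.
have trivN : {in H1, forall h, swap_quo al h = 1%g -> N *m W h = N}.
  move=> h Hh; have [g Gg gh] := swaplP Hh; rewrite (swap_quoE gh).
  move=> /coset_idr; rewrite (subsetP (swapr_norm al)) // => /(_ isT).
  rewrite inE => /eqP gal.
  have hM : W h *m M = M.
    by rewrite (HM 1%g) ?repr_mx1 ?mulmx1 // -gh gal aut1E cmpm1.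
  (* The difference N h - N lies in N and is killed by M, because h fixes M; N meets the kernel of M
     trivially. *)
  apply/eqP; rewrite -subr_eq0 -submx0 -(mxdirect_addsP dxN) sub_capmx.
  apply/andP; split.
    by apply/sub_kermxP; rewrite mulmxBl -mulmxA hM subrr.
  by rewrite addmx_sub ?eqmx_opp ?(mxmoduleP modN).
have [i Wi] := summand_of_trivial_kernel swap_quoM swap_quo_mem swap_quo_surj
  char_H1
  char_swap_quo (@infll_repr_subproof k C x y al) modN nzN trivN.
exact: noW Wi.
Qed.

(** Elements g and h with al g = h al have the same image in G_1/G_0, so these are the homomorphisms
    between two simple modules of that quotient, and Schur's lemma applies. *)
Lemma dim_swap_hom_irr i j :
  \dim (swap_hom (infr i) (infl j)) = (i == j).
Proof.
have commP (M : 'M[k]_(irr_degree j, irr_degree i)) :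
    M \in swap_hom (infr i) (infl j) ->
    {in (swapr al / fixr al)%g,
      forall z, irr_repr j z *m M = M *m irr_repr i z}.
  move=> /(@swap_homP (infr i) (infl j)) HM _ /morphimP[g Ng Gg ->].
  move: (Gg); rewrite inE => /existsP[h /eqP gh].
  by have := HM g h gh; rewrite /= (swap_quoE gh).
have [ij | ij] := eqVneq i j; last first.
  apply/eqP; rewrite dimv_eq0 -subv0; apply/subvP=> M /commP HM; rewrite memv0.
  (* Intertwining extends linearly to the group ring, whose Wedderburn idempotent for i acts as 1 on
     i and as 0 on j. *)
  have op A : (A \in group_ring k (swapr al / fixr al)%G)%MS ->
      gring_op (irr_repr j) A *m M = M *m gring_op (irr_repr i) A.
    have opE (s : U) a : gring_op (irr_repr s)
        (\sum_(z in (swapr al / fixr al)%G) a z *: regular_repr k _ z) =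
        \sum_(z in (swapr al / fixr al)%G) a z *: irr_repr s z.
      rewrite linear_sum; apply: eq_bigr => z Qz.
      by rewrite linearZ /= gring_opG.
    move=> /envelop_mxP[a ->]; rewrite !opE mulmx_suml mulmx_sumr.
    by apply: eq_bigr => z Qz; rewrite -scalemxAl -scalemxAr HM.
  have eR := Wedderburn_id_mem i.
  have eG : (Wedderburn_id i \in group_ring k (swapr al / fixr al)%G)%MS.
    by rewrite -(Wedderburn_sum_pchar U char_swap_quo) (sumsmx_sup i).
  have := op _ eG; rewrite op_Wedderburn_id_pchar ?char_swap_quo // mulmx1 => <-.
  by rewrite (irr_repr'_op0_pchar char_swap_quo ij eR) mul0mx.
subst j; have absi : mx_absolutely_irreducible (irr_repr i).
  exact: (group_closure_closed_field (socle_irr i)).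
pose I1 : 'M[k]_(rdegree (infl i), rdegree (infr i)) :=
  (1%:M : 'M_(irr_degree i)).
suffices -> : swap_hom (infr i) (infl i) = <[I1]>%VS.
  rewrite dim_vline; congr (nat_of_bool _); apply/eqP=> /matrixP.
  have i0 := Ordinal (irr_degree_gt0 i) => /(_ i0 i0)/eqP.
  by rewrite !mxE eqxx oner_eq0.
apply/vspaceP=> M; apply/idP/vlineP=> [/commP HM | [a ->]].
  have /is_scalar_mxP[a aE] : is_scalar_mx (M : 'M_(irr_degree i)).
    apply: (mx_abs_irr_cent_scalar absi); apply/centgmxP=> z Qz.
    by rewrite HM.
  by exists a; rewrite [LHS]aE /I1 scalemx1.
apply/(@swap_homP (infr i) (infl i)) => g h gh /=; rewrite /I1 scalemx1.
by rewrite (swap_quoE gh) scalar_mxC.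
Qed.

(** Bilinearity over direct sums leaves only the pairs i = j; the remainders X and Y admit no
    nonzero intertwiner. The statement takes any e and f with [is_multiplicity], the only property
    by which [multiplicity] is specified. *)
Lemma dim_swap_hom V W (e f : U -> nat) :
    is_multiplicity (@inflr k C x y al) V e ->
    is_multiplicity (@infll k C x y al) W f ->
  \dim (swap_hom V W) = (\sum_i e i * f i)%N.
Proof.
move=> [X [VX noX]] [Y [WY noY]].
rewrite (dim_swap_hom_iso VX WY) dim_swap_hom_addl (swap_hom_eq0l _ noX) addn0.
rewrite dim_swap_hom_addr (swap_hom_eq0r _ noY) addn0 dim_swap_hom_suml.
apply: eq_bigr => i _; rewrite dim_swap_hom_mulnl dim_swap_hom_sumr.
congr (_ * _)%N; rewrite (bigD1 i) // big1 => [|j /andP[_ ji]].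
  by rewrite dim_swap_hom_mulnr dim_swap_hom_irr eqxx muln1 /= addn0.
by rewrite dim_swap_hom_mulnr dim_swap_hom_irr eq_sym (negPf ji) muln0.
Qed.

End SwapHom.

Lemma biorbit_rep_eq (C : eicat) (R : unfact_reps C) (x y : Ob C)
    (r r' : Hom x y) (h h' : autC y) (g g' : autC x) :
  r \in R x y -> r' \in R x y -> h ∘ r ∘ g = h' ∘ r' ∘ g' -> r = r'.
Proof.
move=> Rr Rr' e; have [r0 [_ uniq_r0]] := rep_uniq R (rep_unfact Rr).
have r0r : r0 = r by apply: uniq_r0; split=> //; apply: biorbit_refl.
have r0r' : r0 = r'.
  apply: uniq_r0; split=> //; apply: biorbit_trans (_ : h ∘ r ∘ g \in _) _.
    by rewrite e; apply/biorbitP; exists h', g'.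
  by apply: biorbit_sym; apply/biorbitP; exists h, g.
by rewrite -r0r.
Qed.

(** * Counting arrows at the representatives *)

Section EquivariantDimension.

Variables (k : closedFieldType) (C : eicat).
Hypothesis skelC : skeletal C.
Hypothesis charC : forall x : Ob C, ([pchar k]^'.-group [set: autC x])%g.
Variables (R : unfact_reps C) (S : forall x : Ob C, irrType k [set: autC x]).

(** The identity, named to serve as [iota] for C itself. *)
Definition aut_hom (x : Ob C) (g : autC x) : Hom x x := g.

Lemma dim_equi_space (v w : {x : Ob C & S x}) :
  \dim (@equi_space k C (fun x => autC x) aut_hom S v w) =
  (\sum_(al in R (tag v) (tag w)) arrow_mult al (tagged v) (tagged w))%N.
Proof.
transitivity (\sum_(al in R (tag v) (tag w))
    \dim (swap_hom (resr al (tagged v)) (resl al (tagged w))))%N; last first.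
  apply: eq_bigr => al Ral.
  exact: (dim_swap_hom (charC (tag v)) (charC (tag w))
      (multiplicityP (@inflr_gt0 k C (tag v) (tag w) al) (resr al (tagged v)))
      (multiplicityP (@infll_gt0 k C (tag v) (tag w) al) (resl al (tagged w)))).
have reprM (x : Ob C) (s : S x) (g g' : autC x) :
    irr_repr s (g * g')%g = irr_repr s g *m irr_repr s g'.
  exact: (repr_mxM (irr_repr s) (in_setT g) (in_setT g')).
apply: (@dim_equivariant_orbits k _ _ (autC (tag w)) (autC (tag v))
  (irr_repr (tagged w)) (irr_repr (tagged v)) _ _ _ _ _
  (@unfactorizable C (tag v) (tag w)) (fun h g f => aut_hom h ∘ f ∘ aut_hom g)).
- exact: repr_mx1.
- exact: reprM.
- exact: repr_mx1.
- exact: reprM.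
- by move=> h h' g g' f; rewrite /aut_hom !autME !cmpA.
- move=> h g f.
  by apply: (@unfactorizable_iota C skelC (fun x => autC x) aut_hom) => // z;
    exists id.
- by move=> al /rep_unfact.
- move=> f /(rep_uniq R)[r [[Rr /biorbitP[h [g ->]]] _]].
  by exists r, h, g.
- move=> r r' h h' g g' Rr Rr' e.
  exact: (@biorbit_rep_eq C R _ _ r r' h h' g g' Rr Rr' e).
- exact: equi_spaceP.
move=> al Ral M.
have memP := @swap_homP k C _ _ al (resr al (tagged v)) (resl al (tagged w)) M.
split=> [/memP HM h g | HM].
  by rewrite /aut_hom !aut1E cmp1m cmpm1; apply: HM.
apply/memP=> g h gh; apply: HM.
by rewrite /aut_hom !aut1E cmp1m cmpm1.
Qed.

End EquivariantDimension.

(** * The free cover *)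

Section FreeCoverFunctor.

Variables (C : eicat) (R : unfact_reps C).
Hypothesis skelC : skeletal C.
Local Notation Q := (cover_quiver R).
Local Notation D := (free_cover R).

Fixpoint path_eval (v w : Q0 Q) (p : qpath v w) : hset p -> Hom (v : Ob C) w :=
  match p in qpath _ w return hset p -> Hom (v : Ob C) w with
  | pnil => fun h => h
  | pcons a p' => fun z : bprod_type (abis a) (hset p') =>
      val (repr z).1 ∘ path_eval (repr z).2
  end.

(** Evaluation reads the representative chosen by [repr]; another one moves a group element across
    the product, which composition absorbs. Left compatibility is a premise because its own proof,
    by induction on paths, uses this lemma. *)
Lemma path_eval_pair_lact (a : Q1 Q) v (p : qpath v (src a)) (f : abis a)
    (m : hset p) :
    (forall (h : vgrp (src a)) (n : hset p),
       path_eval (lact h n) = (h : autC _) ∘ path_eval n) ->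
  path_eval (p := pcons p) (bpair f m) = val f ∘ path_eval m.
Proof.
move=> eval_lact; have [h [fE mE]] := bpair_rep f m.
change (val (repr (bpair f m)).1 ∘ path_eval (repr (bpair f m)).2 =
  val f ∘ path_eval m).
have -> : val f = val (repr (bpair f m)).1 ∘ (h : autC _).
  by rewrite [in LHS]fE.
by rewrite mE eval_lact cmpA.
Qed.

Lemma path_eval_lact (v w : Q0 Q) (p : qpath v w) (h : vgrp w) (m : hset p) :
  path_eval (lact h m) = (h : autC (w : Ob C)) ∘ path_eval m.
Proof.
elim: p h m => [|a p IHp] h m; first by [].
have [f [m1 ->]] := bpairP m.
rewrite [lact h _](bprod_lactE h f m1) !path_eval_pair_lact //.
by rewrite cmpA.
Qed.

Lemma path_eval_pair (a : Q1 Q) v (p : qpath v (src a)) (f : abis a)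
    (m : hset p) :
  path_eval (p := pcons p) (bpair f m) = val f ∘ path_eval m.
Proof. exact/path_eval_pair_lact/path_eval_lact. Qed.

Lemma path_eval_hmul (v w : Q0 Q) (p : qpath v w) u (q : qpath u v)
    (m : hset p) (n : hset q) :
  path_eval (hmul m n) = path_eval m ∘ path_eval n.
Proof.
elim: p m => [|a p IHp] m; first exact: path_eval_lact.
have [f [m1 ->]] := bpairP m; rewrite (hmulE f m1 n) !path_eval_pair IHp.
by rewrite cmpA.
Qed.

Definition cover_eval (x y : Ob C) (f : @Hom D x y) : Hom x y :=
  path_eval (tagged f).

Lemma cover_eval_cmp (x y z : Ob C) (g : @Hom D y z) (f : @Hom D x y) :
  cover_eval (g ∘ f) = cover_eval g ∘ cover_eval f.
Proof. exact: path_eval_hmul. Qed.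

Lemma cover_eval_id (x : Ob C) : cover_eval (@idH D x) = idH x.
Proof. by []. Qed.


Definition cover_aut (x : Ob C) (g : autC x) : @Hom D x x :=
  @gen_arr Q x x (@pnil Q x) g.

Lemma cover_autM x (g h : autC x) :
  cover_aut (g * h)%g = cover_aut g ∘ cover_aut h.
Proof. by []. Qed.

(** By acyclicity the only path from x to x is trivial. The endpoint is first generalized to some w
    = x so that the path can be destructed. *)
Lemma cover_aut_bij x : bijective (@cover_aut x).
Proof.
exists (@cover_eval x x) => [g // | f].
suffices [h ->]: exists h : autC x, f = cover_aut h by [].
suffices nil_loop (w : Q0 Q) (p : qpath (x : Q0 Q) w) (m : hset p) (e : w = x) :
    exists h : autC x, eq_rect w (@gen_hom Q x) (gen_arr m) x e = cover_aut h.
  by case: f => p m; exact: (nil_loop x p m erefl).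
case: p m e => [|a p] m e; first by exists m; rewrite (eq_irrelevance e erefl).
have /negP[] := acyclicQ a; rewrite [X in connect _ X _]e.
exact: (parrows_connect p).1.
Qed.

Lemma cover_skeletal : skeletal D.
Proof.
move=> x y f /existsP[g /andP[/eqP gf /eqP fg]]; apply: (skelC (f := cover_eval f)).
apply/existsP; exists (cover_eval g).
by rewrite -!cover_eval_cmp gf fg !cover_eval_id !eqxx.
Qed.

Definition arrow_arr (a : Q1 Q) (f : abis a) : @Hom D (src a) (tgt a) :=
  gen_cons f (@gen_id Q (src a)).

Lemma cover_eval_arrow a (f : abis a) : cover_eval (arrow_arr f) = val f.
Proof. by rewrite /cover_eval path_eval_pair cmpm1. Qed.

Lemma gen_cons_aut (a : Q1 Q) (f : abis a) (h : vgrp (src a)) :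
  gen_cons f (@gen_arr Q _ _ (pnil (src a)) h) =
  gen_cons (ract f h) (@gen_id Q (src a)).
Proof.
congr existT; apply/bpairE; exists (h^-1)%g.
by split; [rewrite -ractM mulgV ract1 | apply/esym/mulVg].
Qed.

(** A nontrivial word is an arrow after a shorter word g. Unfactorizability and acyclicity make g an
    automorphism, which the biset element absorbs. Equality is stated for [Mor] because the
    endpoints of t and of the arrow are not convertible. *)
Lemma unfactorizable_arrow (x y : Ob C) (t : @Hom D x y) : unfactorizable t ->
  exists a, exists f : abis a, @Mor D x y t = @Mor D _ _ (arrow_arr f).
Proof.
refine (@gen_homP Q x (fun y t => @unfactorizable D x y t ->
  exists a, exists f : abis a, @Mor D x y t = @Mor D _ _ (arrow_arr f)) y t _ _).
  by move=> h /(unfactorizable_neq cover_skeletal)/eqP.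
move=> a f g _ unf.
have eq_fg : gen_cons f g = (arrow_arr f : @Hom D _ _) ∘ (g : @Hom D _ _).
  by rewrite /arrow_arr [RHS]gen_cmp_cons gen_cmp1m.
have unf' := unf; rewrite eq_fg in unf'; have {unf' eq_fg} := unf'.
move/(unfactorizable_cmp cover_skeletal)/orP=> [] /eqP e; last first.
  by have /negP[] := acyclicQ a; rewrite -e connect0.
subst x; have [j _ ij] := cover_aut_bij (src a).
exists a, (ract f (j g)); congr (Mor _).
by rewrite -[in LHS](ij g); apply: gen_cons_aut.
Qed.

Definition cover_eval_mor (m : mor D) : mor C := Mor (cover_eval (marr m)).

Definition rep_arrow (x y : Ob C) (r : Hom x y) (Rr : r \in R x y) : Q1 Q :=
  exist _ (Mor r) Rr.

Definition rep_arrow_elt (x y : Ob C) (r : Hom x y) (Rr : r \in R x y)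
    (f : Hom x y) (fr : f \in biorbit r) : abis (rep_arrow Rr) :=
  exist _ f fr.

(** An unfactorizable morphism lies in the orbit of a single representative, so it determines the
    arrow of the cover; membership proofs are boolean, hence equal. *)
Lemma rep_arrow_inj (x y x' y' : Ob C) (r f : Hom x y) (r' f' : Hom x' y')
    (Rr : r \in R x y) (fr : f \in biorbit r)
    (Rr' : r' \in R x' y') (fr' : f' \in biorbit r') :
  Mor f = Mor f' ->
  @Mor D _ _ (arrow_arr (rep_arrow_elt Rr fr)) =
  @Mor D _ _ (arrow_arr (rep_arrow_elt Rr' fr')).
Proof.
move=> ff'; have ex : x = x' := congr1 (@mdom C) ff'.
have ey : y = y' := congr1 (@mcod C) ff'.
subst x' y'; have {}ff' := Mor_inj ff'; subst f'.
have rr' : r = r'.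
  have [h [g fE]] := biorbitP _ _ fr; have [h' [g' fE']] := biorbitP _ _ fr'.
  exact: biorbit_rep_eq Rr Rr' (etrans (esym fE) fE').
by subst r'; rewrite (bool_irrelevance Rr' Rr) (bool_irrelevance fr' fr).
Qed.

Lemma abis_mor_inj (a a' : Q1 Q) (f : abis a) (f' : abis a') :
  Mor (val f) = Mor (val f') :> mor C ->
  @Mor D _ _ (arrow_arr f) = @Mor D _ _ (arrow_arr f').
Proof.
destruct a as [[x [y r]] Rr], a' as [[x' [y' r']] Rr'].
destruct f as [f fr], f' as [f' fr'].
exact: (@rep_arrow_inj x y x' y' r f r' f' Rr fr Rr' fr').
Qed.

Lemma abis_unfactorizable (a : Q1 Q) (f : abis a) : unfactorizable (val f).
Proof.
have /biorbitP[h [g ->]] := valP f.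
apply: (unfactorizable_unitl skelC (h' := (h^-1)%g) (g' := (g^-1)%g)).
- by rewrite -autME mulVg.
- by rewrite -autME mulgV.
exact: rep_unfact (valP a).
Qed.

Lemma cover_eval_val (x y : Ob C) (t : @Hom D x y) a (f : abis a) :
  @Mor D x y t = @Mor D _ _ (arrow_arr f) ->
  Mor (cover_eval t) = Mor (val f) :> mor C.
Proof.
move=> tf.
exact: etrans (congr1 cover_eval_mor tf)
  (congr1 (@Mor C _ _) (cover_eval_arrow f)).
Qed.

Lemma cover_eval_unfactorizable (x y : Ob C) (t : @Hom D x y) :
  unfactorizable t -> unfactorizable (cover_eval t).
Proof.
move=> unf; have [a [f tf]] := unfactorizable_arrow unf.
have : unfactorizable (marr (Mor (val f))) := abis_unfactorizable f.
by rewrite -(cover_eval_val tf).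
Qed.

Lemma cover_eval_inj (x y : Ob C) (t t' : @Hom D x y) :
  unfactorizable t -> unfactorizable t' -> cover_eval t = cover_eval t' -> t = t'.
Proof.
move=> unf unf' tt'; apply: (@Mor_inj D).
have [a [f tf]] := unfactorizable_arrow unf.
have [a' [f' tf']] := unfactorizable_arrow unf'.
rewrite tf tf'; apply: abis_mor_inj.
by rewrite -(cover_eval_val tf) -(cover_eval_val tf') tt'.
Qed.

Lemma cover_eval_surj (x y : Ob C) (f : Hom x y) : unfactorizable f ->
  exists2 t : @Hom D x y, unfactorizable t & cover_eval t = f.
Proof.
move=> unf; have [r [[Rr fr] _]] := rep_uniq R unf.
pose a : Q1 Q := exist _ (Mor r) Rr.
pose f0 : abis a := exist _ f fr.
have f0E : cover_eval (arrow_arr f0 : @Hom D x y) = f := cover_eval_arrow f0.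
exists (arrow_arr f0 : @Hom D x y) => //.
rewrite /unfactorizable skeletal_is_iso; last exact: cover_skeletal.
rewrite (unfactorizable_neq skelC unf) /=.
(* A factorization in the cover evaluates to one of f through the same object z, and by skeletality
   only the objects matter. *)
apply/forallP=> z; apply/forallP=> h; apply/forallP=> g; apply/implyP=> /eqP e.
rewrite !skeletal_is_iso; try exact: cover_skeletal.
apply: (unfactorizable_cmp skelC (g := cover_eval g) (f := cover_eval h)).
have -> : cover_eval g ∘ cover_eval h = f.
  by rewrite -f0E -cover_eval_cmp; congr cover_eval; exact: esym e.
exact: unf.
Qed.

End FreeCoverFunctor.

(** * Equivariant functions on the cover and on the category *)

Section CoverEquivariant.

Variables (k : closedFieldType) (C : eicat) (R : unfact_reps C).
Hypothesis skelC : skeletal C.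
Variable S : forall x : Ob C, irrType k [set: autC x].

Lemma dim_equi_cover (v w : {x : Ob C & S x}) :
  \dim (@equi_space k (free_cover R) (fun x : Ob C => autC x)
    (@cover_aut C R) S v w) =
  \dim (@equi_space k C (fun x => autC x) (@aut_hom C) S v w).
Proof.
apply: (@dim_equivariant_transport k _ _ (autC (tag w)) (autC (tag v))
  (irr_repr (tagged w)) (irr_repr (tagged v)) _ _
  (@unfactorizable C (tag v) (tag w))
  (@unfactorizable (free_cover R) (tag v) (tag w))
  (fun h g f => aut_hom h ∘ f ∘ aut_hom g)
  (fun h g t => cover_aut R h ∘ t ∘ cover_aut R g)
  (@cover_eval C R (tag v) (tag w))).
- exact: equi_spaceP.
- exact: equi_spaceP.
- move=> h g f.
  by apply: (@unfactorizable_iota C skelC (fun x => autC x) (@aut_hom C)) => // z;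
    exists id.
- move=> h g t; apply: (@unfactorizable_iota (free_cover R) (cover_skeletal skelC)
    (fun x : Ob C => autC x) (@cover_aut C R)) => // z.
  exact: cover_aut_bij.
- by move=> h g t; rewrite !cover_eval_cmp.
- exact: cover_eval_unfactorizable.
- exact: cover_eval_inj.
exact: cover_eval_surj.
Qed.

End CoverEquivariant.

Lemma quiver_iso_sym (P P' : quiver) : quiver_iso P P' -> quiver_iso P' P.
Proof.
case=> phi [psi phiK psiK] nphi; exists psi; first by exists phi.
by move=> v w; rewrite -{2}(psiK v) -{2}(psiK w) nphi.
Qed.

Lemma quiver_iso_trans (P P' P'' : quiver) :
  quiver_iso P P' -> quiver_iso P' P'' -> quiver_iso P P''.
Proof.
case=> phi bphi nphi [psi bpsi npsi]; exists (psi \o phi); first exact: bij_comp.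
by move=> v w; rewrite npsi nphi.
Qed.

Theorem theorem1p1 (k : closedFieldType) (C : eicat)
    (skelC : skeletal C) (connC : connected_cat C)
    (invC : forall x : Ob C, (#|{: autC x}|%:R : k) \is a GRing.unit)
    (R : unfact_reps C) (S : forall x : Ob C, irrType k [set: autC x]) :
  quiver_iso (assoc_quiver R S) (ordinary_quiver (cat_alg k C)) /\
  quiver_iso (ordinary_quiver (cat_alg k C))
             (ordinary_quiver (cat_alg k (free_cover R))).
Proof.
(* Invertibility of the group order means that the characteristic does not divide it, the form
   required by Maschke and Wedderburn theory. *)
have charC (x : Ob C) : ([pchar k]^'.-group [set: autC x])%g.
  by rewrite /pgroup cardsT -natf_neq0_pchar -unitfE invC.
have isoC := @ordinary_quiver_cat_alg k C skelC (fun x => autC x) (@aut_hom C)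
  (fun x g h => erefl) (fun x => Bijective (frefl _) (frefl _)) S charC.
have isoD := @ordinary_quiver_cat_alg k (free_cover R) (cover_skeletal skelC)
  (fun x : Ob C => autC x) (@cover_aut C R) (@cover_autM C R) (@cover_aut_bij C R)
  S charC.
split.
  apply: quiver_iso_trans isoC; exists id; first by exists id.
  by move=> v w; apply: dim_equi_space.
apply: quiver_iso_trans (quiver_iso_sym isoC) _.
apply: quiver_iso_trans isoD; exists id; first by exists id.
by move=> v w; apply: dim_equi_cover.
Qed.
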